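(* For each integer $N\ge 3$ let $P_N\subset\mathbb{R}^2$ be the regular polygon with $N$ sides and area $\pi$, and let $B\subset\mathbb{R}^2$ be the unit disk. Then for $N$ sufficiently large, $T(P_N)<T(B)$. In fact, $T(P_N)$ is a strictly increasing function of $N$ and $\lim_{N\to\infty}T(P_N)=T(B)$.
   Context: For a bounded Lipschitz domain $\Omega\subset\mathbb{R}^2$ define $$T(\Omega):=\inf\left\{\frac12\int_\Omega|\nabla u|^2\,dx-\int_\Omega u\,dx:\ u\in H^1(\Omega),\ \int_{\partial\Omega}u\,d\sigma=0\right\}.$$ *)

(* Defs.v *)
From HB Require Import structures.
From mathcomp Require Import all_boot all_order all_algebra.
From mathcomp Require Import all_classical all_reals all_analysis.

Set Implicit Arguments.
Unset Strict Implicit.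
Unset Printing Implicit Defensive.

Import Order.TTheory GRing.Theory Num.Theory.
Import numFieldNormedType.Exports.

Local Open Scope classical_set_scope.
Local Open Scope ring_scope.

(* Mathcomp's norm on [R * R] is the sup norm, so the Euclidean distance is
   spelled out; topological notions do not depend on the choice. *)
Definition edist {R : realType} (x y : R * R) : R :=
  Num.sqrt ((x.1 - y.1) ^+ 2 + (x.2 - y.2) ^+ 2).

(* [maxe 0] is there because the supremum of the empty set is [-oo]. *)
Definition ediam {R : realType} (A : set (R * R)) : \bar R :=
  maxe 0%E (ereal_sup [set (edist p.1 p.2)%:E | p in A `*` A]).

Definition hausdorff1_delta {R : realType} (delta : R) (A : set (R * R)) :
    \bar R :=
  ereal_inf [set (\sum_(0 <= k <oo) ediam (U k))%E | U in
    [set U : (set (R * R))^nat |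
      (forall k, (ediam (U k) <= delta%:E)%E) /\ A `<=` \bigcup_k U k]].

Definition hausdorff1 {R : realType} (A : set (R * R)) : \bar R :=
  ereal_sup [set hausdorff1_delta delta A | delta in [set d : R | 0 < d]].

(* A copy of a type in which every set is measurable, so that [mu_ext] ranges
   over arbitrary covers. *)
Definition all_measurable (T : Type) : Type := T.

Section all_measurable.
Variable T : pointedType.
HB.instance Definition _ := Pointed.copy (all_measurable T) T.
HB.instance Definition _ := @isMeasurable.Build default_measure_display
  (all_measurable T) discrete_measurable discrete_measurable0
  discrete_measurableC discrete_measurableU.
End all_measurable.

Section hausdorff_outer_measure.
Context {R : realType}.
Implicit Types (A B : set (R * R)) (delta : R).
Local Open Scope ereal_scope.

Lemma ediam_ge0 A : 0 <= ediam A.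
Proof. by rewrite /ediam le_max lexx. Qed.

Lemma ediam0 : ediam (set0 : set (R * R)) = 0.
Proof.
rewrite /ediam set0X image_set0 ereal_sup0.
by apply/max_idPl; rewrite leNye.
Qed.

Let gauge delta (A : set (all_measurable (R * R)%type)) : \bar R :=
  if ediam A <= delta%:E then ediam A else +oo.

Let gauge_ge0 delta A : 0 <= gauge delta A.
Proof. by rewrite /gauge; case: ifP => // _; exact: ediam_ge0. Qed.

Let gauge0 delta : (0 < delta)%R -> gauge delta set0 = 0.
Proof. by move=> d0; rewrite /gauge ediam0 lee_fin ltW. Qed.

Let hausdorff1_deltaE delta A :
  hausdorff1_delta delta A =
  @mu_ext _ (all_measurable (R * R)) R (gauge delta) A.
Proof.
apply/eqP; rewrite eq_le; apply/andP; split; apply: le_ereal_inf_tmp => ? /=.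
- move=> [U [_ AU] <-].
  have [Ud|] := pselect (forall k, ediam (U k) <= delta%:E).
    apply: ereal_inf_lbound; exists U => //=.
    by apply: eq_eseriesr => k _; rewrite /gauge Ud.
  move=> /existsNP[k /negP kd].
  rewrite (@eseries_pinfty _ _ xpredT k) ?leey//.
    by move=> n _; rewrite -ltNye (lt_le_trans _ (gauge_ge0 _ _)).
  by rewrite /gauge (negbTE kd).
- move=> [U [Ud AU] <-]; apply: ereal_inf_lbound; exists U => //=.
  by apply: eq_eseriesr => k _; rewrite /gauge Ud.
Qed.

Lemma hausdorff1_0 : hausdorff1 (set0 : set (R * R)) = 0.
Proof.
apply/eqP; rewrite eq_le; apply/andP; split.
  apply: ge_ereal_sup => _ [d /= d0 <-].
  by rewrite hausdorff1_deltaE mu_ext0 //; exact: gauge0.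
apply: ereal_sup_ubound; exists 1%R => //=.
by rewrite hausdorff1_deltaE mu_ext0 //; exact: gauge0.
Qed.

Lemma hausdorff1_ge0 A : 0 <= hausdorff1 A.
Proof.
apply: (@le_trans _ _ (hausdorff1_delta 1%R A)); last first.
  by apply: ereal_sup_ubound; exists 1%R => //=.
by rewrite hausdorff1_deltaE; exact: mu_ext_ge0.
Qed.

Lemma le_hausdorff1 :
  {homo (@hausdorff1 R) : A B / A `<=` B >-> A <= B}.
Proof.
move=> A B AB; apply: ge_ereal_sup => _ [d d0 <-].
apply: (@le_trans _ _ (hausdorff1_delta d B)); last first.
  by apply: ereal_sup_ubound; exists d.
by rewrite !hausdorff1_deltaE; exact: le_mu_ext.
Qed.

Lemma hausdorff1_sigma_subadditive : sigma_subadditive (@hausdorff1 R).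
Proof.
move=> F; apply: ge_ereal_sup => _ [d d0 <-].
rewrite hausdorff1_deltaE.
apply: (@le_trans _ _ (
  \sum_(0 <= k <oo) @mu_ext _ (all_measurable (R * R)) R (gauge d) (F k))).
  exact: (@mu_ext_sigma_subadditive _ (all_measurable (R * R)) _ _
    (gauge_ge0 d)).
apply: lee_nneseries => [k _ _|k _]; first exact: mu_ext_ge0.
by apply: ereal_sup_ubound; exists d => //; rewrite hausdorff1_deltaE.
Qed.

HB.instance Definition _ := isOuterMeasure.Build R (R * R)%type
  (@hausdorff1 R) hausdorff1_0 hausdorff1_ge0 le_hausdorff1
  hausdorff1_sigma_subadditive.

End hausdorff_outer_measure.

(* Arc length: the one-dimensional Hausdorff measure on its Caratheodory
   sigma-algebra. *)
Definition hausdorff1_outer {R : realType} :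
  {outer_measure set (R * R) -> \bar R} := @hausdorff1 R.

Definition arclength {R : realType} :
    {measure set (caratheodory_type (@hausdorff1_outer R)) -> \bar R} :=
  (@hausdorff1_outer R :
     set (caratheodory_type (@hausdorff1_outer R)) -> \bar R).

Definition area {R : realType} := (@lebesgue_measure R \x @lebesgue_measure R)%E.

Definition square_integrable d (T : measurableType d) (R : realType)
    (mu : {measure set T -> \bar R}) (D : set T) (f : T -> R) : Prop :=
  measurable_fun D f /\ (\int[mu]_(x in D) (f x ^+ 2)%:E < +oo)%E.

Section torsion.
Context {R : realType}.
Implicit Types (Omega : set (R * R)) (u phi : R * R -> R) (g : R * R -> R * R)
  (tau : R * R -> R).

Definition boundary (A : set (R * R)) : set (R * R) := closure A `\` A°.

Definition dx1 phi : R * R -> R := fun x => 'D_((1, 0) : R * R) phi x.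
Definition dx2 phi : R * R -> R := fun x => 'D_((0, 1) : R * R) phi x.

Definition smooth phi : Prop :=
  forall vs : seq (R * R),
    let h := foldr (fun v f => fun x => 'D_v f x) phi vs in
    continuous h /\ forall x v, derivable h x v.

Definition test_function Omega phi : Prop :=
  let supp := closure [set x | phi x != 0] in
  [/\ smooth phi, compact supp & supp `<=` Omega].

Definition weak_gradient Omega u g : Prop :=
  forall phi, test_function Omega phi ->
    (\int[area]_(x in Omega) (u x * dx1 phi x)) =
      - (\int[area]_(x in Omega) ((g x).1 * phi x)) /\
    (\int[area]_(x in Omega) (u x * dx2 phi x)) =
      - (\int[area]_(x in Omega) ((g x).2 * phi x)).

(* [u] is in H^1(Omega), with weak gradient [g]. *)
Definition H1 Omega u g : Prop :=
  [/\ square_integrable area Omega u,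
      square_integrable area Omega (fun x => (g x).1),
      square_integrable area Omega (fun x => (g x).2) &
      weak_gradient Omega u g].

(* [tau] is the boundary trace of [u], whose weak gradient is [g]: the trace
   operator is the continuous extension to H^1(Omega), with values in
   L^2(boundary), of the restriction of smooth functions to the boundary. *)
Definition trace Omega u g tau : Prop :=
  square_integrable arclength (boundary Omega) tau /\
  exists phi : nat -> R * R -> R,
    [/\ forall n, smooth (phi n),
        (\int[area]_(x in Omega) ((phi n x - u x) ^+ 2)%:E @[n --> \oo] --> 0)%E,
        (\int[area]_(x in Omega) ((dx1 (phi n) x - (g x).1) ^+ 2)%:E
           @[n --> \oo] --> 0)%E,
        (\int[area]_(x in Omega) ((dx2 (phi n) x - (g x).2) ^+ 2)%:E
           @[n --> \oo] --> 0)%E &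
        (\int[arclength]_(x in boundary Omega) ((phi n x - tau x) ^+ 2)%:E
           @[n --> \oo] --> 0)%E].

Definition energy Omega u g : R :=
  2^-1 * \int[area]_(x in Omega) ((g x).1 ^+ 2 + (g x).2 ^+ 2)
  - \int[area]_(x in Omega) u x.

Definition T_functional Omega : \bar R :=
  ereal_inf [set e : \bar R | exists u g tau,
    [/\ H1 Omega u g, trace Omega u g tau,
        \int[arclength]_(x in boundary Omega) tau x = 0 &
        e = (energy Omega u g)%:E]].

End torsion.

Definition convex_hull {R : realType} N (v : 'I_N -> R * R) : set (R * R) :=
  [set x | exists w : 'I_N -> R,
    [/\ forall k, 0 <= w k, \sum_(k < N) w k = 1 &
        x = \sum_(k < N) w k *: v k]].

(* The open region bounded by a regular [N]-gon of center [c], circumradius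
   [rho] and arbitrary orientation [theta]. *)
Definition regular_polygon {R : realType} (N : nat) (P : set (R * R)) : Prop :=
  exists (c : R * R) (rho theta : R), 0 < rho /\
    P = (convex_hull (fun k : 'I_N =>
      (c.1 + rho * cos (theta + 2 * pi * k%:R / N%:R),
       c.2 + rho * sin (theta + 2 * pi * k%:R / N%:R))))°.

Definition unit_disk {R : realType} : set (R * R) :=
  [set x | edist x (0, 0) < 1].

(* Main.v *)
(* For a domain [Om] which splits around a center [c] into congruent sectors,
   integrating along the rays from [c] gives, for smooth [phi],
     int_Om (2 phi + (x - c) . grad phi) dx = rho int_(boundary Om) phi dH^1
   with a constant [rho] (the inradius of a regular polygon, the radius of a
   disk). The identity passes to H^1 functions with their traces. When the
   boundary mean of [u] vanishes, it turns int_Om u into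
   - 1/2 int_Om (x - c) . grad u, and completing the square gives
   T(Om) = - 1/8 int_Om |x - c|^2, attained at u = const - |x - c|^2 / 4.
   Hence T(B) = - pi/16 and T(P_N) = - (pi/16) f(2 pi / N) with
   f(y) = y (2 + cos y) / (3 sin y), which increases on (0, pi) from the
   limit 1 at 0: the numerator of f' vanishes at 0 and has derivative
   2 sin y (y - sin y). *)

From HB Require Import structures.
From mathcomp Require Import all_boot all_order all_algebra.
From mathcomp Require Import all_classical all_reals all_analysis.
From mathcomp Require Import measurable_realfun lra ring.
Require Import Defs.

Set Implicit Arguments.
Unset Strict Implicit.
Unset Printing Implicit Defensive.

Import Order.TTheory GRing.Theory Num.Theory.
Import numFieldNormedType.Exports.

Local Open Scope classical_set_scope.
Local Open Scope ring_scope.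

(** The boundary weight in the identity is [(x - c) . nu]. On a side of a regular polygon it is the
    inradius, on the circle the radius, so a zero boundary mean kills the whole boundary term. The
    same constancy gives [const - |x - c|^2 / 4] a constant normal derivative, the natural boundary
    condition of the constrained problem. Arc length is a Hausdorff measure here, so boundary
    integrals rest on two facts: Borel sets are Caratheodory measurable, and an arc parametrized by
    arc length carries Lebesgue measure to arc length. The identity for smooth functions uses
    one-dimensional tools only: a rotation to each sector, Fubini in the coordinates [(x, x s)] with
    Jacobian [x], the fundamental theorem of calculus on each ray, and one substitution in the slope
    [s]. Applied to the constant 1/2 and to [|x - c|^2], it also yields the area and the second
    moment. Polygon and disk thus differ only in the arc bounding a sector. *)

Lemma continuous_composition (T U V : topologicalType) (f : T -> U) (g : U -> V) :
  continuous f -> continuous g -> continuous (g \o f).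
Proof. by move=> cf cg x; apply: continuous_comp; [exact: cf|exact: cg]. Qed.

(** * Borel sets of the plane and the area measure *)

Section borel_plane.
Context {R : realType}.
Notation mR := (measurableTypeR R).

(** Second countability: [U] is the union of the squares with rational centre and rational half-side
    that it contains. *)
Lemma open_measurable_prod (U : set (R * R)) : open U ->
  measurable (U : set (mR * mR)).
Proof.
move=> oU.
pose box (q : rat * rat * rat) : set (mR * mR) :=
  `](ratr q.1.1 - ratr q.2), (ratr q.1.1 + ratr q.2)[ `*`
  `](ratr q.1.2 - ratr q.2), (ratr q.1.2 + ratr q.2)[.
have -> : U = \bigcup_q (if `[< box q `<=` U >] then box q else set0).
  apply/seteqP; split; last first.
    by move=> x [q _]; case: ifPn => // /asboolP qU; exact: qU.
  move=> -[x y] Uxy; have /nbhs_ballP[e /= e0 eU] := oU _ Uxy.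
  (* A square of half-side [d] centred within [d] of the point stays within [2 d < e] of it; the
     bound [e / 4] only keeps [d] positive. *)
  have /rat_in_itvoo[d] : e / 4 < e / 2 by lra.
  rewrite in_itv/= => /andP[d1 d2].
  have /rat_in_itvoo[p] : x - ratr d < x + ratr d by lra.
  rewrite in_itv/= => /andP[p1 p2].
  have /rat_in_itvoo[q] : y - ratr d < y + ratr d by lra.
  rewrite in_itv/= => /andP[q1 q2].
  have bU : box (p, q, d) `<=` U.
    move=> -[x' y'] []; rewrite /= !in_itv/= => /andP[a1 a2] /andP[b1 b2].
    by apply: eU; split; rewrite /ball/= ltr_norml; apply/andP; split; lra.
  exists (p, q, d); first by [].
  rewrite asboolT//.
  by split; rewrite /= in_itv/=; apply/andP; split; lra.
apply: countable_bigcupT_measurable => // q; case: ifPn => // _.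
by apply: measurableX;  exact: measurable_itv.
Qed.

Lemma closed_measurable_prod (U : set (R * R)) : closed U ->
  measurable (U : set (mR * mR)).
Proof.
move=> cU; rewrite -(setCK U); apply: measurableC.
by apply: open_measurable_prod; exact: closed_openC.
Qed.

Lemma continuous_measurable_prod (f : R * R -> R) : continuous f ->
  measurable_fun [set: mR * mR] (f : mR * mR -> R).
Proof.
move=> cf; apply: (measurability _ (@RGenOpens.measurableE R)) => _ [_ [a [b ->]] <-].
rewrite setTI; apply: open_measurable_prod.
by apply: open_comp => // x _; exact: cf.
Qed.

Lemma continuous_pair (T : topologicalType) (f g : T -> R) :
  continuous f -> continuous g -> continuous (fun x => (f x, g x)).
Proof.
by move=> cf cg x; apply: (cvg_pair (cf x) (cg x)).
Qed.

Lemma continuous_measurable_plane (f : R * R -> R * R) : continuous f ->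
  measurable_fun [set: mR * mR] (f : mR * mR -> mR * mR).
Proof.
move=> cf; apply/(measurable_fun_pairP (f : mR * mR -> mR * mR)); split;
  apply: continuous_measurable_prod => x; apply: continuous_comp.
- exact: cf.
- exact: cvg_fst.
- exact: cf.
- exact: cvg_snd.
Qed.

Lemma area_setX (A B : set mR) : measurable A -> measurable B ->
  area (A `*` B) = (lebesgue_measure A * lebesgue_measure B)%E.
Proof. by move=> mA mB; rewrite /area product_measure1E. Qed.

Lemma measurable_plane_set1 (p : R * R) : measurable ([set p] : set (mR * mR)).
Proof.
have -> : [set p] = [set p.1] `*` [set p.2].
  by apply/seteqP; split => [x ->//|[x y] /= [-> ->]]; case: p.
by apply: measurableX; exact: measurable_set1.
Qed.

Lemma area_set1 (p : R * R) : area [set p] = 0.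
Proof.
have -> : [set p] = [set p.1] `*` [set p.2].
  by apply/seteqP; split => [x ->//|[x y] /= [-> ->]]; case: p.
rewrite area_setX; [|exact: measurable_set1..].
by rewrite lebesgue_measure_set1 mul0e.
Qed.

Lemma area_bounded (A : set (R * R)) (K : R) : measurable (A : set (mR * mR)) ->
  (forall x, A x -> `|x.1| <= K /\ `|x.2| <= K) -> (area A < +oo)%E.
Proof.
move=> mA AK.
apply: (@le_lt_trans _ _ (area (`[-K, K]%classic `*` `[-K, K]%classic))).
  apply: le_measure; rewrite ?inE//.
    by apply: measurableX;  exact: measurable_itv.
  by move=> x /AK[]; rewrite !ler_norml => ? ?; split; rewrite /= in_itv/=.
rewrite area_setX; [|exact: measurable_itv..].
rewrite !lebesgue_measure_itv/= lte_fin; case: ifP => _; last by rewrite mul0e.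
by rewrite -!EFinB -EFinM ltry.
Qed.



End borel_plane.

(** * Euclidean distance and diameters *)

Section euclidean_distance.
Context {R : realType}.
Implicit Types (p q : R * R) (A B : set (R * R)).

Lemma edist_ge0 p q : 0 <= edist p q.
Proof. exact: sqrtr_ge0. Qed.

Lemma edist_sqr p q : edist p q ^+ 2 = (p.1 - q.1) ^+ 2 + (p.2 - q.2) ^+ 2.
Proof. by rewrite sqr_sqrtr// addr_ge0 ?sqr_ge0. Qed.

Lemma edist_fst p q : `|p.1 - q.1| <= edist p q.
Proof.
rewrite -(ler_sqr (normr_ge0 _)) ?nnegrE ?edist_ge0//.
by rewrite edist_sqr real_normK ?num_real// lerDl sqr_ge0.
Qed.

Lemma edist_snd p q : `|p.2 - q.2| <= edist p q.
Proof.
rewrite -(ler_sqr (normr_ge0 _)) ?nnegrE ?edist_ge0//.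
by rewrite edist_sqr real_normK ?num_real// lerDr sqr_ge0.
Qed.

Lemma le_edist_ediam A p q : A p -> A q -> ((edist p q)%:E <= ediam A)%E.
Proof.
move=> Ap Aq; rewrite /ediam le_max; apply/orP; right.
by apply: ereal_sup_ubound; exists (p, q).
Qed.

Lemma ediam_le A (r : R) : 0 <= r ->
  (forall p q, A p -> A q -> edist p q <= r) -> (ediam A <= r%:E)%E.
Proof.
move=> r0 Ar; rewrite /ediam ge_max lee_fin r0/=.
by apply: ge_ereal_sup => _ [[p q] [/= Ap Aq] <-]; rewrite lee_fin Ar.
Qed.

Lemma le_ediam A B : A `<=` B -> (ediam A <= ediam B)%E.
Proof.
move=> AB; rewrite /ediam ge_max; rewrite le_max lexx/=.
rewrite le_max; apply/orP; right.
by apply: ge_ereal_sup => _ [[p q] [/= /AB Bp /AB Bq] <-];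
  apply: ereal_sup_ubound; exists (p, q).
Qed.

End euclidean_distance.

(** * Borel sets are measurable for arc length *)

Section hausdorff_borel.
Context {R : realType}.
Notation mR := (measurableTypeR R).
Notation H1 := (@hausdorff1_outer R).
Implicit Types (A B X : set (R * R)).

Lemma le_hausdorff1_delta (d e : R) A : d <= e ->
  (hausdorff1_delta e A <= hausdorff1_delta d A)%E.
Proof.
move=> de; apply: le_ereal_inf_tmp => _ [U [Ud AU] <-].
apply: ereal_inf_lbound; exists U => //; split => // k.
by apply: le_trans (Ud k) _; rewrite lee_fin.
Qed.

Lemma hausdorff1_delta_le (d : R) A : 0 < d -> (hausdorff1_delta d A <= hausdorff1 A)%E.
Proof. by move=> d0; apply: ereal_sup_ubound; exists d. Qed.

(** As [l] is 1-Lipschitz, a set of diameter at most [d], less than the gap, cannot meet both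
    [l <= b] and [b' <= l]. Cutting each member of a cover into its two sides therefore leaves one
    side empty, and no diameter is counted twice. *)
Lemma hausdorff1_delta_separated (l : R * R -> R) (b b' d : R) A B :
  (forall p q, l p - l q <= edist p q) -> 0 < d -> d < b' - b ->
  (forall p, A p -> l p <= b) -> (forall p, B p -> b' <= l p) ->
  (hausdorff1_delta d A + hausdorff1_delta d B <=
   hausdorff1_delta d (A `|` B))%E.
Proof.
move=> l1 d0 db Ab Bb; apply: le_ereal_inf_tmp => _ [U [Ud ABU] <-].
pose UA k := U k `&` [set p | l p <= b].
pose UB k := U k `&` [set p | b' <= l p].
apply: (@le_trans _ _ (\sum_(0 <= k <oo) (ediam (UA k) + ediam (UB k)))%E).
  rewrite nneseriesD; [|by move=> *; exact: ediam_ge0..].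
  apply: leeD; apply: ereal_inf_lbound.
  - exists UA => //; split => [k|p Ap].
      by apply: le_trans (Ud k); apply: le_ediam; exact: subIsetl.
    by have [k _ Ukp] := ABU p (or_introl Ap); exists k => //; split => //; exact: Ab.
  - exists UB => //; split => [k|p Bp].
      by apply: le_trans (Ud k); apply: le_ediam; exact: subIsetl.
    by have [k _ Ukp] := ABU p (or_intror Bp); exists k => //; split => //; exact: Bb.
apply: lee_nneseries => [k _ _|k _]; first by rewrite adde_ge0// ediam_ge0.
have [->|/set0P[p [Up lp]]] := eqVneq (UA k) set0.
  by rewrite ediam0 add0e; apply: le_ediam; exact: subIsetl.
have [->|/set0P[q [Uq lq]]] := eqVneq (UB k) set0.
  by rewrite ediam0 adde0; apply: le_ediam; exact: subIsetl.
have := le_trans (le_edist_ediam Uq Up) (Ud k); rewrite lee_fin => h.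
by exfalso; have := l1 q p; move: lp lq h db => /=; clear; lra.
Qed.

Lemma hausdorff1_separated (l : R * R -> R) (b b' : R) A B :
  (forall p q, l p - l q <= edist p q) -> b < b' ->
  (forall p, A p -> l p <= b) -> (forall p, B p -> b' <= l p) ->
  (hausdorff1 A + hausdorff1 B <= hausdorff1 (A `|` B))%E.
Proof.
move=> l1 bb Ab Bb.
have [Hoo|] := eqVneq (hausdorff1 (A `|` B)) +oo%E; first by rewrite Hoo leey.
rewrite -ltey => Hfin.
have fA : hausdorff1 A \is a fin_num.
  rewrite ge0_fin_numE ?hausdorff1_ge0//; apply: le_lt_trans Hfin.
  by apply: le_hausdorff1; exact: subsetUl.
(* The suprema over the mesh are taken separately for [A] and [B]; the meshes [d] and [e] are
   compared at a common [m], finer than both and than the gap. *)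
have step d e : 0 < d -> 0 < e ->
    (hausdorff1_delta d A + hausdorff1_delta e B <= hausdorff1 (A `|` B))%E.
  move=> d0 e0; pose m := Num.min (Num.min d e) ((b' - b) / 2).
  have m0 : 0 < m by rewrite !lt_min d0 e0/= divr_gt0// subr_gt0.
  have [md me] : m <= d /\ m <= e.
    by split; rewrite /m !ge_min lexx ?orbT.
  have mb : m < b' - b.
    by rewrite /m gt_min; apply/orP; right; lra.
  apply: le_trans (hausdorff1_delta_le _ m0).
  apply: le_trans (hausdorff1_delta_separated l1 m0 mb Ab Bb).
  by apply: leeD; exact: le_hausdorff1_delta.
have step2 d : 0 < d -> (hausdorff1_delta d A + hausdorff1 B <= hausdorff1 (A `|` B))%E.
  move=> d0; have [fd|] := boolP (hausdorff1_delta d A \is a fin_num).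
    rewrite addeC -leeBrDr//; apply: ge_ereal_sup => _ [e /= e0 <-].
    by rewrite leeBrDr// addeC step.
  rewrite fin_numE negb_and !negbK => /orP[/eqP->|/eqP dA].
    by rewrite addNye leNye.
  by have := hausdorff1_delta_le A d0; rewrite dA leye_eq => /eqP hA; rewrite hA in fA.
have fB : hausdorff1 B \is a fin_num.
  rewrite ge0_fin_numE ?hausdorff1_ge0//; apply: le_lt_trans Hfin.
  by apply: le_hausdorff1; exact: subsetUr.
rewrite -leeBrDr//; apply: ge_ereal_sup => _ [e /= e0 <-].
by rewrite leeBrDr// step2.
Qed.

(* The slabs between consecutive levels [a - 1 / (j + 1)] have summable mass,
   because slabs two apart are separated. *)
Lemma caratheodory_halfplane (l : R * R -> R) (a : R) :
  (forall p q, l p - l q <= edist p q) ->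
  H1.-caratheodory [set p | l p < a].
Proof.
move=> l1; apply: le_caratheodory_measurable => X.
have [Hoo|] := eqVneq (H1 X) +oo%E; first by rewrite Hoo leey.
rewrite -ltey => Hfin.
pose b j : R := a - j.+1%:R^-1.
have bS j : b j < b j.+1.
  by rewrite /b ltrD2l ltrN2 ltf_pV2 ?posrE// ltr_nat.
pose A := [set p | l p < a].
pose Xb j := X `&` [set p | l p <= b j].
pose f j := H1 (Xb j).
pose B j := X `&` [set p | b j < l p <= b j.+1].
pose g j := H1 (B j).
have g0 j : (0 <= g j)%E by exact: hausdorff1_ge0.
have fX j : (f j <= H1 X)%E by apply: le_hausdorff1; exact: subIsetl.
have fg j : (f j + g j.+1 <= f j.+2)%E.
  have sub : (X `&` [set p | l p <= b j]) `|` B j.+1 `<=` X `&` [set p | l p <= b j.+2].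
    move=> p [[Xp /= lp]|[Xp /= /andP[_ ?]]]; split => //=.
    by apply: (le_trans lp); apply: ltW; apply: lt_trans (bS j) (bS _).
  apply: le_trans (le_hausdorff1 sub).
  apply: (hausdorff1_separated l1 (bS j)) => p []//= _ /andP[? _].
  exact: ltW.
have sumg n : (\sum_(0 <= j < n) g j.+1 <= H1 X + H1 X)%E.
  (* Slabs of one parity add up inside [f n], those of the other inside [f n.+1]; the induction
     advances both parities through [fg]. *)
  suff h : (\sum_(0 <= j < n) g j.+1 <= f n + f n.+1)%E.
    by apply: le_trans h _; apply: leeD.
  elim: n => [|n IH]; first by rewrite big_geq// adde_ge0// hausdorff1_ge0.
  rewrite big_nat_recr//=; apply: le_trans (leeD IH (lexx _)) _.
  by rewrite -addeA addeC -addeA leeD// addeC.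
have sumoo : (\sum_(0 <= j <oo) g j.+1 < +oo)%E.
  apply: (@le_lt_trans _ _ (H1 X + H1 X)%E); last by rewrite lte_add_pinfty.
  by apply: lime_le; [apply: is_cvg_nneseries => *; exact: g0|exact: nearW].
have tail := nneseries_tail_cvg sumoo (fun k _ => g0 k.+1).
(* The tail vanishes, so it suffices to prove the inequality with the tail added to [H1 X], for
   every [N]. *)
have cvgX : (H1 X + \sum_(N <= k <oo) g k.+1)%E @[N --> \oo] --> H1 X.
  rewrite -[X in _ --> X]adde0; apply: cvgeD => //; last exact: cvg_cst.
  by rewrite fin_num_adde_defl.
apply: (@cvge_to_ge _ _ _ _ _ _ _ cvgX); apply: nearW => N.
have XA : (H1 (X `&` A) <= f N.+1 + \sum_(N <= k <oo) g k.+1)%E.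
  apply: (@le_trans _ _ (H1 (Xb N.+1 `|`
      \bigcup_(k in ~` `I_N) B k.+1))); last first.
    apply: le_trans (outer_measureU2 _ _ _) _; apply: leeD => //.
    exact: outer_measure_sigma_subadditive_tail.
  apply: le_hausdorff1 => p [Xp /= lpa].
  have [lN|lN] := leP (l p) (b N.+1); [by left|right].
  have exb : exists j, l p <= b j.
    have ap : 0 < a - l p by rewrite subr_gt0.
    have [k _ kP] := near_infty_natSinv_lt (PosNum ap).
    have /= kp := kP k (leqnn k); exists k.
    by rewrite /b lerBrDr -lerBrDl ltW.
  (* The least level that reaches [p] has index above [N.+1]; by minimality [p] lies in the slab
     just below that level. *)
  case: (ex_minnP exb) => -[|m] lpm mP.
    have := lt_le_trans lN lpm; rewrite ltNge => /negP[].
    suff : {homo b : i j / (i <= j)%N >-> i <= j} by apply.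
    by apply: homo_leq => [//|? ? ?|?]; [exact: le_trans|exact: ltW].
  have mN : (N.+1 <= m)%N.
    rewrite leqNgt; apply/negP => mN; have := lt_le_trans lN lpm.
    rewrite ltNge => /negP[].
    suff : {homo b : i j / (i <= j)%N >-> i <= j} by apply.
    by apply: homo_leq => [//|? ? ?|?]; [exact: le_trans|exact: ltW].
  case: m lpm mP mN => [//|m] lpm mP mN.
  exists m; first by apply/negP; rewrite -leqNgt.
  split => //=; rewrite lpm andbT ltNge; apply/negP => /mP.
  by rewrite ltnn.
apply: le_trans (leeD XA (lexx _)) _.
rewrite addeAC leeD//.
apply: (@le_trans _ _ (H1 (Xb N.+1 `|` (X `&` ~` A)))).
  apply: (@hausdorff1_separated l (b N.+1) a) => //.
  - by rewrite /b ltrBlDr ltrDl invr_gt0.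
  - by move=> p [].
  - by move=> p [_ /= /negP]; rewrite -leNgt.
by apply: le_hausdorff1 => p [[]|[]].
Qed.

Notation cara := (caratheodory_type (@hausdorff1_outer R)).

Lemma measurable_fst_cara : measurable_fun [set: cara] (fst : cara -> mR).
Proof.
apply: (measurability _ (@RGenInftyO.measurableE R)) => _ [_ [a ->] <-].
rewrite setTI.
rewrite (_ : _ @^-1` _ = [set p : R * R | p.1 < a]); last first.
  by apply/seteqP; split => p /=; rewrite in_itv.
apply: caratheodory_halfplane => p q.
by apply: le_trans (edist_fst p q); exact: ler_norm.
Qed.

Lemma measurable_snd_cara : measurable_fun [set: cara] (snd : cara -> mR).
Proof.
apply: (measurability _ (@RGenInftyO.measurableE R)) => _ [_ [a ->] <-].
rewrite setTI.
rewrite (_ : _ @^-1` _ = [set p : R * R | p.2 < a]); last first.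
  by apply/seteqP; split => p /=; rewrite in_itv.
apply: caratheodory_halfplane => p q.
by apply: le_trans (edist_snd p q); exact: ler_norm.
Qed.

(** The two coordinates are 1-Lipschitz, so their open half-planes are Caratheodory measurable, and
    these generate the product sigma-algebra. *)
Lemma measurable_id_cara : measurable_fun [set: cara] (id : cara -> mR * mR).
Proof.
apply/(measurable_fun_pairP (id : cara -> mR * mR)); split.
- exact: measurable_fst_cara.
- exact: measurable_snd_cara.
Qed.

Lemma measurable_cara A : measurable (A : set (mR * mR)) -> measurable (A : set cara).
Proof. by move=> mA; have := measurable_id_cara measurableT mA; rewrite setTI. Qed.

Lemma measurable_fun_cara d (T : measurableType d) (D : set (R * R))
    (f : R * R -> T) :
  measurable_fun (D : set (mR * mR)) f -> measurable (D : set (mR * mR)) ->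
  measurable_fun (D : set cara) f.
Proof.
by move=> mf mD _ Y mY; apply: measurable_cara; exact: mf.
Qed.

End hausdorff_borel.

(** * Hausdorff measure of an arc parametrized by arc length *)

Section rectifiable_curve.
Context {R : realType}.
Notation mR := (measurableTypeR R).
Notation cara := (caratheodory_type (@hausdorff1_outer R)).
Variables (g : R -> R * R) (f : R * R -> R) (a b : R).
Hypothesis ab : a < b.
Hypothesis fK : {in `[a, b], cancel g f}.
Hypothesis mf : measurable_fun [set: mR * mR] (f : mR * mR -> mR).
Hypothesis cg : continuous g.
Hypothesis g1 : {in `[a, b] &, forall s t, edist (g s) (g t) <= `|s - t|}.
Hypothesis gexp : forall e : R, 0 < e -> exists2 d : R, 0 < d &
  {in `[a, b] &, forall s t, edist (g s) (g t) <= d ->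
    `|s - t| <= (1 + e) * edist (g s) (g t)}.

Let inab (u v : R) : a <= u -> v <= b -> `[u, v] `<=` `[a, b].
Proof. by move=> au vb; apply: subset_itv; rewrite bnd_simp. Qed.

(** Equal pieces of the parameter interval have images no wider than the pieces, because [g] is
    1-Lipschitz; their widths add up to [v - u]. *)
Lemma hausdorff1_curve_le (u v : R) : a <= u -> u <= v -> v <= b ->
  (hausdorff1 (g @` `[u, v]) <= (v - u)%:E)%E.
Proof.
move=> au uv vb; apply: ge_ereal_sup => _ [d /= d0 <-].
have [n nd] : exists n, (v - u) / n.+1%:R <= d.
  exists (Num.truncn ((v - u) / d)).
  rewrite ler_pdivrMr// -ler_pdivrMl// mulrC ltW//.
  exact: truncnS_gt.
pose w := (v - u) / n.+1%:R.
have w0 : 0 <= w by rewrite divr_ge0// subr_ge0.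
(* Empty sets complete the finite cover to a sequence; they have diameter 0 and do not change the
   sum. *)
pose U k : set (R * R) :=
  if (k < n.+1)%N then g @` (`[u + k%:R * w, u + k.+1%:R * w] `&` `[u, v]) else set0.
have Uw k : (ediam (U k) <= (if (k < n.+1)%N then w else 0)%:E)%E.
  rewrite /U; case: ifP => [kn|_]; last by rewrite ediam0.
  apply: ediam_le => // p q [s [/= sk suv] <-] [t [/= tk tuv] <-].
  apply: (le_trans (g1 _ _)); rewrite ?inE/=.
  - exact: (inab au vb).
  - exact: (inab au vb).
  move: sk tk; rewrite !in_itv/= -natr1 mulrDl mul1r => /andP[s1 s2] /andP[t1 t2].
  by rewrite ler_norml; apply/andP; split; lra.
apply: (@le_trans _ _ (\sum_(0 <= k <oo) ediam (U k))%E).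
  apply: ereal_inf_lbound; exists U => //; split.
    move=> k; apply: le_trans (Uw k) _; rewrite lee_fin.
    by case: ifP => _ //; exact: ltW.
  move=> _ [s suv <-].
  have [k kn sk] : exists2 k, (k < n.+1)%N & s \in `[u + k%:R * w, u + k.+1%:R * w].
    have find m : s <= u + m.+1%:R * w ->
        exists2 k, (k < m.+1)%N & s \in `[u + k%:R * w, u + k.+1%:R * w].
      elim: m => [|m IH] sm.
        exists 0%N => //; move: suv; rewrite /= !in_itv/= sm mul0r addr0 andbT.
        by case/andP.
      have [sm'|sm'] := leP s (u + m.+1%:R * w).
        by have [k km ks] := IH sm'; exists k => //; exact: ltn_trans km _.
      by exists m.+1 => //; rewrite in_itv/= sm ltW.
    apply: find; rewrite mulrC divfK ?pnatr_eq0//.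
    by move: suv; rewrite /= in_itv/=; lra.
  by exists k => //; rewrite /U kn; exists s.
apply: (@le_trans _ _ (\sum_(0 <= k <oo) (if (k < n.+1)%N then w else 0)%:E)%E).
  by apply: lee_nneseries => // k _ _; exact: ediam_ge0.
rewrite (nneseries_split 0 n.+1); last first.
  by move=> k _; rewrite lee_fin; case: ifP.
rewrite add0n [X in (_ + X)%E]eseries0; last first.
  by move=> i ni _; rewrite ltnNge ni.
rewrite adde0 big_mkord.
under eq_bigr do rewrite ltn_ord.
rewrite sumEFin lee_fin sumr_const card_ord -(mulr_natr w) divfK ?pnatr_eq0//.
Qed.

(** At a mesh fine enough for [gexp], the parameters sent into one set of a cover spread over at
    most [1 + e] times its diameter. Intervals of these lengths cover [I], and [e] is arbitrary. *)
Lemma hausdorff1_curve_ge (I : set R) : measurable (I : set mR) ->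
  I `<=` `[a, b] -> (lebesgue_measure (I : set mR) <= hausdorff1 (g @` I))%E.
Proof.
move=> mI Iab.
have step (e : R) : 0 < e ->
    (lebesgue_measure (I : set mR) <= (1 + e)%:E * hausdorff1 (g @` I))%E.
  move=> e0; have [d d0 dP] := gexp e0.
  have e1 : 0 < 1 + e by rewrite addr_gt0.
  apply: (@le_trans _ _ ((1 + e)%:E * hausdorff1_delta d (g @` I))%E); last first.
    by rewrite lee_pmul2l// hausdorff1_delta_le.
  rewrite /hausdorff1_delta -ereal_inf_pZl//.
  apply: le_ereal_inf_tmp => _ [_ [U [Ud IU] <-] <-].
  rewrite -nneseriesZl; last by move=> k _; exact: ediam_ge0.
  pose J k := [set s | I s /\ U k (g s)].
  pose D k := (1 + e) * fine (ediam (U k)).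
  have Dfin k : (ediam (U k) \is a fin_num)%E.
    by rewrite ge0_fin_numE ?ediam_ge0// (le_lt_trans (Ud k))// ltry.
  have DE k : ((1 + e)%:E * ediam (U k) = (D k)%:E)%E by rewrite /D EFinM fineK.
  have D0 k : 0 <= D k by rewrite /D mulr_ge0 ?fine_ge0 ?ediam_ge0// ltW.
  pose K k : set mR := if `[< J k !=set0 >] then `[inf (J k), inf (J k) + D k]%classic else set0.
  have mK k : measurable (K k).
    by rewrite /K; case: ifP => _ //; exact: measurable_itv.
  have JK k : J k `<=` K k.
    move=> t Jt; have J0 : J k !=set0 by exists t.
    have JD s : J k s -> t - D k <= s.
      move=> [Is Us]; case: Jt => It Ut.
      have sab : s \in `[a, b] by exact: Iab.
      have tab : t \in `[a, b] by exact: Iab.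
      have gd : ((edist (g t) (g s))%:E <= ediam (U k))%E by exact: le_edist_ediam.
      have h : edist (g t) (g s) <= d.
        by rewrite -lee_fin (le_trans gd).
      have := dP _ _ tab sab h.
      have : (1 + e) * edist (g t) (g s) <= D k.
        by apply: ler_wpM2l; [exact: ltW|rewrite -lee_fin fineK].
      move=> h1 h2; have := ler_norm (t - s); lra.
    rewrite /K asboolT//= in_itv/=; apply/andP; split.
      apply: ge_inf => //; exists (t - D k); exact: JD.
    by rewrite -lerBlDr; apply: lb_le_inf.
  have lK k : (lebesgue_measure (K k) <= (D k)%:E)%E.
    rewrite /K; case: ifP => _; last by rewrite measure0 lee_fin.
    rewrite lebesgue_measure_itv/=; case: ifP => _; last by rewrite lee_fin.
    by rewrite -EFinB lee_fin; lra.
  apply: (@le_trans _ _ (\sum_(0 <= k <oo) lebesgue_measure (K k))%E).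
    apply: measure_sigma_subadditive => // s Is.
    have [k _ Uk] : (\bigcup_k U k) (g s) by apply: IU; exists s.
    by exists k => //; apply: JK; split.
  apply: lee_nneseries => [k _ _|k _]; first exact: measure_ge0.
  by rewrite DE.
have [Hoo|] := eqVneq (hausdorff1 (g @` I)) +oo%E; first by rewrite Hoo leey.
rewrite -ltey => Hfin.
have Hf : hausdorff1 (g @` I) \is a fin_num.
  by rewrite ge0_fin_numE// hausdorff1_ge0.
apply/lee_addgt0Pr => e e0.
pose h := fine (hausdorff1 (g @` I)).
have h0 : 0 <= h by rewrite fine_ge0// hausdorff1_ge0.
have hE : hausdorff1 (g @` I) = h%:E by rewrite fineK.
(* With relative error [e / (h + 1)] the absolute error is [e h / (h + 1)], at most [e]; the added 1
   covers [h = 0]. *)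
have h1 : 0 < h + 1 by rewrite ltr_wpDl.
apply: le_trans (step (e / (h + 1)) (divr_gt0 e0 h1)) _.
rewrite hE -EFinM -EFinD lee_fin mulrDl mul1r lerD2l.
by rewrite mulrAC ler_pdivrMr// ler_wpM2l// ?ltW//; lra.
Qed.

(** Half-open, so that arcs of neighbouring sectors share no endpoint. *)
Let G := g @` `[a, b[.

Let G_preim (A : set R) : G `&` f @^-1` A = g @` (`[a, b[ `&` A).
Proof.
apply/seteqP; split => [_ [[s sab <-] /= As]|_ [s [sab As] <-]].
  by exists s => //; split => //; move: As; rewrite fK//; exact: subset_itv_co_cc.
split; first by exists s.
by rewrite /= fK//; exact: subset_itv_co_cc.
Qed.

(** The arc is the set of fixed points of the Borel map [g \o f] whose parameter lies in [[a,
    b[]. *)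
Lemma measurable_curve : measurable (G : set (mR * mR)).
Proof.
have -> : G = [set p | g (f p) = p] `&` f @^-1` `[a, b[.
  apply/seteqP; split => [_ [s sab <-]|p [/= gfp fp]].
    have fs : f (g s) = s by rewrite fK//; exact: subset_itv_co_cc.
    by split; rewrite /= fs.
  by exists (f p).
have mgf : measurable_fun [set: mR * mR] ((g \o f) : mR * mR -> mR * mR).
  apply/(measurable_fun_pairP (g \o f : mR * mR -> mR * mR)); split.
  - apply: (measurableT_comp (f := fst \o g : mR -> mR)) mf.
    apply: continuous_measurable_fun => x; apply: continuous_comp; first exact: cg.
    exact: cvg_fst.
  - apply: (measurableT_comp (f := snd \o g : mR -> mR)) mf.
    apply: continuous_measurable_fun => x; apply: continuous_comp; first exact: cg.
    exact: cvg_snd.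
have [m1 m2] := (measurable_fun_pairP _).1 mgf.
apply: measurableI; last first.
  by rewrite -[X in measurable X]setTI; apply: mf => //; exact: measurable_itv.
have -> : [set p | g (f p) = p] =
    ((fun p : mR * mR => (g (f p)).1 == p.1) @^-1` [set true]) `&`
    ((fun p : mR * mR => (g (f p)).2 == p.2) @^-1` [set true]).
  apply/seteqP; split => [p /= e|p [/eqP e1 /eqP e2]].
    by split; rewrite /= e eqxx.
  by rewrite /= [LHS]surjective_pairing e1 e2; case: (p).
apply: measurableI; rewrite -[X in measurable X]setTI.
- by apply: (measurable_fun_eqr m1 measurable_fst).
- by apply: (measurable_fun_eqr m2 measurable_snd).
Qed.

(** The default [a - 1] lies outside [[a, b[], so the preimage of a subset of [[a, b[] contains only
    points of the arc. *)
Let F0 (p : cara) : mR := if p \in G then f p else a - 1.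

Let mF0 : measurable_fun [set: cara] F0.
Proof.
apply: (measurable_fun_ifT (f := fun p : cara => p \in G)).
- apply: (measurable_fun_bool true) => //.
  rewrite setTI (_ : _ @^-1` _ = G); first exact: measurable_cara measurable_curve.
  by apply/seteqP; split => p /=; [move/set_mem|move/mem_set->].
- by apply: measurable_fun_cara.
- exact: measurable_cst.
Qed.

Let nu0 : {measure set mR -> \bar R} :=
  measure_function_pushforward__canonical__measure_function_Measure
    (@arclength R) mF0.

Let F_preim (A : set R) : A `<=` `[a, b[ -> F0 @^-1` A = g @` A.
Proof.
move=> Aab; have -> : g @` A = G `&` f @^-1` A.
  by rewrite G_preim; congr (_ @` _); apply/esym/setIidr.
apply/seteqP; split => p /=; rewrite /F0; case: ifPn.
- by rewrite inE => Gp Ap; split.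
- by move=> _ /Aab; rewrite /= in_itv/= lerBrDr -lerBrDl subrr ler10.
- by move=> _ [].
- by move=> /negP + [Gp]; rewrite inE.
Qed.

(** The upper bound is known for intervals only. Uniqueness of Lebesgue measure extends the equality
    from half-open intervals to Borel sets. *)
Lemma hausdorff1_curve (A : set R) : measurable (A : set mR) -> A `<=` `[a, b[ ->
  hausdorff1 (g @` A) = lebesgue_measure (A : set mR).
Proof.
move=> mA Aab.
have mab : measurable (`[a, b[%classic : set mR) by exact: measurable_itv.
(* Lebesgue measure is glued on outside [[a, b[], so that [nu] can be compared with Lebesgue measure
   on the whole line. *)
pose nu := measure_add (mrestr nu0 mab)
  (mrestr (@lebesgue_measure R) (measurableC mab)).
have nuE B : nu B = (hausdorff1 (g @` (B `&` `[a, b[)) +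
    lebesgue_measure (B `\` `[a, b[))%E.
  rewrite /nu /measure_add /msum !big_ord_recl big_ord0 adde0/=.
  rewrite /mrestr/= setDE; congr (_ + _)%E.
  by rewrite /nu0/= /pushforward F_preim//; exact: subIsetr.
suff : lebesgue_measure A = nu A.
  rewrite nuE (_ : A `\` _ = set0); last by rewrite setD_eq0.
  by rewrite measure0 adde0 (setIidl Aab) => ->.
apply: lebesgue_measure_unique => // _ [[x y] /= _ <-].
rewrite -[RHS]/(nu `]x, y]%classic) nuE.
have mxy : measurable (`]x, y]%classic : set mR) by exact: measurable_itv.
rewrite -{1}(setUIDK `]x, y]%classic `[a, b[%classic) measureU//; last 3 first.
- exact: measurableI.
- exact: measurableD.
- by rewrite setDE setIACA setICr setI0.
congr (_ + _)%E; apply/eqP; rewrite eq_le; apply/andP; split.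
  apply: hausdorff1_curve_ge; first exact: measurableI.
  by move=> s [_]; exact: subset_itv_co_cc.
have [->|/set0P[s [sxy sab]]] := eqVneq (`]x, y] `&` `[a, b[) set0.
  by rewrite image_set0 measure0 hausdorff1_0.
(* The intersection lies between []u, v[] and [[u, v]], which have the same length. *)
pose u := Num.max x a; pose v := Num.min y b.
have uv : u <= v.
  move: sxy sab; rewrite /= !in_itv/= => /andP[xs sy] /andP[as_ sb].
  by rewrite /u /v ge_max !le_min; apply/andP; split; apply/andP; split; lra.
apply: (@le_trans _ _ (hausdorff1 (g @` `[u, v]))).
  apply: le_hausdorff1; apply: image_subset => t [].
  rewrite /= !in_itv/= => /andP[xt ty] /andP[at_ tb].
  by rewrite /u /v ge_max le_min; apply/andP; split; apply/andP; split; lra.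
have au : a <= u by rewrite /u le_max lexx orbT.
have vb : v <= b by rewrite /v ge_min lexx orbT.
apply: le_trans (hausdorff1_curve_le au uv vb) _.
apply: (@le_trans _ _ (lebesgue_measure (`]u, v[%classic : set mR))).
  rewrite lebesgue_measure_itv/= lte_fin; case: ltP => [//|vu].
  by rewrite lee_fin subr_le0.
apply: le_measure; rewrite ?inE; [exact: measurable_itv|exact: measurableI|].
move=> t; rewrite /= !in_itv/= /u /v gt_max lt_min => /andP[/andP[xt at_] /andP[ty tb]].
by split; apply/andP; split; lra.
Qed.

Lemma hausdorff1_curveT : hausdorff1 G = (b - a)%:E.
Proof.
rewrite /G hausdorff1_curve; [|exact: measurable_itv|by []].
by rewrite lebesgue_measure_itv/= lte_fin ab.
Qed.

(** Both sides are integrals against the pushforward of arc length under [F0], which is Lebesgue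
    measure on subsets of [[a, b[]. *)
Lemma integral_curve (phi : R * R -> R) :
  measurable_fun [set: mR * mR] (phi : mR * mR -> R) ->
  arclength.-integrable (G : set cara) (EFin \o phi) ->
  (\int[arclength]_(x in (G : set cara)) (phi x)%:E =
   \int[lebesgue_measure]_(s in `[a, b[) (phi (g s))%:E)%E.
Proof.
move=> mphi iphi.
have mab : measurable (`[a, b[%classic : set mR) by exact: measurable_itv.
have FG : F0 @^-1` `[a, b[ = G by rewrite F_preim.
have gF (x : cara) : G x -> g (F0 x) = x.
  move=> Gx; rewrite /= /F0 mem_set//; case: Gx => s sab <-.
  by rewrite fK//; exact: subset_itv_co_cc.
have mg : measurable_fun [set: mR] (phi \o g : mR -> R).
  apply: (measurableT_comp (f := phi : mR * mR -> R)) => //.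
  apply/(measurable_fun_pairP (g : mR -> mR * mR)); split.
  - apply: continuous_measurable_fun => x; apply: continuous_comp; first exact: cg.
    exact: cvg_fst.
  - apply: continuous_measurable_fun => x; apply: continuous_comp; first exact: cg.
    exact: cvg_snd.
transitivity (\int[pushforward (@arclength R) F0]_(s in `[a, b[) (phi (g s))%:E)%E.
  rewrite (integral_pushforward mF0 (mu := @arclength R)) //.
  - rewrite FG; apply: eq_integral => x /set_mem Gx /=.
    by rewrite gF.
  - exact/measurable_EFinP.
  - rewrite FG; apply: eq_integrable iphi => // [|x /set_mem Gx /=].
      exact: measurable_cara measurable_curve.
    by rewrite gF.
apply: (eq_measure_integral _ (m1 := nu0)) => A mA Aab.
by rewrite -[RHS](hausdorff1_curve mA Aab)// -F_preim.
Qed.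

End rectifiable_curve.

(** * Rotations and slope coordinates *)

Section area_preserving.
Context {R : realType}.
Notation mR := (measurableTypeR R).

Lemma measurable_affine (x b : R) : measurable_fun [set: mR] (fun s : mR => x * s + b : mR).
Proof.
by apply: measurable_funD => //; apply: measurable_funM.
Qed.

(** The left side is a measure in [A] with the right value on half-open intervals, so uniqueness
    applies. *)
Lemma lebesgue_measure_affine (x b : R) (A : set mR) : 0 < x -> measurable A ->
  (x%:E * lebesgue_measure ((fun s : mR => (x * s + b)%R : mR) @^-1` A))%E = lebesgue_measure A.
Proof.
move=> x0 mA; have maff := measurable_affine x b.
pose nu0 : {measure set mR -> \bar R} :=
  measure_function_pushforward__canonical__measure_function_Measure
    (@lebesgue_measure R) maff.
pose nu : {measure set mR -> \bar R} := mscale (NngNum (ltW x0)) nu0.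
rewrite -[LHS]/(nu A); apply/esym/lebesgue_measure_unique => // _ [[u v] /= _ <-].
rewrite /nu/= /mscale/= /nu0/= /pushforward.
rewrite (_ : _ @^-1` _ = `](u - b) / x, (v - b) / x]%classic); last first.
  apply/seteqP; split => s /=; rewrite !in_itv/=.
    by rewrite ltr_pdivrMr// ler_pdivlMr// ltrBlDr lerBrDr mulrC.
  by rewrite ltr_pdivrMr// ler_pdivlMr// ltrBlDr lerBrDr mulrC.
rewrite !lebesgue_measure_itv/= !lte_fin ltr_pM2r ?invr_gt0// ltrD2r.
case: ifP => _; last by rewrite mule0.
rewrite -!EFinB -EFinM -mulrBl mulrC divfK ?gt_eqF//.
by congr (_%:E); lra.
Qed.

Lemma ge0_integral_scale (x : R) (f : mR -> \bar R) : 0 < x ->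
  measurable_fun [set: mR] f -> (forall s, 0 <= f s)%E ->
  (\int[lebesgue_measure]_y f y = \int[lebesgue_measure]_s (x%:E * f (x * s)%R))%E.
Proof.
move=> x0 mf f0; have maff := measurable_affine x 0.
pose nu0 : {measure set mR -> \bar R} :=
  measure_function_pushforward__canonical__measure_function_Measure
    (@lebesgue_measure R) maff.
have mfx : measurable_fun [set: mR] (fun s : mR => f (x * s)).
  apply: (measurableT_comp mf (g := fun s : mR => x * s : mR)).
  exact: measurable_funM.
rewrite ge0_integralZl//; last by rewrite lee_fin ltW.
transitivity (\int[mscale (NngNum (ltW x0)) nu0]_y f y)%E.
  apply: eq_measure_integral => A mA _.
  by rewrite -[LHS](lebesgue_measure_affine 0 x0 mA).
rewrite ge0_integral_mscale//=; congr (_ * _)%E.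
rewrite (ge0_integral_pushforward maff lebesgue_measure)//.
by apply: eq_integral => s _ /=; rewrite addr0.
Qed.

Definition area_preserving (f : R * R -> R * R) :=
  measurable_fun [set: mR * mR] (f : mR * mR -> mR * mR) /\
  forall A, measurable (A : set (mR * mR)) -> area (f @^-1` A) = area A.

Lemma area_preserving_comp f g :
  area_preserving f -> area_preserving g -> area_preserving (f \o g).
Proof.
move=> [mf pf] [mg pg]; split; first exact: measurableT_comp mf mg.
move=> A mA; rewrite comp_preimage pg ?pf//.
by rewrite -[X in measurable X]setTI; exact: mf.
Qed.

Lemma area_preserving_swap : area_preserving (fun p => (p.2, p.1)).
Proof.
have msw : measurable_fun [set: mR * mR] ((fun p => (p.2, p.1)) : mR * mR -> mR * mR).
  by apply: measurable_fun_pair; [exact: measurable_snd|exact: measurable_fst].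
split => // A mA.
pose nu : {measure set (mR * mR) -> \bar R} :=
  measure_function_pushforward__canonical__measure_function_Measure
    (@area R) msw.
rewrite -[LHS]/(nu A); apply/esym/product_measure_unique => //.
move=> B C mB mC; rewrite /nu/= /pushforward.
rewrite (_ : _ @^-1` _ = C `*` B); last by apply/seteqP; split => -[x y] [].
by rewrite -[LHS]/(area (C `*` B)) area_setX// muleC.
Qed.

(** Each vertical section is merely translated, and [area] integrates the lengths of these
    sections. *)
Lemma area_preserving_vshift (h : R -> R) : measurable_fun [set: mR] (h : mR -> mR) ->
  area_preserving (fun p => (p.1, p.2 + h p.1)).
Proof.
move=> mh.
have msh : measurable_fun [set: mR * mR]
    ((fun p => (p.1, p.2 + h p.1)) : mR * mR -> mR * mR).
  apply: measurable_fun_pair; first exact: measurable_fst.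
  apply: measurable_funD; first exact: measurable_snd.
  by apply: (measurableT_comp mh); exact: measurable_fst.
split => // A mA.
rewrite /area /product_measure1; apply: eq_integral => x _ /=.
have mxA : measurable (xsection A x : set mR) by exact: measurable_xsection.
rewrite -(lebesgue_measure_affine (h x) ltr01 mxA) mul1e; congr lebesgue_measure.
by apply/seteqP; split => y; rewrite /xsection/= !inE/= mul1r.
Qed.

Lemma area_preserving_hshift (h : R -> R) : measurable_fun [set: mR] (h : mR -> mR) ->
  area_preserving (fun p => (p.1 + h p.2, p.2)).
Proof.
move=> mh; have sw := area_preserving_swap.
exact: (area_preserving_comp sw (area_preserving_comp (area_preserving_vshift mh) sw)).
Qed.

Definition rotate (a : R) (p : R * R) : R * R :=
  (cos a * p.1 - sin a * p.2, sin a * p.1 + cos a * p.2).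

Definition frame (c : R * R) (a : R) (p : R * R) : R * R :=
  (c.1 + (rotate a p).1, c.2 + (rotate a p).2).

Lemma rotateD a b p : rotate (a + b) p = rotate a (rotate b p).
Proof. by rewrite /rotate cosD sinD/=; congr (_, _); ring. Qed.

(* A rotation by an angle which is not a multiple of [pi] is a product of
   three shears. *)
Lemma area_preserving_rotate a : area_preserving (rotate a).
Proof.
(* The factor [k] is [- tan (b / 2)]; the middle shear has factor [sin b]. *)
have main b : sin b != 0 -> area_preserving (rotate b).
  move=> sb; pose k := (cos b - 1) / sin b.
  have lin (l : R) : measurable_fun [set: mR] (fun s : mR => l * s : mR).
    exact: measurable_funM.
  have -> : rotate b = (fun p => (p.1 + k * p.2, p.2)) \o
      ((fun p => (p.1, p.2 + sin b * p.1)) \o (fun p => (p.1 + k * p.2, p.2))).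
    apply/funext => -[x y]; rewrite /rotate /k/=.
    have /eqP := cos2Dsin2 b; rewrite -subr_eq0 => /eqP cs.
    congr (_, _).
      have -> : - (sin b * y) = ((cos b - 1) * (1 + cos b) / sin b) * y.
        have -> : (cos b - 1) * (1 + cos b) = - (sin b) ^+ 2.
          by apply/eqP; rewrite -subr_eq0 -cs; apply/eqP; ring.
        by rewrite expr2; field.
      by field.
    by field.
  by apply: area_preserving_comp; [|apply: area_preserving_comp];
    [exact: area_preserving_hshift|exact: area_preserving_vshift|
     exact: area_preserving_hshift].
have [sa|] := eqVneq (sin a) 0; last exact: main.
have /eqP := cos2Dsin2 a; rewrite sa expr0n/= addr0 sqrf_eq1 => /orP[|] /eqP ca.
  have -> : rotate a = id.
    by apply/funext => -[x y]; rewrite /rotate sa ca/=; congr (_, _); ring.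
  by split => //; exact: measurable_id.
(* Half turn: [sin (a / 2) = 0] would make [cos a] the square of [cos (a / 2)], which cannot be
   -1. *)
have -> : rotate a = rotate (a / 2) \o rotate (a / 2).
  by apply/funext => p /=; rewrite -rotateD -splitr.
suff s2 : sin (a / 2) != 0 by apply: area_preserving_comp; exact: main.
apply/eqP => s2; move: ca; rewrite [a in cos a]splitr cosD s2 mulr0 subr0 => h.
by have := sqr_ge0 (cos (a / 2)); rewrite expr2 h lerNr oppr0 ler10.
Qed.

Lemma area_preserving_frame c a : area_preserving (frame c a).
Proof.
have -> : frame c a = (fun p => (p.1 + c.1, p.2)) \o
    ((fun p => (p.1, p.2 + c.2)) \o rotate a).
  by apply/funext => p; rewrite /frame/=; congr (_, _); rewrite addrC.
apply: area_preserving_comp; first exact: (area_preserving_hshift (h := cst c.1)).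
apply: area_preserving_comp; last exact: area_preserving_rotate.
exact: (area_preserving_vshift (h := cst c.2)).
Qed.

Lemma integral_area_preserving f (D : set (R * R)) (h : R * R -> R) :
  area_preserving f -> measurable (D : set (mR * mR)) ->
  measurable_fun [set: mR * mR] (h : mR * mR -> R) ->
  area.-integrable (f @^-1` D : set (mR * mR)) (EFin \o (h \o f)) ->
  (\int[area]_(p in (D : set (mR * mR))) (h p)%:E =
   \int[area]_(p in (f @^-1` D : set (mR * mR))) (h (f p))%:E)%E.
Proof.
move=> [mf pf] mD mh ih.
have e := integral_pushforward mf (mu := @area R) (D := D)
  ((measurable_EFinP _ h).2 mh) ih mD.
rewrite -[RHS]e; apply: eq_measure_integral => A mA _.
by rewrite -[LHS](pf A mA).
Qed.

Lemma measurable_slope :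
  measurable_fun [set: mR * mR] (fun p : mR * mR => (p.1, p.1 * p.2) : mR * mR).
Proof.
apply: measurable_fun_pair; first exact: measurable_fst.
by apply: measurable_funM; [exact: measurable_fst|exact: measurable_snd].
Qed.

(** At a fixed abscissa [x > 0] the substitution [y = x s] scales length by [x], which is the
    Jacobian. Vanishing for [x <= 0] discards the abscissas where this substitution degenerates or
    reverses orientation. *)
Lemma ge0_integral_slope (f : R * R -> \bar R) :
  measurable_fun [set: mR * mR] (f : mR * mR -> \bar R) -> (forall p, 0 <= f p)%E ->
  (forall p, p.1 <= 0 -> f p = 0%E) ->
  (\int[area]_p f p = \int[area]_p (p.1%:E * f (p.1, p.1 * p.2)%R))%E.
Proof.
move=> mf f0 fle0.
have mfs : measurable_fun [set: mR * mR]
    (fun p : mR * mR => p.1%:E * f (p.1, p.1 * p.2)%R)%E.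
  apply: emeasurable_funM; first by apply/measurable_EFinP; exact: measurable_fst.
  exact: measurableT_comp mf measurable_slope.
have fs0 p : (0 <= p.1%:E * f (p.1, p.1 * p.2)%R)%E.
  have [p0|p0] := leP p.1 0; first by rewrite fle0// mule0.
  by rewrite mule_ge0// lee_fin ltW.
rewrite /area fubini_tonelli1// [RHS]fubini_tonelli1//.
apply: eq_integral => x _; rewrite /fubini_F/=.
have [x0|x0] := leP x 0.
  by rewrite !integral0_eq// => y _; rewrite fle0// mule0.
apply: ge0_integral_scale => //.
exact: measurableT_comp mf (pair1_measurable x).
Qed.

(** The slope is the outer variable: each inner integral then runs along a single ray from the
    origin. Positive and negative parts reduce the claim to [ge0_integral_slope], and that lemma for
    the absolute value of [f] provides the integrability that Fubini requires. *)
Lemma integral_slope (f : R * R -> R) :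
  measurable_fun [set: mR * mR] (f : mR * mR -> R) ->
  (forall p, p.1 <= 0 -> f p = 0) ->
  area.-integrable [set: mR * mR] (EFin \o f) ->
  (\int[area]_p (f p)%:E =
   \int[lebesgue_measure]_s \int[lebesgue_measure]_x (x * f (x, x * s)%R)%:E)%E.
Proof.
move=> mf fle0 iff; pose h (p : R * R) := p.1 * f (p.1, p.1 * p.2).
have mh : measurable_fun [set: mR * mR] (h : mR * mR -> R).
  apply: measurable_funM; first exact: measurable_fst.
  exact: measurableT_comp mf measurable_slope.
have ih : area.-integrable [set: mR * mR] (EFin \o h).
  apply/integrableP; split; first exact/measurable_EFinP.
  have /integrableP[_] := iff; rewrite [X in (X < _)%E -> _]ge0_integral_slope.
  - rewrite (eq_integral (fun p : mR * mR => `|(EFin \o h) p|%E))// => p _.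
    rewrite /h/= normrM EFinM.
    have [p0|p0] := leP p.1 0; first by rewrite fle0// normr0 !mule0.
    by rewrite (gtr0_norm p0).
  - by apply: measurableT_comp => //; exact/measurable_EFinP.
  - by [].
  - by move=> p p0 /=; rewrite fle0// normr0.
rewrite -[RHS]/(\int[lebesgue_measure]_s \int[lebesgue_measure]_x (EFin \o h) (x, s))%E.
rewrite (integral21_prod_meas1 ih) -/area.
rewrite [LHS]integralE [RHS]integralE; congr (_ - _)%E.
- rewrite ge0_integral_slope.
  + apply: eq_integral => p _; rewrite /h !funeposE/=.
    have [p0|p0] := leP p.1 0; first by rewrite fle0// mulr0 maxxx mule0.
    by rewrite -!EFin_max -EFinM maxr_pMr ?ltW// mulr0.
  + by apply: measurable_funepos; exact/measurable_EFinP.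
  + by move=> p; exact: funepos_ge0.
  + by move=> p p0; rewrite funeposE/= fle0// maxxx.
- rewrite ge0_integral_slope.
  + apply: eq_integral => p _; rewrite /h !funenegE/=.
    have [p0|p0] := leP p.1 0; first by rewrite fle0// mulr0 oppr0 maxxx mule0.
    by rewrite -!EFin_max -EFinM maxr_pMr ?ltW// mulr0 mulrN.
  + by apply: measurable_funeneg; exact/measurable_EFinP.
  + by move=> p; exact: funeneg_ge0.
  + by move=> p p0; rewrite funenegE/= fle0// oppr0 maxxx.
Qed.

End area_preserving.

(** * Directional calculus of smooth functions *)

Section smooth_functions.
Context {R : realType}.
Implicit Types (phi : R * R -> R) (p v w : R * R).

Lemma smooth_continuous phi : smooth phi -> continuous phi.
Proof. by move=> /(_ [::])[]. Qed.

Lemma smooth_derivable phi p v : smooth phi -> derivable phi p v.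
Proof. by move=> /(_ [::])[_]; exact. Qed.

Lemma smooth_derive phi v : smooth phi -> smooth (fun x => 'D_v phi x).
Proof.
move=> sphi vs; have := sphi (vs ++ [:: v]).
by rewrite foldr_cat.
Qed.

Lemma smooth_derive_continuous phi v :
  smooth phi -> continuous (fun x => 'D_v phi x).
Proof. by move=> /smooth_derive/smooth_continuous. Qed.

Lemma is_derive_line phi p v (d : R) (t : R) :
  is_derive (p + t *: v) v phi d <-> is_derive t 1 (fun x : R => phi (p + x *: v)) d.
Proof.
have e : (fun h : R => h^-1 *: (phi (p + (h *: 1 + t) *: v) - phi (p + t *: v))) =
         (fun h : R => h^-1 *: (phi (h *: v + (p + t *: v)) - phi (p + t *: v))).
  apply/funext => h; congr (_ *: (phi _ - _)).
  by rewrite scalerDl scaler1 addrCA.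
split => -[dd ed]; split.
- by move: dd; rewrite /derivable /= e.
- by move: ed; rewrite /derive /= e.
- by move: dd; rewrite /derivable /= e.
- by move: ed; rewrite /derive /= e.
Qed.

Lemma smooth_is_derive_line phi p v (t : R) : smooth phi ->
  is_derive t 1 (fun x : R => phi (p + x *: v)) ('D_v phi (p + t *: v)).
Proof.
by move=> sphi; apply/is_derive_line/derivableP; exact: smooth_derivable.
Qed.

Lemma continuous_line p v : continuous (fun x : R => p + x *: v).
Proof.
by move=> x; apply: cvgD; [exact: cvg_cst|apply: cvgZr_tmp; exact: cvg_id].
Qed.

Lemma continuous_line_comp (f : R * R -> R) p v : continuous f ->
  continuous (fun x : R => f (p + x *: v)).
Proof.
move=> cf x; have h := @continuous_line p v x.
by apply: (@cvg_comp _ _ _ (fun x : R => p + x *: v) f _ _ _ h); exact: cf.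
Qed.

Lemma smooth_deriveZ phi p v (k : R) : smooth phi -> 'D_(k *: v) phi p = k * 'D_v phi p.
Proof.
move=> sphi; have h := smooth_is_derive_line p v (k * 0) sphi.
have hk : is_derive (0 : R) 1 (fun x : R => k * x) k.
  rewrite (_ : (fun x => k * x) = k \*: (@id R))//.
  by apply: is_derive_eq; rewrite /GRing.scale/= mulr1.
have := @is_derive1_comp _ (fun x : R => phi (p + x *: v)) (fun x : R => k * x) 0 _ _ h hk.
move=> -[_ +]; rewrite mulr0 scale0r addr0 [_ * k]mulrC => <-.
have /is_derive_line := derivableP (@smooth_derivable phi (p + 0 *: (k *: v)) (k *: v) sphi).
rewrite [in RHS]/comp; rewrite !scale0r !addr0 => -[_ <-].
suff -> : (fun x : R => phi (p + x *: (k *: v))) =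
  (fun x : R => phi (p + (k * x) *: v)) by [].
by apply/funext => x /=; rewrite scalerA mulrC.
Qed.

Lemma smooth_mvt phi p v : smooth phi -> exists2 t : R, 0 < t < 1 &
  phi (p + v) - phi p = 'D_v phi (p + t *: v).
Proof.
move=> sphi.
have [||t] := @MVT R (fun x : R => phi (p + x *: v))
    (fun x => 'D_v phi (p + x *: v)) 0 1 ltr01.
- by move=> x _; exact: smooth_is_derive_line.
- apply: continuous_subspaceT => x; apply: continuous_comp.
    exact: continuous_line.
  exact: smooth_continuous.
rewrite in_itv/= subr0 mulr1 scale1r scale0r addr0 => t01 ->.
by exists t.
Qed.

(** [smooth] speaks of directional derivatives only, so linearity in the direction has to be proved.
    The increment along [v + w] is split at [p + h v]; by the mean value theorem the second piece is
    a derivative along [w] at a point tending to [p], and that derivative is continuous. *)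
Lemma smooth_deriveD phi p v w : smooth phi ->
  'D_(v + w) phi p = 'D_v phi p + 'D_w phi p.
Proof.
move=> sphi; apply/cvg_lim => //.
pose A (h : R) := h^-1 *: (phi (h *: v + p) - phi p).
pose B (h : R) := h^-1 *: (phi (h *: w + (h *: v + p)) - phi (h *: v + p)).
have -> : (fun h : R => h^-1 *: ((phi \o shift p) (h *: (v + w)) - phi p)) = A \+ B.
  apply/funext => h; rewrite /A /B /= -scalerDr; congr (_ *: _).
  have -> : h *: (v + w) + p = h *: w + (h *: v + p).
    by rewrite scalerDr (addrC (h *: v)) addrA.
  by ring.
apply: cvgD; first exact: (@smooth_derivable phi p v sphi).
have cD := @smooth_derive_continuous phi w sphi p.
apply/cvgrPdist_lt => e e0.
move: cD => /cvgrPdist_lt/(_ _ e0)/nbhs_ballP[r /= r0 rP].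
(* The intermediate point is within [|h| (|v| + |w|)] of [p]; adding 1 keeps the divisor
   positive. *)
pose M := `|v| + `|w| + 1.
have M0 : 0 < M by rewrite ltr_wpDl// addr_ge0.
near=> h.
have h0 : h != 0 by near: h; exact: nbhs_dnbhs_neq.
have hr : `|h| < r / M.
  near: h; apply: dnbhs0_lt; exact: divr_gt0.
rewrite /B; have [t /andP[t0 t1]] := smooth_mvt (h *: v + p) (h *: w) sphi.
rewrite [X in phi X - _]addrC => ->.
rewrite smooth_deriveZ// [_ *: _]mulrA mulVf// mul1r.
apply: rP; rewrite -ball_normE/=.
have -> : p - (h *: v + p + t *: (h *: w)) = - (h *: (v + t *: w)).
  rewrite opprD [h *: v + p]addrC opprD addrA addrA subrr sub0r -opprD.
  by rewrite scalerDr !scalerA mulrC.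
rewrite normrN normrZ; move: hr; rewrite ltr_pdivlMr//; apply: le_lt_trans.
apply: ler_wpM2l => //; apply: le_trans (ler_normD _ _) _.
rewrite normrZ /M -addrA lerD2l; apply: (@le_trans _ _ `|w|); last by rewrite lerDl.
by rewrite ler_piMl// ger0_norm ?ltW.
Unshelve. all: by end_near. Qed.

Lemma smooth_gradient phi p v : smooth phi ->
  'D_v phi p = v.1 * dx1 phi p + v.2 * dx2 phi p.
Proof.
move=> sphi; rewrite -!smooth_deriveZ// -smooth_deriveD//; congr ('D_ _ _ _).
rewrite [LHS]surjective_pairing [RHS]surjective_pairing.
by congr (_, _); rewrite /= /GRing.scale/=; ring.
Qed.

Lemma integral_derive (F d : R -> R) (a b : R) : a <= b ->
  (forall x : R, is_derive x 1 F (d x)) -> continuous d ->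
  (\int[lebesgue_measure]_(x in `[a, b]) (d x)%:E = (F b - F a)%:E)%E.
Proof.
rewrite le_eqVlt => /predU1P[<- _ _|ab Fd cd].
  by rewrite set_itv1 integral_set1 subrr.
have cF : continuous F.
  move=> x; apply: differentiable_continuous; apply/derivable1_diffP.
  by case: (Fd x).
rewrite (continuous_FTC2 ab (F := F)).
- by rewrite EFinB.
- exact: continuous_subspaceT.
- split; first by move=> x _; case: (Fd x).
  + exact/cvg_at_right_filter/cF.
  + exact/cvg_at_left_filter/cF.
- by move=> x _; rewrite derive1E; case: (Fd x).
Qed.

(* [x F (p + x v)] with [F q = 2 phi q + (q - p) . grad phi q] is the
   derivative of [x ^ 2 phi (p + x v)]. *)
Lemma integral_smooth_ray phi p v (a : R) : smooth phi -> 0 <= a ->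
  (\int[lebesgue_measure]_(x in `[0%R, a])
     (x * (2 * phi (p + x *: v) + x * 'D_v phi (p + x *: v)))%:E =
   (a ^+ 2 * phi (p + a *: v))%:E)%E.
Proof.
move=> sphi a0.
pose F (x : R) := x ^+ 2 * phi (p + x *: v).
pose d (x : R) := x * (2 * phi (p + x *: v) + x * 'D_v phi (p + x *: v)).
have Fd (x : R) : is_derive x 1 F (d x).
  have h := smooth_is_derive_line p v x sphi.
  rewrite /F (_ : (fun x => _) = (@id R) ^+ 2 * (fun x => phi (p + x *: v)))//.
  apply: is_derive_eq; rewrite /d /= /GRing.scale/= expr1.

 rewrite fctE /=; ring.
have cd : continuous d.
  have c1 : continuous (fun x : R => phi (p + x *: v)).
    exact: (continuous_line_comp (smooth_continuous sphi)).
  have c2 : continuous (fun x : R => 'D_v phi (p + x *: v)).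
    exact: (continuous_line_comp (smooth_derive_continuous sphi)).
  move=> x; apply: cvgM; first exact: cvg_id.
  apply: cvgD; first by apply: cvgM; [exact: cvg_cst|exact: c1].
  by apply: cvgM; [exact: cvg_id|exact: c2].
apply: etrans (integral_derive a0 Fd cd) _.
by rewrite /F expr0n/= mul0r subr0.
Qed.

(** A family closed under directional derivatives, which makes its smoothness an induction. It
    contains every explicit function needed later: constants, the minimizer and [|x - c|^2]. *)
Definition quadratic (k m : R) (b p : R * R) : R :=
  k + (b.1 * p.1 + b.2 * p.2) + m * (p.1 ^+ 2 + p.2 ^+ 2).

Lemma is_derive_quadratic k m b p v :
  is_derive p v (quadratic k m b)
    (quadratic (b.1 * v.1 + b.2 * v.2) 0 ((2 * m) *: v) p).
Proof.
rewrite -[p in is_derive p](addr0 p) -(scale0r v); apply/is_derive_line.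
pose c1 := b.1 * v.1 + b.2 * v.2 + 2 * m * (p.1 * v.1 + p.2 * v.2).
pose c2 := m * (v.1 ^+ 2 + v.2 ^+ 2).
have -> : (fun x : R => quadratic k m b (p + x *: v)) =
    (fun x => quadratic k m b p + c1 * x + c2 * x ^+ 2).
  apply/funext => x; rewrite /quadratic /c1 /c2 /=.
  by rewrite /GRing.scale/=; ring.
rewrite (_ : (fun x => _) = cst (quadratic k m b p) + c1 \*: (@id R) + c2 \*: (@id R) ^+ 2)//.
apply: is_derive_eq.
rewrite /quadratic /c1 /= /GRing.scale/= expr1; ring.
Qed.

Lemma smooth_quadratic k m b : smooth (quadratic k m b).
Proof.
have cq k' m' b' : continuous (quadratic k' m' b').
  move=> p; rewrite /quadratic; apply: cvgD; first (apply: cvgD; first exact: cvg_cst).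
    by apply: cvgD; apply: cvgM; [exact: cvg_cst|exact: cvg_fst|exact: cvg_cst|exact: cvg_snd].
  apply: cvgM; first exact: cvg_cst.
  by apply: cvgD; apply: cvgM; [exact: cvg_fst|exact: cvg_fst|exact: cvg_snd|exact: cvg_snd].
move=> vs /=.
have [[[k' m'] b'] ->] : exists kmb : R * R * (R * R),
    foldr (fun v f => fun x => 'D_v f x) (quadratic k m b) vs =
    quadratic kmb.1.1 kmb.1.2 kmb.2.
  elim: vs => [|v vs [[[k' m'] b'] /= ->]]; first by exists (k, m, b).
  exists (b'.1 * v.1 + b'.2 * v.2, 0, (2 * m') *: v); apply/funext => p /=.
  by have [_ ->] := is_derive_quadratic k' m' b' p v.
split; first exact: cq.
by move=> x v; have [] := is_derive_quadratic k' m' b' x v.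
Qed.

End smooth_functions.

(** * Integrals under L^2 convergence on sets of finite measure *)

Section integral_limits.
Context d (T : measurableType d) (R : realType) (mu : {measure set T -> \bar R}).
Implicit Types (D : set T) (f w : T -> R).

Lemma bounded_integrable D f (M : R) : measurable D -> (mu D < +oo)%E ->
  measurable_fun D f -> (forall x, D x -> `|f x| <= M) ->
  mu.-integrable D (EFin \o f).
Proof.
move=> mD muD mf fM; apply: measurable_bounded_integrable => //.
exists M; split; first exact: num_real.
by move=> N MN x Dx; apply: le_trans (fM x Dx) (ltW MN).
Qed.

Lemma square_integrable_integrable D f : measurable D -> (mu D < +oo)%E ->
  square_integrable mu D f -> mu.-integrable D (EFin \o f).
Proof.
move=> mD muD [mf f2].
have mf2 : measurable_fun D (fun x => f x ^+ 2) by exact: measurable_funX.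
apply: (le_integrable mD (g := EFin \o (fun x => 1 + f x ^+ 2))).
- exact/measurable_EFinP.
- move=> x _ /=; rewrite lee_fin [leRHS]ger0_norm ?addr_ge0 ?sqr_ge0//.
  (* From [2 |f| <= 1 + f^2], a dominating function integrable on a set of finite measure. *)
  have := sqr_ge0 (`|f x| - 1); rewrite -(real_normK (num_real (f x))).
  by have := normr_ge0 (f x); nra.
- apply/integrableP; split.
    by apply/measurable_EFinP; exact: measurable_funD.
  rewrite (eq_integral (fun x => 1%:E + (f x ^+ 2)%:E)%E); last first.
    by move=> x _ /=; rewrite ger0_norm ?addr_ge0 ?sqr_ge0.
  rewrite ge0_integralD//.
  - by rewrite integral_cst// mul1e lte_add_pinfty.
  - by move=> x _; rewrite lee_fin sqr_ge0.
  - exact/measurable_EFinP.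
Qed.

Lemma square_integrable_sqr D f : measurable D ->
  square_integrable mu D f -> mu.-integrable D (EFin \o (fun x => f x ^+ 2)).
Proof.
move=> mD [mf f2]; apply/integrableP; split.
  by apply/measurable_EFinP; exact: measurable_funX.
rewrite (eq_integral (fun x => (f x ^+ 2)%:E))// => x _ /=.
by rewrite ger0_norm// sqr_ge0.
Qed.

Lemma integrable_square_integrable D f : measurable_fun D f ->
  mu.-integrable D (EFin \o (fun x => f x ^+ 2)) -> square_integrable mu D f.
Proof.
move=> mf /integrableP[_]; rewrite (eq_integral (fun x => (f x ^+ 2)%:E))//.
by move=> x _ /=; rewrite ger0_norm// sqr_ge0.
Qed.

Lemma square_integrableM D f w (K : R) : measurable D -> measurable_fun D w ->
  (forall x, D x -> `|w x| <= K) ->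
  square_integrable mu D f -> square_integrable mu D (fun x => w x * f x).
Proof.
move=> mD mw wK [mf f2]; split; first exact: measurable_funM.
apply: (@le_lt_trans _ _ (\int[mu]_(x in D) ((K ^+ 2)%:E * (f x ^+ 2)%:E))%E).
  apply: ge0_le_integral => //.
  - by move=> x _; rewrite lee_fin sqr_ge0.
  - by apply/measurable_EFinP; apply: measurable_funX; exact: measurable_funM.
  - by apply: emeasurable_funM => //; apply/measurable_EFinP; exact: measurable_funX.
  - move=> x Dx; rewrite -EFinM lee_fin exprMn ler_wpM2r ?sqr_ge0//.
    rewrite -(real_normK (num_real (w x))).
    by apply: lerXn2r; rewrite ?nnegrE ?(wK x Dx)// (le_trans _ (wK x Dx)).
rewrite ge0_integralZl//; last 3 first.
- by apply/measurable_EFinP; exact: measurable_funX.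
- by move=> x _; rewrite lee_fin sqr_ge0.
- by rewrite lee_fin sqr_ge0.
by rewrite lte_mul_pinfty// lee_fin sqr_ge0.
Qed.

(* For [e > 0], [|a| <= e + a ^ 2 / e]. *)
Lemma cvg_Rintegral_L2 D (f : nat -> T -> R) (g : T -> R) :
  measurable D -> (mu D < +oo)%E ->
  (forall n, mu.-integrable D (EFin \o f n)) -> square_integrable mu D g ->
  (\int[mu]_(x in D) ((f n x - g x) ^+ 2)%:E @[n --> \oo] --> 0)%E ->
  \int[mu]_(x in D) f n x @[n --> \oo] --> \int[mu]_(x in D) g x.
Proof.
move=> mD muD intf g2 fg.
have intg := square_integrable_integrable mD muD g2.
have muDE : mu D = (fine (mu D))%:E by rewrite fineK// ge0_fin_numE.
set m := fine (mu D) in muDE.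
have m0 : 0 <= m by rewrite /m fine_ge0.
apply/cvgrPdist_le => e e0.
(* The final bound is [eta m + eta^-1 eta^2 = eta (m + 1) = e]. *)
pose eta := e / (m + 1).
have m1 : 0 < m + 1 by rewrite ltr_wpDl.
have eta0 : 0 < eta by rewrite divr_gt0.
have small : \forall n \near \oo,
    (\int[mu]_(x in D) ((f n x - g x) ^+ 2)%:E < (eta ^+ 2)%:E)%E.
  have lt0 : (0 < (eta ^+ 2)%:E :> \bar R)%E by rewrite lte_fin exprn_gt0.
  by have := fg _ (open_ereal_lt' lt0).
near=> n.
have sm : (\int[mu]_(x in D) ((f n x - g x) ^+ 2)%:E < (eta ^+ 2)%:E)%E.
  by near: n.
have intfg : mu.-integrable D (EFin \o (fun x => f n x - g x)).
  by have := integrableB mD (intf n) intg; apply: eq_integrable.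
have mfg : measurable_fun D (fun x => f n x - g x).
  by apply/measurable_EFinP; exact: measurable_int intfg.
rewrite distrC -RintegralB//; rewrite -lee_fin EFin_normr_Rintegral//.
apply: le_trans (le_abse_integral mu mD _) _; first exact/measurable_EFinP.
apply: (@le_trans _ _ (\int[mu]_(x in D)
    (eta%:E + (eta^-1)%:E * ((f n x - g x) ^+ 2)%:E))%E).
  apply: ge0_le_integral => //.
  - by apply: measurableT_comp => //; exact/measurable_EFinP.
  - apply: emeasurable_funD => //; apply: emeasurable_funM => //.
    by apply/measurable_EFinP; exact: measurable_funX.
  - move=> x _; rewrite -EFinM -EFinD lee_fin; set a := f n x - g x.
    have [ae|ea] := leP `|a| eta.
      by rewrite (le_trans ae)// lerDl mulr_ge0 ?sqr_ge0// invr_ge0 ltW.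
    apply: (@le_trans _ _ (eta^-1 * a ^+ 2)); last by rewrite lerDr ltW.
    rewrite ler_pdivlMl// -[a ^+ 2](real_normK (num_real a)) expr2.
    by rewrite ler_wpM2r// ltW.
rewrite ge0_integralD//; last 3 first.
- by move=> x _; rewrite lee_fin ltW.
- by move=> x _; rewrite -EFinM lee_fin mulr_ge0 ?sqr_ge0// invr_ge0 ltW.
- apply: emeasurable_funM => //.
  by apply/measurable_EFinP; exact: measurable_funX.
rewrite integral_cst// ge0_integralZl//; last 3 first.
- by apply/measurable_EFinP; exact: measurable_funX.
- by move=> x _; rewrite lee_fin sqr_ge0.
- by rewrite lee_fin invr_ge0 ltW.
rewrite [X in (_ * X + _)%E]muDE.
apply: (@le_trans _ _ (eta%:E * m%:E + (eta^-1)%:E * (eta ^+ 2)%:E)%E).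
  by rewrite leeD2l// lee_pmul2l// ?lte_fin ?invr_gt0// ltW.
rewrite -!EFinM -EFinD lee_fin expr2 mulKf ?gt_eqF//.
by rewrite -[X in _ + X]mulr1 -mulrDr /eta divfK ?gt_eqF.
Unshelve. all: by end_near. Qed.

(** A weight bounded by [K] enlarges the squared L^2 error by at most [K^2]. *)
Lemma cvg_Rintegral_L2M D w (K : R) (f : nat -> T -> R) (g : T -> R) :
  measurable D -> (mu D < +oo)%E -> measurable_fun D w ->
  (forall x, D x -> `|w x| <= K) ->
  (forall n, mu.-integrable D (EFin \o f n)) -> square_integrable mu D g ->
  (\int[mu]_(x in D) ((f n x - g x) ^+ 2)%:E @[n --> \oo] --> 0)%E ->
  \int[mu]_(x in D) (w x * f n x) @[n --> \oo] --> \int[mu]_(x in D) (w x * g x).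
Proof.
move=> mD muD mw wK intf g2 fg.
have mf n : measurable_fun D (f n).
  by apply/measurable_EFinP; exact: measurable_int (intf n).
have [mg _] := g2.
apply: cvg_Rintegral_L2 => //.
- move=> n; have bw : [bounded w x | x in D].
    exists K; split; first exact: num_real.
    by move=> N KN x Dx; apply: le_trans (wK x Dx) (ltW KN).
  have := integrableMl mD (intf n) mw bw; apply: eq_integrable => // x _ /=.
  by rewrite -EFinM mulrC.
- exact: (square_integrableM mD mw wK g2).
apply: (@squeeze_cvge _ _ _ _ (cst 0%E) _
    (fun n => (K ^+ 2)%:E * \int[mu]_(x in D) ((f n x - g x) ^+ 2)%:E)%E).
- near=> n; apply/andP; split.
    by apply: integral_ge0 => x _; rewrite lee_fin sqr_ge0.
  have mfg : measurable_fun D (fun x => (f n x - g x) ^+ 2).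
    by apply: measurable_funX; exact: measurable_funB.
  rewrite -ge0_integralZl//; last 3 first.
  + exact/measurable_EFinP.
  + by move=> x _; rewrite lee_fin sqr_ge0.
  + by rewrite lee_fin sqr_ge0.
  apply: ge0_le_integral => //.
  + by move=> x _; rewrite lee_fin sqr_ge0.
  + apply/measurable_EFinP; apply: measurable_funX.
    by apply: measurable_funB; exact: measurable_funM.
  + by apply: emeasurable_funM => //; exact/measurable_EFinP.
  + move=> x Dx; rewrite -EFinM lee_fin -mulrBr exprMn ler_wpM2r ?sqr_ge0//.
    rewrite -(real_normK (num_real (w x))).
    by apply: lerXn2r; rewrite ?nnegrE ?(wK x Dx)// (le_trans _ (wK x Dx)).
- exact: cvg_cst.
- by rewrite -[X in _ --> X](mule0 (K ^+ 2)%:E); apply: cvgeZl.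
Unshelve. all: by end_near. Qed.

End integral_limits.

Section plane_integrability.
Context {R : realType}.
Notation mR := (measurableTypeR R).
Notation cara := (caratheodory_type (@hausdorff1_outer R)).

Lemma continuous_bounded_box (f : R * R -> R) (K : R) : continuous f ->
  exists M, forall p, `|p.1| <= K -> `|p.2| <= K -> `|f p| <= M.
Proof.
move=> cf; have [K0|K0] := ltP K 0.
  by exists 0 => p pK; exfalso; have := normr_ge0 p.1; lra.
pose B : set (R * R) := `[-K, K]%classic `*` `[-K, K]%classic.
have inB (p : R * R) : `|p.1| <= K -> `|p.2| <= K -> B p.
  by rewrite !ler_norml => h1 h2; split; rewrite /= in_itv/=.
have cB : compact B by apply: compact_setX; exact: segment_compact.
have [||M _ MP] := @compact_EVT_max (R * R)%type R (fun p => `|f p|) B _ cB.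
- by exists (0, 0); apply: inB; rewrite /= normr0.
- apply: continuous_subspaceT => p.
  by apply: cvg_norm; exact: cf.
by exists `|f M| => p p1 p2; apply: MP; rewrite inE; exact: inB.
Qed.

Lemma continuous_area_integrable (A : set (R * R)) (f : R * R -> R) (K : R) :
  measurable (A : set (mR * mR)) ->
  (forall x, A x -> `|x.1| <= K /\ `|x.2| <= K) -> continuous f ->
  area.-integrable (A : set (mR * mR)) (EFin \o f).
Proof.
move=> mA AK cf; have [M fM] := continuous_bounded_box K cf.
apply: (@bounded_integrable _ _ _ _ _ _ M) => //.
- exact: area_bounded AK.
- by apply: measurable_funTS; exact: continuous_measurable_prod.
- by move=> x /AK[]; exact: fM.
Qed.

Lemma continuous_arclength_integrable (A : set (R * R)) (f : R * R -> R) (K : R) :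
  measurable (A : set (mR * mR)) -> (hausdorff1 A < +oo)%E ->
  (forall x, A x -> `|x.1| <= K /\ `|x.2| <= K) -> continuous f ->
  arclength.-integrable (A : set cara) (EFin \o f).
Proof.
move=> mA HA AK cf; have [M fM] := continuous_bounded_box K cf.
apply: (@bounded_integrable _ _ _ _ _ _ M) => //.
- exact: measurable_cara.
- apply: measurable_fun_cara => //.
  by apply: measurable_funTS; exact: continuous_measurable_prod.
- by move=> x /AK[]; exact: fM.
Qed.

End plane_integrability.

(** * From the divergence identity to the torsion functional *)

Section torsion_domain.
Context {R : realType}.
Notation mR := (measurableTypeR R).
Notation cara := (caratheodory_type (@hausdorff1_outer R)).
Variables (Om : set (R * R)) (c : R * R) (rho K : R).
Hypothesis oOm : open Om.
Hypothesis OmK : forall x, Om x -> `|x.1| <= K /\ `|x.2| <= K.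
Hypothesis bOmK : forall x, boundary Om x -> `|x.1| <= K /\ `|x.2| <= K.
Hypothesis bOm_gt0 : (0 < hausdorff1 (boundary Om))%E.
Hypothesis bOm_fin : (hausdorff1 (boundary Om) < +oo)%E.
Hypothesis divergence : forall phi, smooth phi ->
  \int[area]_(x in Om)
    (2 * phi x + (x.1 - c.1) * dx1 phi x + (x.2 - c.2) * dx2 phi x) =
  rho * \int[arclength]_(x in boundary Om) phi x.

Let mOm : measurable (Om : set (mR * mR)).
Proof. exact: open_measurable_prod. Qed.

Lemma measurable_boundary : measurable (boundary Om : set (mR * mR)).
Proof.
apply: measurableD; first by apply: closed_measurable_prod; exact: closed_closure.
by apply: open_measurable_prod; exact: open_interior.
Qed.

Let mbOm : measurable (boundary Om : set cara).
Proof. exact: measurable_cara measurable_boundary. Qed.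

Let areaOm : (area Om < +oo)%E.
Proof. exact: area_bounded OmK. Qed.

Let cont_int (f : R * R -> R) : continuous f ->
  area.-integrable (Om : set (mR * mR)) (EFin \o f).
Proof. exact: continuous_area_integrable OmK. Qed.

Let cont_meas (f : R * R -> R) : continuous f -> measurable_fun (Om : set (mR * mR)) f.
Proof. by move=> cf; apply: measurable_funTS; exact: continuous_measurable_prod. Qed.

Let cont_bint (f : R * R -> R) : continuous f ->
  arclength.-integrable (boundary Om : set cara) (EFin \o f).
Proof. exact: continuous_arclength_integrable measurable_boundary bOm_fin bOmK. Qed.

Let cx1 : continuous (fun x : R * R => x.1 - c.1).
Proof. by move=> x; apply: cvgB; [exact: cvg_fst|exact: cvg_cst]. Qed.

Let cx2 : continuous (fun x : R * R => x.2 - c.2).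
Proof. by move=> x; apply: cvgB; [exact: cvg_snd|exact: cvg_cst]. Qed.

Let moment : R := \int[area]_(x in Om) ((x.1 - c.1) ^+ 2 + (x.2 - c.2) ^+ 2).

Let cvgM2 (f g : R * R -> R) : continuous f -> continuous g ->
  continuous (fun x => f x * g x).
Proof. by move=> cf cg x; apply: cvgM; [exact: cf|exact: cg]. Qed.

Let cvgD2 (f g : R * R -> R) : continuous f -> continuous g ->
  continuous (fun x => f x + g x).
Proof. by move=> cf cg x; apply: cvgD; [exact: cf|exact: cg]. Qed.

Let continuous_moment : continuous (fun x : R * R => (x.1 - c.1) ^+ 2 + (x.2 - c.2) ^+ 2).
Proof. by apply: cvgD2; apply: cvgM2. Qed.

(** The smooth functions supplied by [trace] converge in L^2 inside [Om] together with their
    derivatives, and on the boundary. The factors [x - c] are bounded on [Om] and both measures are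
    finite, so every term of the identity converges. *)
Lemma divergence_limit u g tau : H1 Om u g -> trace Om u g tau ->
  2 * \int[area]_(x in Om) u x + \int[area]_(x in Om) ((x.1 - c.1) * (g x).1) +
    \int[area]_(x in Om) ((x.2 - c.2) * (g x).2) =
  rho * \int[arclength]_(x in boundary Om) tau x.
Proof.
move=> [u2 g12 g22 _] [tau2 [phi [sphi phiu phi1 phi2 phit]]].
have cphi n : continuous (phi n) by exact: smooth_continuous.
have cd1 n : continuous (dx1 (phi n)).
  by rewrite /dx1; exact: smooth_derive_continuous.
have cd2 n : continuous (dx2 (phi n)).
  by rewrite /dx2; exact: smooth_derive_continuous.
have l0 : 2 * \int[area]_(x in Om) phi n x @[n --> \oo] --> 2 * \int[area]_(x in Om) u x.
  apply: cvgM; first (by exact: cvg_cst); apply: cvg_Rintegral_L2 => //.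
  by move=> n; exact: cont_int.
have [K1 K1P] := continuous_bounded_box K cx1.
have [K2 K2P] := continuous_bounded_box K cx2.
have l1 : \int[area]_(x in Om) ((x.1 - c.1) * dx1 (phi n) x) @[n --> \oo] -->
    \int[area]_(x in Om) ((x.1 - c.1) * (g x).1).
  apply: (cvg_Rintegral_L2M (K := K1)) => //.
  - exact: cont_meas.
  - by move=> x /OmK[]; exact: K1P.
  - by move=> n; exact: cont_int.
have l2 : \int[area]_(x in Om) ((x.2 - c.2) * dx2 (phi n) x) @[n --> \oo] -->
    \int[area]_(x in Om) ((x.2 - c.2) * (g x).2).
  apply: (cvg_Rintegral_L2M (K := K2)) => //.
  - exact: cont_meas.
  - by move=> x /OmK[]; exact: K2P.
  - by move=> n; exact: cont_int.
have lt : rho * \int[arclength]_(x in boundary Om) phi n x @[n --> \oo] -->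
    rho * \int[arclength]_(x in boundary Om) tau x.
  apply: cvgM; first (by exact: cvg_cst); apply: cvg_Rintegral_L2 => //.
  by move=> n; exact: cont_bint.
have l : 2 * \int[area]_(x in Om) phi n x +
    \int[area]_(x in Om) ((x.1 - c.1) * dx1 (phi n) x) +
    \int[area]_(x in Om) ((x.2 - c.2) * dx2 (phi n) x) @[n --> \oo] -->
    rho * \int[arclength]_(x in boundary Om) tau x; last first.
  apply: (cvg_unique (@Rhausdorff R) _ l).
  by apply: cvgD => //; exact: cvgD.
apply: cvg_trans lt; apply: near_eq_cvg; apply: nearW => n /=.
rewrite -divergence// -RintegralZl//; last exact: cont_int.
rewrite -RintegralD//.
- rewrite -RintegralD//; apply: cont_int.
    by apply: cvgD2; apply: cvgM2 => //; move=> ?; exact: cvg_cst.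
  exact: cvgM2.
- by apply: cont_int; apply: cvgM2 => // ?; exact: cvg_cst.
- by apply: cont_int; exact: cvgM2.
Qed.

Lemma energy_ge u g tau : H1 Om u g -> trace Om u g tau ->
  \int[arclength]_(x in boundary Om) tau x = 0 ->
  - (8^-1 * moment) <= energy Om u g.
Proof.
move=> H1u tru tau0; have := divergence_limit H1u tru; rewrite tau0 mulr0.
have [u2 g12 g22 _] := H1u.
have [K1 K1P] := continuous_bounded_box K cx1.
have [K2 K2P] := continuous_bounded_box K cx2.
have i1 : area.-integrable (Om : set (mR * mR)) (EFin \o (fun x => (x.1 - c.1) * (g x).1)).
  apply: square_integrable_integrable => //.
  apply: (square_integrableM (K := K1)) => //; first exact: cont_meas.
  by move=> x /OmK[]; exact: K1P.
have i2 : area.-integrable (Om : set (mR * mR)) (EFin \o (fun x => (x.2 - c.2) * (g x).2)).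
  apply: square_integrable_integrable => //.
  apply: (square_integrableM (K := K2)) => //; first exact: cont_meas.
  by move=> x /OmK[]; exact: K2P.
have i3 : area.-integrable (Om : set (mR * mR))
    (EFin \o (fun x => (g x).1 ^+ 2 + (g x).2 ^+ 2)).
  have := integrableD mOm (square_integrable_sqr mOm g12) (square_integrable_sqr mOm g22).
  by apply: eq_integrable.
have i12 : area.-integrable (Om : set (mR * mR))
    (EFin \o (fun x => (x.1 - c.1) * (g x).1 + (x.2 - c.2) * (g x).2)).
  by have := integrableD mOm i1 i2; apply: eq_integrable.
have i12h : area.-integrable (Om : set (mR * mR))
    (EFin \o (fun x => 2^-1 * ((x.1 - c.1) * (g x).1 + (x.2 - c.2) * (g x).2))).
  have := integrableZl mOm 2^-1 i12.
  by apply: eq_integrable => // x _ /=; rewrite EFinM.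
have i3h : area.-integrable (Om : set (mR * mR))
    (EFin \o (fun x => 2^-1 * ((g x).1 ^+ 2 + (g x).2 ^+ 2))).
  have := integrableZl mOm 2^-1 i3.
  by apply: eq_integrable => // x _ /=; rewrite EFinM.
rewrite -addrA -RintegralD// => e.
(* The identity [e] replaces the linear term: minus the integral of [u] is half the integral of
   [(x - c) . g]. *)
have -> : energy Om u g = \int[area]_(x in Om)
    (2^-1 * ((g x).1 ^+ 2 + (g x).2 ^+ 2) +
     2^-1 * ((x.1 - c.1) * (g x).1 + (x.2 - c.2) * (g x).2)).
  rewrite RintegralD// !RintegralZl// /energy.
  move: e; set I1 := Rintegral _ _ _; set I2 := Rintegral _ _ _; lra.
rewrite -mulNr /moment -RintegralZl//; last exact: cont_int.
apply: le_Rintegral => //.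
- by apply: cont_int; apply: cvgM2 => // ?; exact: cvg_cst.
- have := integrableD mOm i3h i12h.
  by apply: eq_integrable.
- move=> x _.
  (* The difference of the integrands is half of [|g + (x - c) / 2|^2]. *)
  have := sqr_ge0 ((g x).1 + 2^-1 * (x.1 - c.1)).
  have := sqr_ge0 ((g x).2 + 2^-1 * (x.2 - c.2)).
  rewrite !sqrrD !exprMn; lra.
Qed.

Lemma continuous_square_integrable (f : R * R -> R) : continuous f ->
  square_integrable area Om f.
Proof.
move=> cf; apply: integrable_square_integrable; first exact: cont_meas.
exact: (cont_int (cvgM2 cf cf)).
Qed.

Lemma continuous_square_integrable_boundary (f : R * R -> R) : continuous f ->
  square_integrable arclength (boundary Om) f.
Proof.
move=> cf; apply: integrable_square_integrable; last exact: (cont_bint (cvgM2 cf cf)).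
apply: measurable_fun_cara; last exact: measurable_boundary.
by apply: measurable_funTS; exact: continuous_measurable_prod.
Qed.

(** A constant sequence serves as the approximation. *)
Lemma smooth_trace u : smooth u -> trace Om u (fun x => (dx1 u x, dx2 u x)) u.
Proof.
move=> su; split.
  by apply: continuous_square_integrable_boundary; exact: smooth_continuous.
have z d (T : measurableType d) (mu : {measure set T -> \bar R}) (D : set T) (f : T -> R) :
    (\int[mu]_(x in D) ((f x - f x) ^+ 2)%:E @[n --> \oo] --> 0)%E.
  rewrite (_ : (fun n : nat => _) = cst 0%E); first exact: cvg_cst.
  apply/funext => n; rewrite integral0_eq// => x _.
  by rewrite subrr expr0n.
by exists (fun=> u); split => //; exact: z.
Qed.

(** The support is closed and contained in [Om], so [phi] vanishes near every point outside [Om]. *)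
Lemma test_function_outside phi x : test_function Om phi -> ~ Om x ->
  phi x = 0 /\ forall v, 'D_v phi x = 0.
Proof.
move=> [_ _ suppOm] Omx.
have nx : ~ closure [set x | phi x != 0] x by move=> /suppOm.
have phi0 : \forall y \near x, phi y = cst 0 y.
  have oc : open (~` closure [set x | phi x != 0]).
    by apply: closed_openC; exact: closed_closure.
  apply: filterS (open_nbhs_nbhs (conj oc nx)) => y ny /=.
  apply/eqP; apply/negPn/negP => py; apply: ny; exact: subset_closure.
split; first exact: nbhs_singleton phi0.
by move=> v; rewrite (near_eq_derive v phi0) derive_cst.
Qed.

Let L : R := `|K| + 1.

Let OmL x : Om x -> (- L <= x.1 <= L) /\ (- L <= x.2 <= L).
Proof.
move=> /OmK[x1 x2]; have := ler_norm K; rewrite /L.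
by move: x1 x2; rewrite !ler_norml => ? ? ?; split; lra.
Qed.

(** The integrand is the derivative of [u phi] along the line, and [u phi] vanishes at both
    parameters [- M] and [M], where the line has left [Om]. *)
Lemma smooth_product_line u phi p v : smooth u -> test_function Om phi ->
  (forall t : R, L < `|t| -> ~ Om (p + t *: v)) ->
  (\int[lebesgue_measure]_t (u (p + t *: v) * 'D_v phi (p + t *: v) +
    'D_v u (p + t *: v) * phi (p + t *: v))%:E = 0)%E.
Proof.
move=> su tphi out; have [sphi _ _] := tphi.
pose F (t : R) := u (p + t *: v) * phi (p + t *: v).
pose d (t : R) := u (p + t *: v) * 'D_v phi (p + t *: v) +
  'D_v u (p + t *: v) * phi (p + t *: v).
have Fd (t : R) : is_derive t 1 F (d t).
  have h1 := smooth_is_derive_line p v t su.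
  have h2 := smooth_is_derive_line p v t sphi.
  rewrite /F (_ : (fun x => _) = (fun t => u (p + t *: v)) * (fun x => phi (p + x *: v)))//.
  by apply: is_derive_eq; rewrite /d /GRing.scale/= [in RHS]mulrC [X in _ + X]mulrC addrC;
    rewrite [RHS]addrC [X in _ = _ + X]mulrC.
have cd : continuous d.
  have c1 : continuous (fun x : R => u (p + x *: v)).
    exact: (continuous_line_comp (smooth_continuous su)).
  have c2 : continuous (fun x : R => 'D_v u (p + x *: v)).
    exact: (continuous_line_comp (smooth_derive_continuous su)).
  have c3 : continuous (fun x : R => phi (p + x *: v)).
    exact: (continuous_line_comp (smooth_continuous sphi)).
  have c4 : continuous (fun x : R => 'D_v phi (p + x *: v)).
    exact: (continuous_line_comp (smooth_derive_continuous sphi)).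
  move=> x; apply: cvgD; first by apply: cvgM; [exact: c1|exact: c4].
  by apply: cvgM; [exact: c2|exact: c3].
pose M := L + 1.
have M0 : 0 < M by rewrite /M /L -addrA ltr_wpDl// addr_gt0.
have LM : L < M by rewrite /M ltrDl.
have MM : - M <= M by rewrite (ge0_cp (ltW M0)).2.
rewrite -[LHS]/(\int[lebesgue_measure]_t (d t)%:E)%E.
rewrite (_ : (\int[lebesgue_measure]_t (d t)%:E)%E =
   (\int[lebesgue_measure]_(t in `[(- M)%R, M]) (d t)%:E)%E); last first.
  rewrite [RHS]integral_mkcond; apply: eq_integral => t _.
  rewrite patchE; case: ifPn => // tM; rewrite /d.
  have Lt : L < `|t|.
    rewrite ltNge; apply/negP => tL; move/negP: tM; apply.
    rewrite inE/= in_itv/=; move: tL; rewrite ler_norml; lra.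
  have [-> ->] := test_function_outside tphi (out t Lt).
  by rewrite !mulr0 addr0.
rewrite (integral_derive MM Fd cd) /F.
have L1 : L < `|M| by rewrite gtr0_norm.
have L2 : L < `|- M| by rewrite normrN gtr0_norm.
have [-> _] := test_function_outside tphi (out _ L1).
have [-> _] := test_function_outside tphi (out _ L2).
by rewrite !mulr0 subrr.
Qed.

Lemma smooth_weak_derive u phi v : smooth u -> test_function Om phi ->
  v = (1, 0) \/ v = (0, 1) ->
  \int[area]_(x in Om) (u x * 'D_v phi x) = - \int[area]_(x in Om) ('D_v u x * phi x).
Proof.
move=> su tphi v12; have [sphi _ _] := tphi.
have cu := smooth_continuous su; have cphi := smooth_continuous sphi.
have cdu := @smooth_derive_continuous _ _ v su.
have cdphi := @smooth_derive_continuous _ _ v sphi.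
apply/eqP; rewrite -subr_eq0 opprK -RintegralD//; [|exact/cont_int/cvgM2..].
pose d x := u x * 'D_v phi x + 'D_v u x * phi x.
have cd : continuous d by apply: cvgD2; exact: cvgM2.
(* [d] vanishes outside [Om], so the integral runs over the whole plane and Fubini yields full lines
   parallel to [v]. *)
have dE : d \_ Om = d.
  apply/funext => x; rewrite patchE; case: ifPn => // /negP; rewrite inE => Omx.
  rewrite /d; have [-> ->] := test_function_outside tphi Omx.
  by rewrite !mulr0 addr0.
have id : area.-integrable [set: mR * mR] (EFin \o d).
  by rewrite -dE -restrict_EFin; apply/(integrable_mkcond _ mOm); exact: cont_int.
rewrite -/(Rintegral area Om d) Rintegral_mkcond dE /Rintegral.
have /eqP -> // : (\int[area]_x (d x)%:E)%E == 0%E.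
rewrite -[X in X == _]/(\int[area]_x (EFin \o d) x)%E /area.
case: v12 => vE.
- rewrite -(integral21_prod_meas1 id); apply/eqP/integral0_eq => y _.
  have pt (t : R) : (0, y) + t *: v = (t, y).
    by rewrite vE; congr (_, _); rewrite /= /GRing.scale/=; ring.
  transitivity (\int[lebesgue_measure]_t (u ((0, y) + t *: v) * 'D_v phi ((0, y) + t *: v) +
      'D_v u ((0, y) + t *: v) * phi ((0, y) + t *: v))%:E)%E.
    by apply: eq_integral => t _; rewrite pt.
  apply: smooth_product_line => // t Lt; rewrite pt => /OmL[+ _] /=.
  by rewrite -ler_norml leNgt Lt.
- rewrite -(integral12_prod_meas1 id); apply/eqP/integral0_eq => x _.
  have pt (t : R) : (x, 0) + t *: v = (x, t).
    by rewrite vE; congr (_, _); rewrite /= /GRing.scale/=; ring.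
  transitivity (\int[lebesgue_measure]_t (u ((x, 0) + t *: v) * 'D_v phi ((x, 0) + t *: v) +
      'D_v u ((x, 0) + t *: v) * phi ((x, 0) + t *: v))%:E)%E.
    by apply: eq_integral => t _; rewrite pt.
  apply: smooth_product_line => // t Lt; rewrite pt => /OmL[_ +] /=.
  by rewrite -ler_norml leNgt Lt.
Qed.

Lemma smooth_H1 u : smooth u -> H1 Om u (fun x => (dx1 u x, dx2 u x)).
Proof.
move=> su; split.
- by apply: continuous_square_integrable; exact: smooth_continuous.
- by apply: continuous_square_integrable; exact: smooth_derive_continuous.
- by apply: continuous_square_integrable; exact: smooth_derive_continuous.
- move=> phi tphi; split.
  + by apply: smooth_weak_derive => //; left.
  + by apply: smooth_weak_derive => //; right.
Qed.

(* The optimal function: [k - |x - c| ^ 2 / 4] with zero boundary mean. *)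
Lemma energy_attained : exists u, [/\ smooth u,
  \int[arclength]_(x in boundary Om) u x = 0 &
  energy Om u (fun x => (dx1 u x, dx2 u x)) = - (8^-1 * moment)].
Proof.
pose q k := quadratic k (- 4^-1) (2^-1 *: c).
pose H := fine (hausdorff1 (boundary Om)).
have H0 : 0 < H by rewrite fine_gt0// bOm_gt0.
have HE : fine (arclength (boundary Om : set cara)) = H by [].
have sq k : smooth (q k) by exact: smooth_quadratic.
have cq k := smooth_continuous (sq k).
(* The constant that cancels the boundary mean of [q 0]; dividing uses the positive length of the
   boundary. *)
pose k := - \int[arclength]_(x in boundary Om) q 0 x / H.
have qk x : q k x = q 0 x + k by rewrite /q /quadratic; ring.
have d1 x : dx1 (q k) x = - (2^-1 * (x.1 - c.1)).
  have [_ e] := is_derive_quadratic k (- 4^-1) (2^-1 *: c) x (1, 0).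
  by rewrite /dx1 /q e /quadratic /= /GRing.scale/=; lra.
have d2 x : dx2 (q k) x = - (2^-1 * (x.2 - c.2)).
  have [_ e] := is_derive_quadratic k (- 4^-1) (2^-1 *: c) x (0, 1).
  by rewrite /dx2 /q e /quadratic /= /GRing.scale/=; lra.
have q0 : \int[arclength]_(x in boundary Om) q k x = 0.
  under eq_Rintegral do rewrite qk.
  rewrite RintegralD//; [|exact: cont_bint|by apply: cont_bint => ?; exact: cvg_cst].
  by rewrite Rintegral_cst// HE /k mulNr divfK ?subrr// gt_eqF.
exists (q k); split => //.
(* This gives a quarter of [moment] for the integral of [q k]; the gradient term of the energy is an
   eighth of it, whence minus an eighth. *)
have := divergence (sq k); rewrite q0 mulr0.
have -> : \int[area]_(x in Om) (2 * q k x + (x.1 - c.1) * dx1 (q k) x + (x.2 - c.2) * dx2 (q k) x) =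
    \int[area]_(x in Om) (2 * q k x + - 2^-1 * ((x.1 - c.1) ^+ 2 + (x.2 - c.2) ^+ 2)).
  by apply: eq_Rintegral => x _; rewrite d1 d2; ring.
rewrite RintegralD//; last 2 first.
- by apply: cont_int; apply: cvgM2 => // ?; exact: cvg_cst.
- by apply: cont_int; apply: cvgM2 => // ?; exact: cvg_cst.
rewrite !RintegralZl//; [|exact: cont_int..].
rewrite -/moment => e.
have -> : energy Om (q k) (fun x => (dx1 (q k) x, dx2 (q k) x)) =
    2^-1 * \int[area]_(x in Om) (4^-1 * ((x.1 - c.1) ^+ 2 + (x.2 - c.2) ^+ 2)) -
    \int[area]_(x in Om) q k x.
  rewrite /energy; congr (_ * _ - _); apply: eq_Rintegral => x _ /=.
  by rewrite d1 d2; field.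
rewrite RintegralZl//; last exact: cont_int.
by rewrite -/moment; lra.
Qed.

Lemma T_functional_moment : T_functional Om = (- (8^-1 *
  \int[area]_(x in Om) ((x.1 - c.1) ^+ 2 + (x.2 - c.2) ^+ 2)))%:E.
Proof.
apply/eqP; rewrite eq_le; apply/andP; split.
  have [u [su u0 <-]] := energy_attained.
  apply: ereal_inf_lbound; exists u, (fun x => (dx1 u x, dx2 u x)), u; split => //.
  - exact: smooth_H1.
  - exact: smooth_trace.
apply: le_ereal_inf_tmp => _ [u [g [tau [H1u tru tau0 ->]]]].
by rewrite lee_fin; exact: energy_ge tau0.
Qed.

End torsion_domain.

(** * Rotated frames and angular sectors *)

Section frames.
Context {R : realType}.
Implicit Types (c p q : R * R) (al : R).

Definition unframe c al p : R * R := rotate (- al) (p.1 - c.1, p.2 - c.2).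

Lemma rotate0 p : rotate 0 p = p.
Proof. by case: p => x y; rewrite /rotate cos0 sin0/=; congr (_, _); ring. Qed.

Lemma frameK c al : cancel (frame c al) (unframe c al).
Proof.
move=> p; rewrite /frame /unframe /= ![_ + _ - _]addrAC !subrr !add0r.
by rewrite -[X in rotate _ X]/(rotate al p) -rotateD addNr rotate0.
Qed.

Lemma unframeK c al : cancel (unframe c al) (frame c al).
Proof.
move=> p; rewrite /frame /unframe -rotateD addrN rotate0/=.
by case: p => x y /=; congr (_, _); ring.
Qed.

Lemma edist_frame c al p q : edist (frame c al p) (frame c al q) = edist p q.
Proof.
rewrite /edist; congr Num.sqrt; rewrite /frame /rotate/=.
have cs := cos2Dsin2 al.
transitivity ((cos al ^+ 2 + sin al ^+ 2) * ((p.1 - q.1) ^+ 2 + (p.2 - q.2) ^+ 2)).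
  by ring.
by rewrite cs mul1r.
Qed.

Lemma continuous_rotate al : continuous (rotate al : R * R -> R * R).
Proof.
apply: continuous_pair => p.
- by apply: cvgB; apply: cvgM; [exact: cvg_cst|exact: cvg_fst|exact: cvg_cst|exact: cvg_snd].
- by apply: cvgD; apply: cvgM; [exact: cvg_cst|exact: cvg_fst|exact: cvg_cst|exact: cvg_snd].
Qed.

Lemma continuous_frame c al : continuous (frame c al).
Proof.
have cr := @continuous_rotate al.
have c1 : continuous (fun p => (rotate al p).1).
  by apply: (continuous_composition cr (g := fst)) => p; exact: cvg_fst.
have c2 : continuous (fun p => (rotate al p).2).
  by apply: (continuous_composition cr (g := snd)) => p; exact: cvg_snd.
by apply: continuous_pair => p; apply: cvgD; [exact: cvg_cst|exact: c1|exact: cvg_cst|exact: c2].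
Qed.

Lemma continuous_unframe c al : continuous (unframe c al).
Proof.
have cs : continuous (fun p : R * R => (p.1 - c.1, p.2 - c.2)).
  apply: continuous_pair => p; apply: cvgB; try exact: cvg_cst.
    exact: cvg_fst.
  exact: cvg_snd.
exact: (continuous_composition cs (@continuous_rotate (- al))).
Qed.

Lemma frame_line c al (x s : R) :
  frame c al (x, x * s) = c + x *: rotate al (1, s).
Proof.
rewrite /frame /rotate /=; case: c => c1 c2.
by congr (_, _); rewrite /= /GRing.scale/=; ring.
Qed.

(** Half-open in the slope, so that rotated copies can tile the punctured plane without overlap. *)
Definition sector (t : R) : set (R * R) :=
  [set p | 0 < p.1 /\ - (t * p.1) <= p.2 < t * p.1].

Lemma sector_line t (x s : R) : 0 < x -> sector t (x, x * s) <-> - t <= s < t.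
Proof.
move=> x0; rewrite /sector/= mulrC -mulrN.
rewrite ler_pM2l// ltr_pM2l//; split=> [[_]//|?]; by split.
Qed.

Lemma measurable_sector t :
  measurable (sector t : set (measurableTypeR R * measurableTypeR R)).
Proof.
have c1 : continuous (fun p : R * R => t * p.1).
  by move=> p; apply: cvgM; [exact: cvg_cst|exact: cvg_fst].
have m1 := continuous_measurable_prod c1.
have -> : sector t = [set p | 0 < p.1] `&` ([set p | - (t * p.1) <= p.2] `&`
    [set p | p.2 < t * p.1]).
  apply/seteqP; split => [p [p0 /andP[]]//|p [/= ? [? ?]]].
  by split => //; apply/andP.
apply: measurableI; last apply: measurableI.
- rewrite (_ : [set p | _] = (fun p => (cst 0 p < p.1)) @^-1` [set true])//.
  rewrite -[X in measurable X]setTI; exact: measurable_fun_ltr.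
- rewrite (_ : [set p | _] = (fun p => (- (t * p.1) <= p.2)) @^-1` [set true])//.
  rewrite -[X in measurable X]setTI; apply: measurable_fun_ler => //.
  exact: measurable_funN.
- rewrite (_ : [set p | _] = (fun p => (p.2 < t * p.1)) @^-1` [set true])//.
  rewrite -[X in measurable X]setTI; exact: measurable_fun_ltr.
Qed.

End frames.

(** * Domains made of congruent sectors *)

(* In the [k]-th sector, in the frame of origin [c] and angle [al k], the domain
   is [x < h (y / x)]. Its boundary there is the curve [gam], parametrized by
   arc length, and [S s] is the slope of [gam s]. The map [f0] recovers the
   parameter. By [hS], the cone measure [h^2 dS] is proportional to arc length. *)
Section sectored_domain.
Context {R : realType}.
Notation mR := (measurableTypeR R).
Notation cara := (caratheodory_type (@hausdorff1_outer R)).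
Variables (Om : set (R * R)) (c : R * R) (rho K : R) (n : nat) (al : 'I_n -> R).
Variables (t a : R) (h S : R -> R) (gam : R -> R * R) (f0 : R * R -> R).
Hypothesis oOm : open Om.
Hypothesis OmK : forall x, Om x -> `|x.1| <= K /\ `|x.2| <= K.
Hypothesis bOmK : forall x, boundary Om x -> `|x.1| <= K /\ `|x.2| <= K.
Hypothesis cover : forall x, x <> c -> exists k, sector t (unframe c (al k) x).
Hypothesis sector_inj : forall x j k, sector t (unframe c (al j) x) ->
  sector t (unframe c (al k) x) -> j = k.
Hypothesis OmP : forall k p, sector t p ->
  Om (frame c (al k) p) <-> p.1 < h (p.2 / p.1).
Hypothesis bOmP : forall k p, sector t p ->
  boundary Om (frame c (al k) p) <-> (exists2 s, s \in `[- a, a[ & gam s = p).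
Hypothesis gam_sector : forall s, s \in `[- a, a[ -> sector t (gam s).
Hypothesis bOmc : ~ boundary Om c.
Hypothesis ch : continuous h.
Hypothesis h_gt0 : forall s, 0 < h s.
Hypothesis a_gt0 : 0 < a.
Hypothesis Sa : S a = t.
Hypothesis SNa : S (- a) = - t.
Hypothesis S_incr : {in `[- a, a] &, {homo S : x y / x < y}}.
Hypothesis S_der : {in `[- a, a], forall s, derivable S s 1}.
Hypothesis S_cont : {in `[- a, a], continuous S^`()%classic}.
Hypothesis hS : {in `[- a, a], forall s, h (S s) ^+ 2 * S^`()%classic s = rho}.
Hypothesis gamE : {in `[- a, a], forall s, gam s = (h (S s), h (S s) * S s)}.
Hypothesis cgam : continuous gam.
Hypothesis gamK : {in `[- a, a], cancel gam f0}.
Hypothesis mf0 : measurable_fun [set: mR * mR] (f0 : mR * mR -> mR).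
Hypothesis gam1 : {in `[- a, a] &, forall s u, edist (gam s) (gam u) <= `|s - u|}.
Hypothesis gamexp : forall e : R, 0 < e -> exists2 d : R, 0 < d &
  {in `[- a, a] &, forall s u, edist (gam s) (gam u) <= d ->
    `|s - u| <= (1 + e) * edist (gam s) (gam u)}.

Let M k := frame c (al k).
Let A k := Om `&` unframe c (al k) @^-1` sector t.
Let B k := boundary Om `&` unframe c (al k) @^-1` sector t.

Let mOm : measurable (Om : set (mR * mR)).
Proof. exact: open_measurable_prod. Qed.

Let msec k : measurable (unframe c (al k) @^-1` sector t : set (mR * mR)).
Proof.
rewrite -[X in measurable X]setTI.
apply: (continuous_measurable_plane (@continuous_unframe _ c (al k))) => //.
exact: measurable_sector.
Qed.

Let mA k : measurable (A k : set (mR * mR)).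
Proof. exact: measurableI. Qed.

Let cphiM (phi : R * R -> R) k : continuous phi -> continuous (phi \o M k).
Proof.
by move=> cphi; exact: (continuous_composition (@continuous_frame _ c (al k)) cphi).
Qed.

(** Only the centre [c] escapes the sectors, and a point has area 0. *)
Lemma integral_sectors (F : R * R -> R) : continuous F ->
  (\int[area]_(x in Om) (F x)%:E = \sum_(k < n) \int[area]_(x in A k) (F x)%:E)%E.
Proof.
move=> cF; rewrite (negligible_integral (N := [set c] : set (mR * mR))) => //; last 3 first.
- exact: measurable_plane_set1.
- exact: (continuous_area_integrable mOm OmK cF).
- exact: area_set1.
have -> : Om `\` [set c] = \big[setU/set0]_(k < n) A k.
  rewrite -bigcup_seq; apply/seteqP; split => [x [Omx xc]|x [k _ [Omx sx]]].
    by have [k sk] := cover xc; exists k => //=; rewrite mem_index_enum.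
  split => //= xc; move: sx; rewrite xc /= /unframe !subrr /rotate/= !mulr0 subrr.
  by move=> [/=]; rewrite ltxx.
rewrite integral_bigsetU_EFin ?index_enum_uniq//.
- move=> j k _ _ [x [[_ sj] [_ sk]]]; exact: sector_inj sj sk.
- by apply: measurable_funTS; apply/measurable_EFinP; exact: continuous_measurable_prod.
Qed.

Let continuous_profile (phi : R * R -> R) k : continuous phi ->
  continuous (fun s : R => h s ^+ 2 * phi (M k (h s, h s * s))).
Proof.
move=> cphi; have ca : continuous (fun s : R => (h s, h s * s)).
  apply: continuous_pair => // u; apply: cvgM; [exact: ch|exact: cvg_id].
have cp : continuous (fun s : R => phi (M k (h s, h s * s))).
  exact: (continuous_composition ca (@cphiM phi k cphi)).
by move=> s; apply: cvgM; [apply: cvgM; exact: ch|exact: cp].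
Qed.

Let hmax : exists H : R, forall s, - t <= s < t -> h s <= H.
Proof.
have [tt|tt] := leP (- t) t; last first.
  by exists 0 => s /andP[? ?]; exfalso; lra.
have [|m _ mP] := EVT_max tt (f := h); first exact: continuous_subspaceT.
exists (h m) => s /andP[s1 s2]; apply: mP; rewrite in_itv/= s1 ltW//.
Qed.

Let D k := sector t `&` M k @^-1` Om.

Let mD k : measurable (D k : set (mR * mR)).
Proof.
apply: measurableI; first exact: measurable_sector.
rewrite -[X in measurable X]setTI.
exact: (continuous_measurable_plane (@continuous_frame _ c (al k))).
Qed.

Let D_bounded k : exists L : R, forall p, D k p -> `|p.1| <= L /\ `|p.2| <= L.
Proof.
have [H HP] := hmax; exists ((1 + `|t|) * H) => p [sp Op].
have [p0 /andP[p1 p2]] := sp.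
have e : p = (p.1, p.1 * (p.2 / p.1)).
  by rewrite [p.1 * _]mulrC divfK ?gt_eqF//; case: (p).
have sb : - t <= p.2 / p.1 < t by apply/(sector_line _ _ p0); rewrite -e.
have pH : p.1 <= H.
  by apply: le_trans (HP _ sb); apply/ltW/(OmP k sp).
have t0 : 0 < t by move: sb => /andP[? ?]; lra.
rewrite (gtr0_norm t0) (gtr0_norm p0) ler_norml; split; first nra.
by apply/andP; split; nra.
Qed.

(** In the frame of the sector and in slope coordinates, the Jacobian [x] times the integrand is the
    derivative of [x^2 phi] along the ray of slope [s]. That ray leaves the domain at [x = h s], and
    the lower end contributes 0. *)
Lemma integral_sector (phi : R * R -> R) k : smooth phi ->
  (\int[area]_(x in A k)
    (2 * phi x + (x.1 - c.1) * dx1 phi x + (x.2 - c.2) * dx2 phi x)%:E =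
  \int[lebesgue_measure]_(s in `[(- t)%R, t])
    (h s ^+ 2 * phi (M k (h s, h s * s)))%:E)%E.
Proof.
move=> sphi; pose F x := 2 * phi x + (x.1 - c.1) * dx1 phi x + (x.2 - c.2) * dx2 phi x.
rewrite -[LHS]/(\int[area]_(x in A k) (F x)%:E)%E.
have cphi := smooth_continuous sphi.
have cF : continuous F.
  move=> x; apply: cvgD; first apply: cvgD.
  - by apply: cvgM; [exact: cvg_cst|exact: cphi].
  - apply: cvgM; last exact: smooth_derive_continuous.
    by apply: cvgB; [exact: cvg_fst|exact: cvg_cst].
  - apply: cvgM; last exact: smooth_derive_continuous.
    by apply: cvgB; [exact: cvg_snd|exact: cvg_cst].
have [L DL] := D_bounded k.
have MA : M k @^-1` A k = D k.
  apply/seteqP; split => p [p1 p2]; split => //; first by move: p2; rewrite /= frameK.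
  by rewrite /= frameK.
have iFM : area.-integrable (D k : set (mR * mR)) (EFin \o (F \o M k)).
  by apply: (continuous_area_integrable (mD k) DL); exact: cphiM.
rewrite (integral_area_preserving (area_preserving_frame c (al k))) ?MA//; last first.
  exact: continuous_measurable_prod.
pose G := (F \o M k) \_ (D k).
have GE : (\int[area]_(x in D k) (F (frame c (al k) x))%:E = \int[area]_x (G x)%:E)%E.
  by rewrite integral_mkcond restrict_EFin.
rewrite GE integral_slope; last 3 first.
- apply/(measurable_restrictT _ (mD k)); apply: measurable_funTS.
  by apply: continuous_measurable_prod; exact: cphiM.
- move=> p p0; rewrite /G patchE memNset// => -[[]].
  by rewrite ltNge p0.
- by rewrite /G -restrict_EFin; apply/(integrable_mkcond _ (mD k)).
(* The endpoint [t] is removed to match the half-open sector. *)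
rewrite -integral_itv_bndo_bndc; last first.
  apply: measurable_funTS; apply/measurable_EFinP.
  by apply: continuous_measurable_fun; exact: continuous_profile.
rewrite [RHS]integral_mkcond; apply: eq_integral => s _.
rewrite patchE; case: ifPn => [|/negP] sI; rewrite inE/= in_itv/= in sI; last first.
  apply: integral0_eq => x _; rewrite /G patchE; case: ifPn => [|_]; last by rewrite mulr0.
  rewrite inE => -[sx _]; have [x0 _] := sx; exfalso; apply: sI.
  exact/(sector_line _ _ x0).
(* For a slope in [[- t, t[], the points of the ray in the domain are those with [0 < x < h s]. *)
transitivity (\int[lebesgue_measure]_(x in `]0%R, h s[)
    (x * (2 * phi (c + x *: rotate (al k) (1, s)) +
      x * 'D_(rotate (al k) (1, s)) phi (c + x *: rotate (al k) (1, s))))%:E)%E.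
  rewrite [RHS]integral_mkcond; apply: eq_integral => x _.
  rewrite patchE /G patchE; case: ifPn => [|/negP] xD; rewrite inE/= in xD; last first.
    case: ifPn => [|_]; last by rewrite mulr0.
    rewrite inE/= in_itv/= => /andP[x0 xh]; exfalso; apply: xD.
    have sx : sector t (x, x * s) by apply/sector_line.
    split => //=; apply/(OmP k sx) => /=.
    by rewrite mulrAC mulfV ?gt_eqF// mul1r.
  have [sx Ox] := xD; have [/= x0 _] := sx.
  rewrite mem_set; last first.
    rewrite /= in_itv/= x0/=; move: Ox => /(OmP k sx)/=.
    by rewrite mulrAC mulfV ?gt_eqF// mul1r.
  congr (_ * _)%:E; rewrite /F /= /M frame_line [in RHS]smooth_gradient//.
  by case: (c) => c1 c2 /=; rewrite /GRing.scale/=; ring.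
have mray (E : set mR) : measurable_fun E
    (fun x => (x * (2 * phi (c + x *: rotate (al k) (1, s)) +
      x * 'D_(rotate (al k) (1, s)) phi (c + x *: rotate (al k) (1, s))))%:E).
  apply: measurable_funTS; apply/measurable_EFinP; apply: continuous_measurable_fun.
  have c1 : continuous (fun x : R => phi (c + x *: rotate (al k) (1, s))).
    exact: continuous_line_comp.
  have c2 : continuous (fun x : R => 'D_(rotate (al k) (1, s)) phi (c + x *: rotate (al k) (1, s))).
    exact: (continuous_line_comp (smooth_derive_continuous sphi)).
  move=> x; apply: cvgM; first exact: cvg_id.
  apply: cvgD; first by apply: cvgM; [exact: cvg_cst|exact: c1].
  by apply: cvgM; [exact: cvg_id|exact: c2].
rewrite (integral_itv_bndo_bndc (mray _)) (integral_itv_obnd_cbnd (mray _)).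
rewrite integral_smooth_ray//; last exact: ltW.
by rewrite /M frame_line.
Qed.

(** The substitution of [S] for the slope turns [h^2] into [h (S s)^2 S'(s)], which is the constant
    [rho]. *)
Lemma integral_substitution (phi : R * R -> R) k : continuous phi ->
  (\int[lebesgue_measure]_(s in `[(- t)%R, t])
    (h s ^+ 2 * phi (M k (h s, h s * s)))%:E =
   \int[lebesgue_measure]_(s in `[(- a)%R, a]) (rho * phi (M k (gam s)))%:E)%E.
Proof.
move=> cphi.
have aa : - a <= a by rewrite (ge0_cp (ltW a_gt0)).2.
have inI : `]- a, a[ `<=` `[- a, a] by exact: subset_itv_oo_cc.
have Na : - a \in `[- a, a] by rewrite in_itv/= lexx.
have Pa : a \in `[- a, a] by rewrite in_itv/= lexx aa.
have contS : {in `[- a, a], continuous S}.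
  by move=> s sI; apply: differentiable_continuous; apply/derivable1_diffP/S_der.
pose G s := h s ^+ 2 * phi (M k (h s, h s * s)).
have cG : {within `[S (- a), S a], continuous G}.
  by apply: continuous_subspaceT; exact: continuous_profile.
have cS1 : {in `]- a, a[, continuous S^`()%classic}.
  by move=> s sI; apply: S_cont; exact: inI.
have cSr : cvg (S^`()%classic x @[x --> (- a)^'+]).
  by apply/cvg_ex; exists (S^`()%classic (- a)); apply: cvg_at_right_filter; exact: S_cont.
have cSl : cvg (S^`()%classic x @[x --> a^'-]).
  by apply/cvg_ex; exists (S^`()%classic a); apply: cvg_at_left_filter; exact: S_cont.
have dS : derivable_oo_LRcontinuous S (- a) a.
  split; first by move=> s sI; apply: S_der; exact: inI.
  - by apply: cvg_at_right_filter; exact: contS.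
  - by apply: cvg_at_left_filter; exact: contS.
have := integration_by_substitution_increasing aa S_incr cS1 cSr cSl dS cG.
rewrite Sa SNa => sub; apply: etrans sub _.
apply: eq_integral => s; rewrite inE => sI.
have -> : ((G \o S) * S^`()%classic) s = G (S s) * S^`()%classic s by [].
by rewrite /G mulrAC hS// -gamE.
Qed.

Let g k (s : R) := M k (gam s).
Let f k (p : R * R) := f0 (unframe c (al k) p).

Let BE k : B k = g k @` `[- a, a[.
Proof.
apply/seteqP; split => [x [bx sx]|_ [s sI <-]].
  have := bx; rewrite -(unframeK c (al k) x) => /(bOmP k sx)[s sI gs].
  by exists s => //; rewrite /g gs /M unframeK.
have sg := gam_sector sI; split; last by rewrite /= /g /M frameK.
by apply/(bOmP k sg); exists s.
Qed.

Let fK k : {in `[- a, a], cancel (g k) (f k)}.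
Proof. by move=> s sI; rewrite /f /g /M frameK gamK. Qed.

Let mf k : measurable_fun [set: mR * mR] (f k : mR * mR -> mR).
Proof.
apply: (measurableT_comp mf0).
exact: (continuous_measurable_plane (@continuous_unframe _ c (al k))).
Qed.

Let cg k : continuous (g k).
Proof.
exact: (continuous_composition cgam (@continuous_frame _ c (al k))).
Qed.

Let g1 k : {in `[- a, a] &, forall s u, edist (g k s) (g k u) <= `|s - u|}.
Proof. by move=> s u sI uI; rewrite /g /M edist_frame; exact: gam1. Qed.

Let gexp k : forall e : R, 0 < e -> exists2 d : R, 0 < d &
  {in `[- a, a] &, forall s u, edist (g k s) (g k u) <= d ->
    `|s - u| <= (1 + e) * edist (g k s) (g k u)}.
Proof.
move=> e /gamexp[d d0 dP]; exists d => // s u sI uI.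
by rewrite /g /M edist_frame; exact: dP.
Qed.

Let aa : - a < a. Proof. by rewrite gt0_cp. Qed.

Let mB k : measurable (B k : set (mR * mR)).
Proof. by rewrite BE; exact: (measurable_curve (@fK k) (@mf k) (@cg k)). Qed.

Let bOmE : boundary Om = \big[setU/set0]_(k < n) B k.
Proof.
rewrite -bigcup_seq; apply/seteqP; split => [x bx|x [k _ []]//].
have xc : x <> c by move=> xc; apply: bOmc; rewrite -xc.
by have [k sk] := cover xc; exists k => //=; rewrite mem_index_enum.
Qed.

Let trivB : trivIset [set` index_enum 'I_n] (B : 'I_n -> set cara).
Proof. by move=> j k _ _ [x [[_ sj] [_ sk]]]; exact: sector_inj sj sk. Qed.

Lemma hausdorff1_boundary : hausdorff1 (boundary Om) = (n%:R * (2 * a))%:E.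
Proof.
rewrite bOmE; apply: etrans (@measure_semi_additive_ord _ _ _ (@arclength R) n
  (B : 'I_n -> set cara) _ _ _) _.
- by move=> k; exact: measurable_cara.
- by move=> j k _ _ [x [[_ sj] [_ sk]]]; exact: sector_inj sj sk.
- by apply: bigsetU_measurable => k _; exact: measurable_cara.
transitivity (\sum_(k < n) (2 * a)%:E)%E.
  apply: eq_bigr => k _; rewrite BE.
  have := hausdorff1_curveT aa (@fK k) (@mf k) (@cg k) (@g1 k) (@gexp k).
  by rewrite /arclength/= => ->; rewrite opprK mulr_natl mulr2n.
by rewrite sumEFin sumr_const card_ord -(mulr_natl (2 * a) n).
Qed.

Lemma integral_boundary (phi : R * R -> R) : continuous phi ->
  (\int[arclength]_(x in boundary Om) (phi x)%:E =
   \sum_(k < n) \int[lebesgue_measure]_(s in `[(- a)%R, a]) (phi (M k (gam s)))%:E)%E.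
Proof.
move=> cphi; have mphi := continuous_measurable_prod cphi.
have Hfin : (hausdorff1 (boundary Om) < +oo)%E by rewrite hausdorff1_boundary ltry.
rewrite {1}bOmE (@integral_bigsetU_EFin _ _ _ (@arclength R)) ?index_enum_uniq//.
- apply: eq_bigr => k _.
  rewrite BE (integral_curve (@fK k) (@mf k) (@cg k) (@g1 k) (@gexp k))//.
  + apply: integral_itv_bndo_bndc; apply: measurable_funTS; apply/measurable_EFinP.
    apply: continuous_measurable_fun => s.
    exact: (continuous_composition (@cg k) cphi).
  + rewrite -BE; apply: (continuous_arclength_integrable (K := K) (mB k) _ _ cphi).
      by apply: le_lt_trans Hfin; apply: le_hausdorff1; exact: subIsetl.
    by move=> x [/bOmK].
- by move=> k; exact: measurable_cara.
- rewrite -bOmE; apply/measurable_EFinP; apply: measurable_fun_cara.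
    exact: measurable_funTS.
  rewrite bOmE; rewrite -bigcup_seq; apply: fin_bigcup_measurable => //.
Qed.

Lemma sectored_divergence phi : smooth phi ->
  \int[area]_(x in Om)
    (2 * phi x + (x.1 - c.1) * dx1 phi x + (x.2 - c.2) * dx2 phi x) =
  rho * \int[arclength]_(x in boundary Om) phi x.
Proof.
move=> sphi; have cphi := smooth_continuous sphi.
rewrite /Rintegral integral_boundary// integral_sectors; last first.
  move=> x; apply: cvgD; first apply: cvgD.
  - by apply: cvgM; [exact: cvg_cst|exact: cphi].
  - apply: cvgM; last exact: smooth_derive_continuous.
    by apply: cvgB; [exact: cvg_fst|exact: cvg_cst].
  - apply: cvgM; last exact: smooth_derive_continuous.
    by apply: cvgB; [exact: cvg_snd|exact: cvg_cst].
have iphi k : lebesgue_measure.-integrable (`[(- a), a]%classic : set mR)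
    (EFin \o (fun s => phi (M k (gam s)))).
  apply: continuous_compact_integrable; first exact: segment_compact.
  apply: continuous_subspaceT => s.
  exact: (continuous_composition (@cg k) cphi).
pose J k := \int[lebesgue_measure]_(s in `[(- a), a]) phi (M k (gam s)).
have JE k : (\int[lebesgue_measure]_(s in `[(- a)%R, a]) (phi (M k (gam s)))%:E = (J k)%:E)%E.
  by rewrite /J /Rintegral fineK//; exact: integrable_fin_num (iphi k).
rewrite [in RHS](eq_bigr (fun k => (J k)%:E))// sumEFin/=.
rewrite (eq_bigr (fun k => (rho * J k)%:E)); first by rewrite sumEFin/= mulr_sumr.
move=> k _; rewrite integral_sector// integral_substitution//.
under eq_integral do rewrite EFinM.
by rewrite integralZl; [rewrite JE|exact: measurable_itv|exact: iphi].
Qed.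

(** The identity for the constant 1/2 has integrand 1, so the area is [rho / 2] times the length of
    the boundary. *)
Lemma sectored_area : area Om = (rho * n%:R * a)%:E.
Proof.
have s1 : smooth (quadratic 2^-1 0 (0 : R * R)) by exact: smooth_quadratic.
have q1 x : quadratic 2^-1 0 0 x = 2^-1 :> R by rewrite /quadratic /=; ring.
have d0 v x : 'D_v (quadratic 2^-1 0 (0 : R * R)) x = 0.
  have [_ ->] := is_derive_quadratic 2^-1 0 (0 : R * R) x v.
  by rewrite /quadratic/= /GRing.scale/=; ring.
have mbOm : measurable (boundary Om : set cara).
  by apply: measurable_cara; exact: measurable_boundary.
have := sectored_divergence s1.
under [X in _ = _ * X]eq_Rintegral do rewrite q1.
have -> : \int[area]_(x in Om) (2 * quadratic 2^-1 0 0 x +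
    (x.1 - c.1) * dx1 (quadratic 2^-1 0 0) x +
    (x.2 - c.2) * dx2 (quadratic 2^-1 0 0) x) = \int[area]_(_ in Om) 1.
  by apply: eq_Rintegral => x _; rewrite /dx1 /dx2 !d0 q1; lra.
rewrite !Rintegral_cst// mul1r -[arclength _]/(hausdorff1 (boundary Om)).
rewrite hausdorff1_boundary/= => e.
have Afin : (area Om \is a fin_num)%E.
  by rewrite ge0_fin_numE//; exact: area_bounded OmK.
rewrite -(fineK Afin) e; congr (_%:E); lra.
Qed.

Lemma sectored_T_functional (m : R) : (0 < n)%N ->
  (\int[lebesgue_measure]_(s in `[(- a)%R, a])
     ((gam s).1 ^+ 2 + (gam s).2 ^+ 2)%:E = m%:E)%E ->
  T_functional Om = (- (rho * n%:R * m / 32))%:E.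
Proof.
move=> n0 gm.
rewrite (T_functional_moment (c := c) (rho := rho) (K := K)) //; last 3 first.
- by rewrite hausdorff1_boundary lte_fin !mulr_gt0// ltr0n.
- by rewrite hausdorff1_boundary ltry.
- exact: sectored_divergence.
congr (_%:E).
set J := Rintegral _ _ _.
suff e : 4 * J = rho * (n%:R * m) by lra.
(* This is [|x - c|^2], homogeneous of degree 2 about [c]: the interior integrand is [4 q], and the
   second moment becomes a boundary integral. *)
pose q := quadratic (c.1 ^+ 2 + c.2 ^+ 2) 1 ((- 2) *: c).
have sq : smooth q by exact: smooth_quadratic.
have qE x : q x = (x.1 - c.1) ^+ 2 + (x.2 - c.2) ^+ 2.
  by rewrite /q /quadratic/= /GRing.scale/=; ring.
have d1 x : dx1 q x = 2 * (x.1 - c.1).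
  have [_ e] := is_derive_quadratic (c.1 ^+ 2 + c.2 ^+ 2) 1 ((- 2) *: c) x (1, 0).
  by rewrite /dx1 /q e /quadratic /= /GRing.scale/=; ring.
have d2 x : dx2 q x = 2 * (x.2 - c.2).
  have [_ e] := is_derive_quadratic (c.1 ^+ 2 + c.2 ^+ 2) 1 ((- 2) *: c) x (0, 1).
  by rewrite /dx2 /q e /quadratic /= /GRing.scale/=; ring.
have := sectored_divergence sq.
have -> : \int[area]_(x in Om) (2 * q x + (x.1 - c.1) * dx1 q x + (x.2 - c.2) * dx2 q x) =
    \int[area]_(x in Om) (4 * ((x.1 - c.1) ^+ 2 + (x.2 - c.2) ^+ 2)).
  by apply: eq_Rintegral => x _; rewrite d1 d2 qE; ring.
have cq : continuous (fun x : R * R => (x.1 - c.1) ^+ 2 + (x.2 - c.2) ^+ 2).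
  by rewrite (_ : (fun x => _) = q); [exact: smooth_continuous|exact/funext].
rewrite RintegralZl//; last exact: (continuous_area_integrable mOm OmK cq).
rewrite -/J => ->; congr (_ * _).
rewrite /Rintegral integral_boundary; last exact: smooth_continuous.
rewrite (eq_bigr (fun=> m%:E)); first by rewrite sumEFin/= sumr_const card_ord mulr_natl.
move=> k _; rewrite -gm; apply: eq_integral => s _; congr (_%:E).
rewrite qE /M /frame /rotate /=.
have cs := cos2Dsin2 (al k).
transitivity ((cos (al k) ^+ 2 + sin (al k) ^+ 2) * ((gam s).1 ^+ 2 + (gam s).2 ^+ 2)).
  by ring.
by rewrite cs mul1r.
Qed.

Lemma sectored_values m : (0 < n)%N ->
  (\int[lebesgue_measure]_(s in `[(- a)%R, a])
     ((gam s).1 ^+ 2 + (gam s).2 ^+ 2)%:E = m%:E)%E ->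
  area Om = (rho * n%:R * a)%:E /\ T_functional Om = (- (rho * n%:R * m / 32))%:E.
Proof. by move=> n0 gm; split; [exact: sectored_area|exact: sectored_T_functional]. Qed.

End sectored_domain.

(** * Regular polygons *)

Section angular_sectors.
Context {R : realType}.
Implicit Types (b psi theta : R) (c p : R * R).

Definition polar (d psi : R) : R * R := (d * cos psi, d * sin psi).

Lemma rotate_polar b d psi : rotate b (polar d psi) = polar d (b + psi).
Proof. by rewrite /polar cosD sinD /rotate/=; congr (_, _); ring. Qed.

Lemma polarP p : p <> 0 ->
  exists d psi : R, [/\ 0 < d, 0 <= psi < 2 * pi & p = polar d psi].
Proof.
case: p => x y p0; pose d := Num.sqrt (x ^+ 2 + y ^+ 2).
have q0 : 0 < x ^+ 2 + y ^+ 2.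
  rewrite lt_neqAle addr_ge0 ?sqr_ge0// andbT eq_sym.
  rewrite paddr_eq0 ?sqr_ge0// !sqrf_eq0; apply/negP => /andP[/eqP x0 /eqP y0].
  by apply: p0; rewrite x0 y0.
have d0 : 0 < d by rewrite sqrtr_gt0.
have dd : d ^+ 2 = x ^+ 2 + y ^+ 2 by rewrite sqr_sqrtr// ltW.
have xd : (x / d) ^+ 2 <= 1.
  by rewrite expr_div_n dd ler_pdivrMr// mul1r lerDl sqr_ge0.
have xI : x / d \in `[(-1 : R), 1].
  by rewrite in_itv/= -ler_norml -(@ler_pXn2r _ 2) ?nnegrE// expr1n real_normK ?num_real.
have yd : 1 - (x / d) ^+ 2 = (y / d) ^+ 2.
  rewrite !expr_div_n dd -[1](@divff _ (x ^+ 2 + y ^+ 2)) ?gt_eqF// -mulrBl.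
  by congr (_ / _); ring.
have pi0 := pi_gt0 R.
have sa : sin (acos (x / d)) = `|y| / d.
  by rewrite sin_acos// yd sqrtr_sqr normrM (gtr0_norm (_ : 0 < d^-1)) ?invr_gt0.
have [a0 api] : 0 <= acos (x / d) /\ acos (x / d) <= pi.
  by split; [exact: acos_ge0|exact: acos_lepi].
have [y0|y0] := leP 0 y.
  exists d, (acos (x / d)); split => //; first by apply/andP; split => //; lra.
  rewrite /polar acosK// sa (ger0_norm y0).
  by congr (_, _); rewrite mulrC divfK ?gt_eqF.
exists d, (2 * pi - acos (x / d)); split => //.
  apply/andP; split; first by lra.
  rewrite ltrBlDr ltrDl lt_neqAle a0 andbT; apply/eqP => e.
  move: sa; rewrite -e sin0 => /esym/eqP; rewrite mulf_eq0 invr_eq0 (gt_eqF d0) orbF.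
  by rewrite normr_eq0 (lt_eqF y0).
rewrite /polar cosB sinB mulr_natl cos2pi sin2pi acosK// sa (ltr0_norm y0).
by congr (_, _); field; rewrite gt_eqF.
Qed.

Lemma polar_inj d e u v : 0 < d -> 0 < e -> 0 <= u < 2 * pi -> 0 <= v < 2 * pi ->
  polar d u = polar e v -> u = v :> R.
Proof.
move=> d0 e0 /andP[u0 u1] /andP[v0 v1] [xx yy].
have de : d = e.
  apply/eqP; rewrite -(@eqrXn2 _ 2) ?ltW//; apply/eqP.
  transitivity ((d * cos u) ^+ 2 + (d * sin u) ^+ 2).
    by rewrite !exprMn -mulrDr cos2Dsin2 mulr1.
  by rewrite xx yy !exprMn -mulrDr cos2Dsin2 mulr1.
move: xx yy; rewrite -de => /(mulfI (lt0r_neq0 d0)) cc /(mulfI (lt0r_neq0 d0)) ss.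
(* Equal cosines and sines give [cos (u - v) = 1], hence [sin ((u - v) / 2) = 0]; within less than
   [pi] of 0 this leaves only 0. *)
have w1 : `|(u - v) / 2| < pi.
  rewrite normrM (gtr0_norm (_ : 0 < 2^-1)) ?invr_gt0// ltr_pdivrMr// mulrC.
  by rewrite ltr_norml; apply/andP; split; lra.
have c1 : cos (u - v) = 1 by rewrite cosB cc ss -!expr2 cos2Dsin2.
have s0 : sin ((u - v) / 2) = 0.
  have := c1; rewrite [u - v in LHS]splitr cosD.
  have := cos2Dsin2 ((u - v) / 2); set C := cos _; set S := sin _ => e1 e2.
  have : S ^+ 2 = 0 by rewrite !expr2 in e1 *; lra.
  by move/eqP; rewrite sqrf_eq0 => /eqP.
have [w|w|w] := ltgtP ((u - v) / 2) 0; last by lra.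
- have := sin_gt0_pi (x := - ((u - v) / 2)).
  by rewrite sinN s0 oppr0 ltxx oppr_gt0 w/= -(ltr0_norm w) w1 => /(_ isT).
- have := sin_gt0_pi (x := (u - v) / 2).
  by rewrite s0 ltxx w/= -[X in X < pi](gtr0_norm w) w1 => /(_ isT).
Qed.

Lemma sector_polar b d u : 0 < b < pi / 2 -> 0 < d -> - b <= u < b ->
  sector (tan b) (polar d u).
Proof.
move=> /andP[b0 b2] d0 /andP[u1 u2].
have cu : 0 < cos u by apply: cos_gt0_pihalf; apply/andP; split; lra.
have cb : 0 < cos b by apply: cos_gt0_pihalf; apply/andP; split; lra.
rewrite /sector /polar/=; split; first by rewrite mulr_gt0.
have -> : tan b * (d * cos u) = d * (sin b * cos u / cos b) by rewrite /tan; ring.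
rewrite -mulrN ler_pM2l// ltr_pM2l// -mulNr ler_pdivrMr// ltr_pdivlMr//.
apply/andP; split.
  have [->|ub] := eqVneq u (- b); first by rewrite cosN sinN mulNr.
  have : 0 < sin (u + b) by apply: sin_gt0_pi; move: ub; rewrite neq_lt => /orP[|] ?; apply/andP; split; lra.
  by rewrite sinD -subr_ge0 opprK [sin b * _]mulrC => /ltW.
have : 0 < sin (b - u) by apply: sin_gt0_pi; apply/andP; split; lra.
by rewrite sinB subr_gt0 [cos b * _]mulrC.
Qed.

Lemma sector_polarP b p : 0 < b < pi / 2 -> sector (tan b) p ->
  exists d u : R, [/\ 0 < d, - b <= u < b & p = polar d u].
Proof.
move=> b02 [x0 /andP[y1 y2]]; have /andP[b0 b2] := b02.
have cu : 0 < cos (atan (p.2 / p.1)).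
  by rewrite cos_atan invr_gt0 sqrtr_gt0 ltr_wpDr// sqr_ge0.
exists (p.1 / cos (atan (p.2 / p.1))), (atan (p.2 / p.1)); split.
- by rewrite divr_gt0.
- have bI : b \in `]- (pi / 2), pi / 2[ by rewrite in_itv/=; apply/andP; split => //; lra.
  have NbI : - b \in `]- (pi / 2), pi / 2[ by rewrite in_itv/=; apply/andP; split => //; lra.
  have aI : atan (p.2 / p.1) \in `]- (pi / 2), pi / 2[.
    by rewrite in_itv/= atan_gtNpi2 atan_ltpi2.
  rewrite leNgt -(ltr_tan aI NbI) -(ltr_tan aI bI) atanK tanN -leNgt.
  by rewrite ler_pdivlMr// ltr_pdivrMr// mulNr y1.
- have e : tan (atan (p.2 / p.1)) = p.2 / p.1 by rewrite atanK.
  case: p x0 cu e {y1 y2} => x y /= x0; rewrite /tan /polar.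
  set C := cos _; set S := sin _ => cu e; congr (_, _); first by rewrite divfK ?gt_eqF.
  by rewrite mulrAC -mulrA e mulrC divfK ?gt_eqF.
Qed.

(** The odd multiple of [pi / n] points to the midpoint of the side joining the vertices at angles
    [theta + 2 k pi / n] and [theta + 2 (k + 1) pi / n]. *)
Definition sector_angle (n : nat) theta (k : 'I_n) : R :=
  theta + (k.*2.+1)%:R * (pi / n%:R).

Section covering.
Variables (n : nat) (theta : R) (c : R * R).
Hypothesis n3 : (3 <= n)%N.
Let b : R := pi / n%:R.

Let n0 : 0 < n%:R :> R. Proof. by rewrite ltr0n (leq_trans _ n3). Qed.

Lemma sector_angle_bounds : 0 < b < pi / 2.
Proof.
rewrite /b divr_gt0 ?pi_gt0//= ltr_pM2l ?pi_gt0// ltf_pV2 ?posrE//.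
by rewrite (ltr_nat R 2 n).
Qed.

Lemma sector_cover x : x <> c ->
  exists k : 'I_n, sector (tan b) (unframe c (sector_angle theta k) x).
Proof.
move=> xc; have /andP[b0 b2] := sector_angle_bounds.
have p0 : unframe c theta x <> 0.
  by move=> e; apply: xc; rewrite -(unframeK c theta x) e /frame /rotate/= !mulr0 subrr !addr0; case: (c).
have [d [psi [d0 /andP[psi0 psi2] e]]] := polarP p0.
have bn : 2 * b * n%:R = 2 * pi by rewrite /b -mulrA divfK ?gt_eqF.
have u0 : 0 <= psi / (2 * b) by rewrite divr_ge0// mulr_ge0// ltW.
have /andP[k1 k2] := truncn_itv u0.
(* Sectors have opening [2 b], so the integer part of [psi / (2 b)] is the index of the sector that
   contains the angle. *)
set k := Num.truncn (psi / (2 * b)) in k1 k2.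
have b20 : 0 < 2 * b by rewrite mulr_gt0.
rewrite ler_pdivlMr// in k1; rewrite ltr_pdivrMr// in k2.
have kn : (k < n)%N.
  by rewrite -(ltr_nat R) -(@ltr_pM2r _ (2 * b))// (le_lt_trans k1)// [ltRHS]mulrC bn.
exists (Ordinal kn).
have -> : unframe c (sector_angle theta (Ordinal kn)) x = polar d (psi - (k.*2.+1)%:R * b).
  rewrite -(unframeK c theta x) e /sector_angle/= /unframe /frame ![_ + _ - _]addrAC !subrr !add0r.
  rewrite -[X in rotate _ X]/(rotate theta (polar d psi)) !rotate_polar; congr polar.
  by rewrite /b; ring.
apply: sector_polar => //; first exact: sector_angle_bounds.
move: k1 k2; rewrite -!natr1 -muln2 natrM => ? ?; apply/andP; split; lra.
Qed.

(** Measured from [theta], the [i]-th sector is the angular interval from [2 i b] to [2 (i + 1) b].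
    These are disjoint inside one turn, where the polar angle is unique. *)
Lemma sector_inj x (j k : 'I_n) :
  sector (tan b) (unframe c (sector_angle theta j) x) ->
  sector (tan b) (unframe c (sector_angle theta k) x) -> j = k.
Proof.
have /andP[b0 b2] := sector_angle_bounds.
have bn : 2 * b * n%:R = 2 * pi by rewrite /b -mulrA divfK ?gt_eqF.
have main (i : 'I_n) : sector (tan b) (unframe c (sector_angle theta i) x) ->
    exists d u : R, [/\ 0 < d, i%:R * (2 * b) <= u < i.+1%:R * (2 * b), 0 <= u < 2 * pi &
      unframe c theta x = polar d u].
  move=> /(sector_polarP sector_angle_bounds)[d [u [d0 /andP[u1 u2] e]]].
  exists d, (u + (i.*2.+1)%:R * b); have i1 : i.+1%:R <= n%:R :> R by rewrite ler_nat.
  have i0 : 0 <= i%:R :> R by [].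
  have [w1 w2] : i%:R * (2 * b) <= u + (i.*2.+1)%:R * b /\
      u + (i.*2.+1)%:R * b < i.+1%:R * (2 * b).
    by rewrite -!natr1 -muln2 natrM; split; lra.
  have b20 : 0 < 2 * b by rewrite mulr_gt0.
  split => //.
  - exact/andP.
  - apply/andP; split; first by apply: le_trans w1; rewrite mulr_ge0// ltW.
    by apply: (lt_le_trans w2); rewrite -bn [leRHS]mulrC ler_pM2r.
  - rewrite -[LHS](unframeK c (sector_angle theta i)) in e *.
    rewrite unframeK in e.
    rewrite -(unframeK c (sector_angle theta i) x) e /unframe /frame ![_ + _ - _]addrAC !subrr !add0r.
    rewrite -[X in rotate _ X]/(rotate (sector_angle theta i) (polar d u)) !rotate_polar.
    by congr polar; rewrite /sector_angle -/b; ring.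
move=> /main[d [u [d0 /andP[u1 u2] uI e]]] /main[d' [v [d'0 /andP[v1 v2] vI e']]].
have uv : u = v by apply: (polar_inj d0 d'0) => //; rewrite -e.
rewrite -uv in v1 v2; have b20 : 0 < 2 * b by rewrite mulr_gt0.
have := le_lt_trans u1 v2; have := le_lt_trans v1 u2.
by rewrite !ltr_pM2r// !ltr_nat !ltnS => kj jk; apply/val_inj/eqP; rewrite eqn_leq jk.
Qed.

End covering.

End angular_sectors.

(** * Interior, closure and boundary of star-shaped sets *)

Section star_shaped.
Context {R : realType}.
Variables (A C : set (R * R)) (c : R * R).
Hypothesis oA : open A.
Hypothesis cC : closed C.
Hypothesis AC : A `<=` C.
Hypothesis star : forall x l, C x -> 0 <= l < 1 -> A (c + l *: (x - c)).

Let cvg_ray x (l0 : R) : c + l *: (x - c) @[l --> l0] --> c + l0 *: (x - c).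
Proof. by apply: cvgD; [exact: cvg_cst|apply: cvgZr_tmp; exact: cvg_id]. Qed.

(** An interior point of [C] can be pushed away from [c] by a factor [l > 1] within [C]; contracting
    back by [l^-1] lands in [A]. *)
Lemma interior_star : C° = A.
Proof.
apply/seteqP; split => [x xC|x Ax]; last first.
  by apply: (interiorS AC); move: oA; rewrite openE; apply.
have xC1 : \forall l \near (1 : R)^'+, C (c + l *: (x - c)).
  have := @cvg_ray x 1; rewrite scale1r addrCA subrr addr0 => /cvg_at_right_filter; apply.
  exact: xC.
have [l [l1 Cl]] : exists l : R, 1 < l /\ C (c + l *: (x - c)).
  by near (1 : R)^'+ => l; exists l; split; near: l; [exact: nbhs_right_gt|].
have /(star Cl) : 0 <= l^-1 < 1 by rewrite invr_ge0 invf_lt1 ?l1 ?ltW// (lt_trans ltr01).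
by rewrite addrAC subrr add0r scalerA mulVf ?scale1r ?gt_eqF ?(lt_trans ltr01)// addrCA subrr addr0.
Unshelve. all: by end_near. Qed.

Lemma closure_star : closure A = C.
Proof.
apply/seteqP; split; first by rewrite [X in _ `<=` X](closure_id C).1//; exact: closureS.
move=> x Cx U Ux.
have xU1 : \forall l \near (1 : R)^'-, U (c + l *: (x - c)).
  by have := @cvg_ray x 1; rewrite scale1r addrCA subrr addr0 => /cvg_at_left_filter; apply.
near (1 : R)^'- => l; exists (c + l *: (x - c)); split; last by near: l.
by apply: star => //; apply/andP; split; near: l; [exact: nbhs_left_ge|exact: nbhs_left_lt].
Unshelve. all: by end_near. Qed.

Lemma boundary_star : boundary A = C `\` A.
Proof. by rewrite /boundary closure_star (interior_id A).1. Qed.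

End star_shaped.

(** * The regular polygon as hull of its vertices and as intersection of half-planes *)

Section polygon.
Context {R : realType}.

Lemma natr_double (m : nat) : m.*2%:R = 2 * m%:R :> R.
Proof. by rewrite -muln2 natrM mulrC. Qed.

Lemma natr_doubleS (m : nat) : m.*2.+1%:R = 2 * m%:R + 1 :> R.
Proof. by rewrite -[LHS]natr1 natr_double. Qed.

Lemma cos_le_cos (b u : R) : 0 <= b <= pi -> b <= `|u| <= 2 * pi - b -> cos u <= cos b.
Proof.
move=> /andP[b0 bpi] /andP[u1 u2]; have pi0 := pi_gt0 R.
rewrite -cos_norm; set w := `|u| in u1 u2 *.
have [wpi|wpi] := leP w pi.
  by rewrite leNgt ltr_cos -?leNgt// in_itv/= ?b0 ?wpi ?andbT//; lra.
have -> : cos w = cos (2 * pi - w).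
  by rewrite cosB mulr_natl cos2pi sin2pi mul1r mul0r addr0.
by rewrite leNgt ltr_cos -?leNgt ?in_itv/=; [lra|apply/andP; split; lra|apply/andP; split; lra].
Qed.

(** After multiplication by [2 sin b] the cosines telescope, since [2 sin b cos u = sin (u + b) -
    sin (u - b)]; after multiplication by [- 2 sin b] the sines do. The end terms differ by a full
    turn. *)
Lemma sum_polar_eq0 (n : nat) (d theta : R) : (1 < n)%N ->
  \sum_(k < n) polar d (theta + k%:R * (2 * (pi / n%:R))) = 0.
Proof.
move=> n1; set b := pi / n%:R.
have n0 : 0 < n%:R :> R by rewrite ltr0n (leq_trans _ n1).
have bn : n%:R * (2 * b) = 2 * pi by rewrite /b; field; rewrite gt_eqF.
have b0 : 0 < b by rewrite divr_gt0 ?pi_gt0.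
have sb : sin b != 0.
  rewrite gt_eqF// sin_gt0_pi// b0/= ltr_pdivrMr// -[X in X < _]mulr1 ltr_pM2l ?pi_gt0//.
  by rewrite (ltr_nat R 1).
have c0 : \sum_(k < n) cos (theta + k%:R * (2 * b)) = 0.
  apply: (mulfI (mulf_neq0 (_ : 2 != 0) sb)) => //; rewrite mulr0 mulr_sumr.
  rewrite (eq_bigr (fun k : 'I_n => sin (theta - b + k.+1%:R * (2 * b)) - sin (theta - b + k%:R * (2 * b)))).
    rewrite -(big_mkord xpredT (fun k => sin (theta - b + k.+1%:R * (2 * b)) - sin (theta - b + k%:R * (2 * b)))).
    rewrite telescope_sumr// bn mul0r addr0 mulr_natl sinD cos2pi sin2pi.
    by rewrite mulr1 mulr0 addr0 subrr.
  move=> k _; have -> : k.+1%:R = k%:R + 1 :> R by rewrite natr1.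
  have -> : theta - b + (k%:R + 1) * (2 * b) = (theta + k%:R * (2 * b)) + b by ring.
  have -> : theta - b + k%:R * (2 * b) = (theta + k%:R * (2 * b)) - b by ring.
  by rewrite sinD sinB; ring.
have s0 : \sum_(k < n) sin (theta + k%:R * (2 * b)) = 0.
  apply: (mulfI (mulf_neq0 (_ : - 2 != 0) sb)); first by rewrite oppr_eq0.
  rewrite mulr0 mulr_sumr.
  rewrite (eq_bigr (fun k : 'I_n => cos (theta - b + k.+1%:R * (2 * b)) - cos (theta - b + k%:R * (2 * b)))).
    rewrite -(big_mkord xpredT (fun k => cos (theta - b + k.+1%:R * (2 * b)) - cos (theta - b + k%:R * (2 * b)))).
    rewrite telescope_sumr// bn mul0r addr0 mulr_natl cosD cos2pi sin2pi.
    by rewrite mulr1 mulr0 subr0 subrr.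
  move=> k _; have -> : k.+1%:R = k%:R + 1 :> R by rewrite natr1.
  have -> : theta - b + (k%:R + 1) * (2 * b) = (theta + k%:R * (2 * b)) + b by ring.
  have -> : theta - b + k%:R * (2 * b) = (theta + k%:R * (2 * b)) - b by ring.
  by rewrite cosD cosB; ring.
rewrite [LHS]surjective_pairing.
rewrite (big_morph fst (fun _ _ => erefl) erefl) (big_morph snd (fun _ _ => erefl) erefl).
by rewrite /= -!mulr_sumr c0 s0 !mulr0.
Qed.

Lemma unframe_fst c al (x : R * R) :
  (unframe c al x).1 = cos al * (x.1 - c.1) + sin al * (x.2 - c.2).
Proof. by rewrite /unframe /rotate/= cosN sinN mulNr opprK. Qed.

Lemma frame_polar (c : R * R) (al d u : R) : frame c al (polar d u) = c + polar d (al + u).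
Proof. by rewrite /frame rotate_polar. Qed.

Section regular.
Variables (n : nat) (c : R * R) (d theta : R).
Hypothesis n3 : (3 <= n)%N.
Hypothesis d0 : 0 < d.
Let b : R := pi / n%:R.
Let al := @sector_angle R n theta.
Let r := d * cos b.
Let t := tan b.
(** Indexed by naturals, so that the side of index [k] ends at [v k.+1] even for the last [k], where
    [v n] is [v 0]. *)
Let v (k : nat) : R * R := c + polar d (theta + k%:R * (2 * b)).
(** The sides lie on lines at distance [r = d cos b] from [c], the inradius; [A] and [C] are the
    open and closed intersections of the corresponding half-planes. *)
Let A : set (R * R) := [set x | forall k, (unframe c (al k) x).1 < r].
Let C : set (R * R) := [set x | forall k, (unframe c (al k) x).1 <= r].

Let n0 : 0 < n%:R :> R. Proof. by rewrite ltr0n (leq_trans _ n3). Qed.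
Let b0 : 0 < b. Proof. by have /andP[] := sector_angle_bounds (R := R) n3. Qed.
Let b2 : b < pi / 2. Proof. by have /andP[] := sector_angle_bounds (R := R) n3. Qed.
Let bn : n%:R * b = pi. Proof. by rewrite /b mulrC divfK ?gt_eqF. Qed.
Let cb : 0 < cos b.
Proof. by apply: cos_gt0_pihalf; apply/andP; split; move: b0 b2 (pi_gt0 R) => ? ? ?; lra. Qed.
Let sb : 0 < sin b.
Proof. by apply: sin_gt0_pi; apply/andP; split; move: b0 b2 (pi_gt0 R) => ? ? ?; lra. Qed.
Let t0 : 0 < t. Proof. by rewrite /t /tan divr_gt0. Qed.
Let r0 : 0 < r. Proof. by rewrite mulr_gt0. Qed.
Let rt : r * t = d * sin b. Proof. by rewrite /r /t /tan; field; rewrite gt_eqF. Qed.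

Let vE k (i : 'I_n) : v k = frame c (al i) (polar d (k%:R * (2 * b) - (i.*2.+1)%:R * b)).
Proof. by rewrite frame_polar /v /al /sector_angle -/b; congr (_ + polar _ _); ring. Qed.

Let vl (k : 'I_n) : v k = frame c (al k) (r, - (r * t)).
Proof.
rewrite (vE k k) rt /r; congr frame.
have -> : k%:R * (2 * b) - (k.*2.+1)%:R * b = - b by rewrite natr_doubleS; ring.
by rewrite /polar cosN sinN mulrN.
Qed.

Let vr (k : 'I_n) : v k.+1 = frame c (al k) (r, r * t).
Proof.
rewrite (vE k.+1 k) rt /r; congr frame.
by have -> : k.+1%:R * (2 * b) - (k.*2.+1)%:R * b = b by rewrite natr_doubleS -[k.+1%:R]natr1; ring.
Qed.

(* The angle between a vertex and the midpoint of a side is an odd multiple of [b]. *)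
Let v_le k (j : 'I_n) : (k <= n)%N -> (unframe c (al j) (v k)).1 <= r.
Proof.
move=> kn; rewrite (vE k j) frameK /polar/= ler_pM2l//.
apply: cos_le_cos; first by move: b0 b2 (pi_gt0 R) => ? ? ?; apply/andP; split; lra.
suff main m : 1 <= m -> m + 1 <= n%:R * 2 -> b <= `|m * b| <= 2 * pi - b.
  have [kj|jk] := leqP k j.
    have -> : k%:R * (2 * b) - (j.*2.+1)%:R * b = - (((j - k).*2.+1)%:R * b).
      by rewrite !natr_doubleS natrB//; ring.
    rewrite normrN; apply: main; first by rewrite (ler_nat R 1).
    rewrite natr1 -natrM ler_nat muln2 -doubleS leq_double.
    by rewrite (leq_trans _ (ltn_ord j))// ltnS leq_subr.
  have -> : k%:R * (2 * b) - (j.*2.+1)%:R * b = ((k - j)%:R * 2 - 1) * b.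
    by rewrite natr_doubleS natrB 1?ltnW//; ring.
  have e1 : 1 <= (k - j)%:R :> R by rewrite (ler_nat R 1) subn_gt0.
  have e2 : (k - j)%:R <= n%:R :> R by rewrite ler_nat (leq_trans (leq_subr _ _)).
  by apply: main; lra.
move=> m1 m2; have m0 : 0 < m by rewrite (lt_le_trans _ m1).
have -> : `|m * b| = m * b by rewrite gtr0_norm// mulr_gt0.
apply/andP; split; first by rewrite -[leLHS]mul1r ler_wpM2r// ltW.
have := ler_wpM2r (ltW b0) m2; have e : n%:R * 2 * b = 2 * pi by rewrite -bn; ring.
by rewrite e mulrDl mul1r lerBrDr.
Qed.

(** Coordinates in the basis of the two vertices that bound the sector, seen from [c]; their sum is
    the fraction of the inradius reached by [p.1]. *)
Let sector_combination k p : sector t p ->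
  exists x y : R, [/\ 0 <= x, 0 <= y, (x + y) * r = p.1 &
    frame c (al k) p = c + x *: (v k - c) + y *: (v k.+1 - c)].
Proof.
move=> [p0 /andP[p1 p2]]; have rt0 : 0 < r * t by rewrite mulr_gt0.
have cr : t * r != 0 by rewrite mulf_neq0 ?gt_eqF.
exists ((t * p.1 - p.2) / (2 * (r * t))), ((t * p.1 + p.2) / (2 * (r * t))); split.
- by apply: divr_ge0; [rewrite subr_ge0 ltW|rewrite mulr_ge0 ?ltW].
- apply: divr_ge0; last by rewrite mulr_ge0 ?ltW.
  by rewrite -lerBlDl sub0r.
- by field; rewrite !gt_eqF.
- rewrite vl vr /frame /rotate; case: c => c1 c2 /=.
  by congr (_, _); rewrite /= /GRing.scale/=; field; rewrite !gt_eqF.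
Qed.

(** Within its own sector the [k]-th constraint is the tightest: the coordinates along the two
    vertices are nonnegative, side [k] attains [r] at both of them, and [v_le] bounds every other
    side there by [r]. *)
Let sector_max k p j : sector t p -> (unframe c (al j) (frame c (al k) p)).1 <= p.1.
Proof.
move=> /(sector_combination k)[x [y [x0 y0 <- ->]]].
have e : (unframe c (al j) (c + x *: (v k - c) + y *: (v k.+1 - c))).1 =
    x * (unframe c (al j) (v k)).1 + y * (unframe c (al j) (v k.+1)).1.
  rewrite !unframe_fst/= /GRing.scale/=; ring.
by rewrite e mulrDl lerD// ler_wpM2l// v_le// ltnW.
Qed.

Let cX k : continuous (fun x => (unframe c (al k) x).1).
Proof.
by apply: (continuous_composition (@continuous_unframe _ c (al k)) (g := fst)) => x; exact: cvg_fst.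
Qed.

Let oA : open A.
Proof.
rewrite openE => x Ax.
change (\forall y \near x, forall k, (unframe c (al k) y).1 < r).
apply: (@filter_forall _ 'I_n (fun k => [set y | (unframe c (al k) y).1 < r]) (nbhs x) _) => k.
have o : open ((fun x => (unframe c (al k) x).1) @^-1` [set u | u < r]).
  by apply: open_comp => [? _|]; [exact: cX|exact: open_lt].
by move: o; rewrite openE; apply; exact: Ax.
Qed.

Let cC : closed C.
Proof.
rewrite (_ : C = \bigcap_(k in [set: 'I_n]) [set x | (unframe c (al k) x).1 <= r]).
  apply: closed_bigI => k _.
  have o : closed ((fun x => (unframe c (al k) x).1) @^-1` [set u | u <= r]).
    by apply: closed_comp => [? _|]; [exact: cX|exact: closed_le].
  exact: o.
by apply/seteqP; split => [x Ax k _|x Ax k]; exact: Ax.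
Qed.

Let AC : A `<=` C. Proof. by move=> x Ax k; exact: ltW. Qed.

Let starAC x l : C x -> 0 <= l < 1 -> A (c + l *: (x - c)).
Proof.
move=> Cx /andP[l0 l1] k; have := Cx k; rewrite !unframe_fst/= /GRing.scale/=.
set X := _ + _ => Xr.
have -> : cos (al k) * (c.1 + l * (x.1 - c.1) - c.1) +
  sin (al k) * (c.2 + l * (x.2 - c.2) - c.2) = l * X by rewrite /X; ring.
by move: r0 => ?; have [?|?] := leP X 0; nra.
Qed.

Let bA : boundary A = C `\` A. Proof. exact: (boundary_star oA cC AC starAC). Qed.

Let vn : v n = v 0.
Proof.
rewrite /v mul0r addr0 /polar; have -> : n%:R * (2 * b) = pi *+ 2 by rewrite -bn; ring.
by rewrite cosD sinD cos2pi sin2pi !mulr1 !mulr0 subr0 addr0.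
Qed.

Let sum_delta (F : 'I_n -> R * R) k : \sum_i (i == k)%:R *: F i = F k.
Proof.
rewrite (bigD1 k)//= eqxx scale1r big1 ?addr0// => i /negPf ->.
by rewrite scale0r.
Qed.

Let sum_vertices : \sum_(k < n) v k = n%:R *: c.
Proof.
rewrite big_split/= sumr_const card_ord scaler_nat.
by rewrite (sum_polar_eq0 _ _ (ltnW n3)) addr0.
Qed.

Let C_combination x : C x -> exists (k : 'I_n) (y z : R),
  [/\ 0 <= y, 0 <= z, y + z <= 1 & x = c + y *: (v k - c) + z *: (v k.+1 - c)].
Proof.
move=> Cx; have [xc|/eqP xc] := eqVneq x c.
  exists (Ordinal (ltnW (ltnW n3))), 0, 0; split => //; by rewrite ?scale0r ?addr0 ?ler01.
have [k sk] := sector_cover theta n3 xc.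
have [y [z [y0 z0 yz e]]] := sector_combination k sk.
exists k, y, z; split => //; last by rewrite -e unframeK.
by rewrite -(ler_pM2r r0) mul1r yz; exact: Cx.
Qed.

Let hullE : convex_hull (fun k : 'I_n => v k) = C.
Proof.
apply/seteqP; split => [x [w [w0 w1 ->]] j|x /C_combination[k [y [z [y0 z0 yz ->]]]]].
  have -> : (unframe c (al j) (\sum_(k < n) w k *: v k)).1 =
      \sum_(k < n) w k * (unframe c (al j) (v k)).1.
    rewrite unframe_fst (big_morph fst (fun _ _ => erefl) erefl).
    rewrite (big_morph snd (fun _ _ => erefl) erefl).
    rewrite -[c.1]mul1r -[c.2]mul1r -w1 !mulr_suml -!sumrB !mulr_sumr -big_split/=.
    apply: eq_bigr => k _; have := unframe_fst c (al j) (v k); rewrite /= => ->.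
    by rewrite /GRing.scale/=; ring.
  rewrite -[leRHS]mul1r -w1 mulr_suml; apply: ler_sum => k _.
  by rewrite ler_wpM2l// v_le// ltnW.
pose k' : 'I_n := Ordinal (ltn_pmod k.+1 (ltnW (ltnW n3))).
have vk' : v k' = v k.+1.
  rewrite /k'/=; have := ltn_ord k; rewrite leq_eqVlt => /orP[/eqP ->|kn].
    by rewrite modnn vn.
  by rewrite modn_small.
(* The missing weight [1 - y - z] belongs to the centre, which is the mean of the vertices, so it is
   spread evenly. *)
exists (fun i => (i == k)%:R * y + (i == k')%:R * z + (1 - y - z) / n%:R); split.
- move=> i; rewrite !addr_ge0 ?mulr_ge0// ?invr_ge0 ?ler0n//.
  by rewrite -addrA -opprD subr_ge0.
- have s1 (i0 : 'I_n) (u : R) : \sum_i (i == i0)%:R * u = u.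
    by rewrite (bigD1 i0)//= eqxx mul1r big1 ?addr0// => i /negPf ->; rewrite mul0r.
  rewrite !big_split/= !s1 sumr_const card_ord -[_ / _ *+ n]mulr_natr divfK ?gt_eqF//; ring.
- under eq_bigr do rewrite !scalerDl -!scalerA.
  rewrite !big_split/= !sum_delta -!scaler_sumr sum_vertices.
  rewrite [n%:R^-1 *: _]scalerA mulVf ?gt_eqF// scale1r vk'.
  by rewrite !scalerBr !scalerBl scale1r; case: c => ? ?; case: (v k) => ? ?; case: (v k.+1) => ? ?;
    congr (_, _); rewrite /=; ring.
Qed.

Let K := `|c.1| + `|c.2| + (r + r * t).

Let C_bounded x : C x -> `|x.1| <= K /\ `|x.2| <= K.
Proof.
have rt0 : 0 < r * t by rewrite mulr_gt0.
move=> Cx; have [->|/eqP xc] := eqVneq x c.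
  by rewrite /K; have := normr_ge0 c.1; have := normr_ge0 c.2; move: r0 => ? ? ?; split; lra.
have [k sk] := sector_cover theta n3 xc; have := Cx k.
rewrite -/al -/b -/t in sk *; rewrite -{2 3}(unframeK c (al k) x).
move: (unframe _ _ _) sk => p [p0 /andP[p1 p2]] pr.
have N2 : `|p.2| <= r * t.
  have : t * p.1 <= t * r by rewrite ler_pM2l.
  by rewrite ler_norml => ?; apply/andP; split; lra.
have N1 : `|p.1| <= r by rewrite gtr0_norm.
have [C1 S1] : `|cos (al k)| <= 1 /\ `|sin (al k)| <= 1.
  by rewrite !ler_norml cos_geN1 cos_le1 sin_geN1 sin_le1.
have m (u w B : R) : `|u| <= 1 -> `|w| <= B -> `|u * w| <= B.
  by move=> u1 wB; rewrite normrM -[B]mul1r ler_pM.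
rewrite /frame /rotate/=; split.
  apply: (le_trans (ler_normD _ _)); apply: lerD; first by rewrite lerDl.
  by apply: (le_trans (ler_normB _ _)); apply: lerD; exact: m.
apply: (le_trans (ler_normD _ _)); apply: lerD; first by rewrite lerDr.
by apply: (le_trans (ler_normD _ _)); apply: lerD; exact: m.
Qed.

Lemma polygon_values : area (convex_hull (fun k : 'I_n => v k))° = (r * n%:R * (r * t))%:E /\
  T_functional (convex_hull (fun k : 'I_n => v k))° =
    (- (r * n%:R * (2 * (r ^+ 2 * (r * t) + (r * t) ^+ 3 / 3)) / 32))%:E.
Proof.
rewrite hullE (interior_star oA AC starAC).
have AP k p : sector t p -> A (frame c (al k) p) <-> p.1 < r.
  move=> sp; split => [/(_ k)|pr j]; first by rewrite frameK.
  exact: le_lt_trans (sector_max k j sp) pr.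
have rt0 : 0 < r * t by rewrite mulr_gt0.
have ed (s u : R) : edist (r, s) (r, u) = `|s - u|.
  by rewrite /edist/= subrr expr0n add0r sqrtr_sqr.
have dS (s : R) : is_derive s 1 (fun s : R => s / r) r^-1.
  by apply: is_derive_eq; rewrite /GRing.scale/= !mulr0 ?add0r ?addr0 mulr1.
have S'E : (fun s : R => s / r)^`()%classic = cst r^-1.
  by apply/funext => s; rewrite derive1E derive_val.
have sec s : s \in `[- (r * t), r * t[ -> sector t (r, s).
  by rewrite in_itv /sector/= [t * r]mulrC.
(* The arc is the side [x = r], with its ordinate as arc length; slope [s / r] and constant profile
   [r] give [r^2 r^-1 = r] for the weight. *)
apply: (@sectored_values R A c r K n al t (r * t) (cst r) (fun s => s / r) (fun s => (r, s)) snd) => //.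
- by move=> x Ax; apply: C_bounded; exact: AC.
- by move=> x; rewrite bA => -[/C_bounded].
- by move=> x xc; exact: sector_cover.
- by move=> x j k; exact: sector_inj.
- move=> k p sp; rewrite bA; split => [[Cp nA]|[s sI <-]].
    have pr : p.1 = r.
      apply/eqP; rewrite eq_le; apply/andP; split; first by have := Cp k; rewrite frameK.
      by rewrite leNgt; apply/negP => /(AP k p sp).
    have [_] := sp; rewrite pr mulrC => p2; exists p.2; first by rewrite in_itv.
    by rewrite -pr; case: (p).
  split => [j|/(AP k _ (sec s sI))/=]; last by rewrite ltxx.
  exact: (sector_max k j (sec s sI)).
- rewrite bA => -[_]; apply => k; rewrite unframe_fst !subrr !mulr0 addr0; exact: r0.
- exact: cst_continuous.
- by rewrite mulrAC mulfV ?mul1r// gt_eqF.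
- by rewrite mulNr mulrAC mulfV ?mul1r// gt_eqF.
- by move=> s u _ _ su; rewrite ltr_pM2r// invr_gt0.
- by move=> s _; rewrite S'E; exact: cst_continuous.
- by move=> s _; rewrite S'E/= expr2 mulfK// gt_eqF.
- by move=> s _ /=; rewrite mulrCA mulfV ?mulr1// gt_eqF.
- apply: continuous_pair => s; [exact: cvg_cst|exact: cvg_id].
- by move=> s u _ _; rewrite ed.
(* The side is parametrized isometrically, so any mesh works. *)
- move=> e e0; exists 1 => // s u _ _ _; rewrite ed ler_peMl//.
  by rewrite lerDl ltW.
- exact: ltnW (ltnW n3).
- pose F s := r ^+ 2 * s + s ^+ 3 / 3.
  have dF (s : R) : is_derive s 1 F (r ^+ 2 + s ^+ 2).
    by rewrite /F; apply: is_derive_eq; rewrite /GRing.scale/=; field.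
  have NN : - (r * t) <= r * t by rewrite ge0_cp// ltW.
  rewrite (@integral_derive R F (fun s => r ^+ 2 + s ^+ 2))//.
    by rewrite /F; congr (_%:E); field.
  by move=> s; apply: cvgD; [exact: cvg_cst|exact: exprn_continuous].
Qed.


End regular.

Lemma regular_polygon_values N P : (3 <= N)%N -> regular_polygon N P ->
  exists2 r : R, 0 < r & let t := tan (pi / N%:R) in
    area P = (N%:R * r ^+ 2 * t)%:E /\
    T_functional P = (- (N%:R * r ^+ 4 * (t + t ^+ 3 / 3) / 16))%:E.
Proof.
move=> n3 [c [d [theta [d0 ->]]]]; pose b : R := pi / N%:R.
have cb : 0 < cos b.
  have /andP[b0 b2] := sector_angle_bounds (R := R) n3.
  by apply: cos_gt0_pihalf; rewrite -/b in b0 b2; apply/andP; split => //; lra.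
exists (d * cos b); first by rewrite mulr_gt0.
have [aE TE] := polygon_values c theta n3 d0.
have -> : convex_hull (fun k : 'I_N =>
    (c.1 + d * cos (theta + 2 * pi * k%:R / N%:R), c.2 + d * sin (theta + 2 * pi * k%:R / N%:R))) =
    convex_hull (fun k : 'I_N => c + polar d (theta + k%:R * (2 * (pi / N%:R)))).
  congr convex_hull; apply/funext => k.
  by have -> : 2 * (pi : R) * k%:R / N%:R = k%:R * (2 * (pi / N%:R)) by ring.
split; first by rewrite aE; congr (_%:E); rewrite -/b; ring.
by rewrite TE; congr (_%:E); rewrite -/b; field.
Qed.
End polygon.

(** * The disk *)

Section trigonometry.
Context {R : realType}.
Implicit Types x y s u : R.

Lemma is_derive_gt0_lt (F D : R -> R) x y : x < y ->
  (forall s : R, x <= s <= y -> is_derive s 1 F (D s)) ->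
  (forall s, x < s < y -> 0 < D s) -> F x < F y.
Proof.
move=> xy FD D0; have cF : {within `[x, y], continuous F}.
  apply: derivable_within_continuous => s; rewrite in_itv/= => sI.
  by have [] := FD s sI.
have [s|s sI e] := MVT xy _ cF (df := D).
  by rewrite in_itv/= => /andP[? ?]; apply: FD; rewrite !ltW.
by rewrite -subr_gt0 e mulr_gt0 ?subr_gt0// D0//; move: sI; rewrite in_itv.
Qed.

Lemma sin_lt x : 0 < x < pi -> sin x < x.
Proof.
move=> /andP[x0 xpi]; pose F s := s - sin s.
have dF (s : R) : is_derive s 1 F (1 - cos s) by rewrite /F; apply: is_derive_eq.
have := is_derive_gt0_lt x0 (fun s _ => dF s); rewrite /F sin0 !subr0 subr_gt0; apply.
move=> s /andP[s0 sx]; rewrite subr_gt0 -cos0 ltr_cos// in_itv/=; apply/andP; split => //; lra.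
Qed.

Lemma mul_cos_lt_sin x : 0 < x < pi -> x * cos x < sin x.
Proof.
move=> /andP[x0 xpi]; pose F s := sin s - s * cos s.
have dF (s : R) : is_derive s 1 F (s * sin s).
  by rewrite /F; apply: is_derive_eq; rewrite /GRing.scale/=; ring.
have := is_derive_gt0_lt x0 (fun s _ => dF s); rewrite /F sin0 mul0r subr0 subr_gt0; apply.
move=> s /andP[s0 sx]; rewrite mulr_gt0// sin_gt0_pi// s0/=; lra.
Qed.

(** [x cos x < sin x], weakened through [cos^2 x <= cos x], to have a lower bound in terms of the
    sine alone. *)
Lemma sin_ge x : 0 < x < pi / 2 -> x * (1 - sin x ^+ 2) <= sin x.
Proof.
move=> /andP[x0 x2]; have pi0 := pi_gt0 R.
have c0 : 0 < cos x by apply: cos_gt0_pihalf; apply/andP; split; lra.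
apply: le_trans (ltW (mul_cos_lt_sin _)); last by apply/andP; split; lra.
have <- : cos x ^+ 2 = 1 - sin x ^+ 2 by rewrite -(cos2Dsin2 x); ring.
by rewrite ler_pM2l// expr2 ler_piMr ?cos_le1 // ltW.
Qed.

Lemma edist_polar s u : `|s - u| <= pi ->
  edist (polar 1 s) (polar 1 u) = 2 * sin (`|s - u| / 2).
Proof.
move=> sup; have S0 : 0 <= sin (`|s - u| / 2).
  by apply: sin_ge0_pi; rewrite divr_ge0//=; have := pi_gt0 R; lra.
rewrite -[RHS]ger0_norm ?mulr_ge0// -sqrtr_sqr /edist; congr Num.sqrt.
rewrite exprMn /polar/= !mul1r.
have c : cos (s - u) = 1 - 2 * sin (`|s - u| / 2) ^+ 2.
  rewrite -cos_norm [`|s - u| in LHS]splitr cosD -!expr2.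
  have := cos2Dsin2 (`|s - u| / 2); set X := cos _ ^+ 2; set Y := sin _ ^+ 2 => ?; lra.
move: c; rewrite cosB; have := cos2Dsin2 s; have := cos2Dsin2 u => ? ? ?; nra.
Qed.

Lemma edist_polar_le s u : `|s - u| <= pi -> edist (polar 1 s) (polar 1 u) <= `|s - u|.
Proof.
move=> sup; rewrite edist_polar//; have [->|su] := eqVneq s u.
  by rewrite subrr normr0 mul0r sin0 mulr0.
have w0 : 0 < `|s - u| by rewrite normr_gt0 subr_eq0.
have : sin (`|s - u| / 2) < `|s - u| / 2 by apply: sin_lt; apply/andP; split; lra.
lra.
Qed.

Lemma edist_polar_ge (e : R) s u : 0 < e -> `|s - u| <= pi / 2 ->
  edist (polar 1 s) (polar 1 u) <= Num.min 1 e ->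
  `|s - u| <= (1 + e) * edist (polar 1 s) (polar 1 u).
Proof.
have pi0 := pi_gt0 R.
move=> e0 sup; rewrite edist_polar; last by lra.
have [->|su] := eqVneq s u.
  by rewrite subrr normr0 mul0r sin0 !mulr0.
have w0 : 0 < `|s - u| by rewrite normr_gt0 subr_eq0.
have : `|s - u| / 2 * (1 - sin (`|s - u| / 2) ^+ 2) <= sin (`|s - u| / 2).
  by apply: sin_ge; apply/andP; split; lra.
have : 0 < sin (`|s - u| / 2) by apply: sin_gt0_pi; apply/andP; split; lra.
rewrite le_min; set S := sin _; set w := `|s - u| in w0 * => S0 wS /andP[S1 Se].
(* The chord is [2 S], at most 1 and at most [e], so [S^2] is at most 1/4 and [e / 4]; the loss
   [S^2 (1 + e)] is then at most [e / 2]. *)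
have k : 1 <= (1 + e) * (1 - S ^+ 2).
  have S4 : S ^+ 2 <= 4^-1 by rewrite expr2; nra.
  have Se4 : S ^+ 2 <= e / 4 by rewrite expr2; nra.
  have : e * S ^+ 2 <= e * 4^-1 by rewrite ler_pM2l.
  lra.
have w1 : w <= (1 + e) * (w * (1 - S ^+ 2)) by rewrite mulrCA ler_peMr// ltW.
have : (1 + e) * (w / 2 * (1 - S ^+ 2)) <= (1 + e) * S by rewrite ler_pM2l//; lra.
lra.
Qed.

End trigonometry.

Section disk.
Context {R : realType}.
Let b : R := pi / 4.
Let t : R := tan (pi / 4%:R).
Let al := @sector_angle R 4 0.
Let C : set (R * R) := [set x | edist x 0 <= 1].
Let h (s : R) := (Num.sqrt (1 + s ^+ 2))^-1.

Let pi0 : 0 < pi :> R. Proof. exact: pi_gt0. Qed.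
Let t1 : t = 1. Proof. by rewrite /t tan_piquarter. Qed.

Let edist0 (x : R * R) : edist x 0 = Num.sqrt (x.1 ^+ 2 + x.2 ^+ 2).
Proof. by rewrite /edist/= !subr0. Qed.

Let ce : continuous (fun x : R * R => edist x 0).
Proof.
have cq : continuous (fun x : R * R => x.1 ^+ 2 + x.2 ^+ 2).
  move=> x; apply: cvgD; rewrite expr2; under eq_fun do rewrite expr2.
    by apply: cvgM; exact: cvg_fst.
  by apply: cvgM; exact: cvg_snd.
under eq_fun do rewrite edist0.
exact: (continuous_composition cq (@sqrt_continuous R)).
Qed.

Let oA : open (@unit_disk R).
Proof.
by apply: (@open_comp _ _ (fun x : R * R => edist x 0) [set u | u < 1]) => [? _|];
  [exact: ce|exact: open_lt].
Qed.

Let cC : closed C.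
Proof.
by apply: (@closed_comp _ _ (fun x : R * R => edist x 0) [set u | u <= 1]) => [? _|];
  [exact: ce|exact: closed_le].
Qed.

Let AC : @unit_disk R `<=` C. Proof. by move=> x; exact: ltW. Qed.

Let starAC (x : R * R) l : C x -> 0 <= l < 1 -> @unit_disk R (0 + l *: (x - 0)).
Proof.
move=> Cx /andP[l0 l1]; rewrite add0r subr0 /unit_disk/= -[(0, 0)]/(0 : R * R).
have -> : edist (l *: x) 0 = l * edist x 0.
  rewrite !edist0 /GRing.scale/= /GRing.scale/= !exprMn -mulrDr sqrtrM ?sqr_ge0//.
  by rewrite sqrtr_sqr ger0_norm.
by rewrite (le_lt_trans _ l1)// ler_piMr.
Qed.

Let bA : boundary (@unit_disk R) = C `\` @unit_disk R.
Proof. exact: boundary_star oA cC AC starAC. Qed.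

Let bAE x : boundary unit_disk x <-> edist x 0 = 1 :> R.
Proof.
rewrite bA /C /unit_disk/= -[(0, 0)]/(0 : R * R); split => [[x1 /negP]|->].
  by rewrite -leNgt => x1'; apply/eqP; rewrite eq_le x1.
by split => //; rewrite ltxx.
Qed.

Let C_bounded x : C x -> `|x.1| <= 1 /\ `|x.2| <= 1.
Proof.
move=> Cx; split; apply: le_trans Cx.
  by have := edist_fst x 0; rewrite subr0.
by have := edist_snd x 0; rewrite subr0.
Qed.

Let h_gt0 s : 0 < h s.
Proof. by rewrite invr_gt0 sqrtr_gt0 ltr_wpDr// sqr_ge0. Qed.

Let hE (p : R * R) : 0 < p.1 -> edist p 0 * h (p.2 / p.1) = p.1.
Proof.
move=> p0; rewrite edist0 /h.
have -> : p.1 ^+ 2 + p.2 ^+ 2 = p.1 ^+ 2 * (1 + (p.2 / p.1) ^+ 2).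
  by field; rewrite gt_eqF.
rewrite sqrtrM ?sqr_ge0// sqrtr_sqr gtr0_norm// mulfK// gt_eqF// sqrtr_gt0.
by rewrite ltr_wpDr// sqr_ge0.
Qed.

Let cos_quarter s : s \in `[- b, b] -> 0 < cos s.
Proof.
by rewrite in_itv/= /b => /andP[? ?]; apply: cos_gt0_pihalf; move: pi0 => ?; apply/andP; split; lra.
Qed.

Let h_tan s : s \in `[- b, b] -> h (tan s) = cos s.
Proof.
move=> /cos_quarter c0; rewrite /h -cos2_tan2 ?gt_eqF// -exprVn sqrtr_sqr.
by rewrite gtr0_norm ?invrK// invr_gt0.
Qed.

Let derive_tan s : s \in `[- b, b] -> {near s, tan^`()%classic =1 (fun x : R => (cos x) ^- 2)}.
Proof.
move=> /cos_quarter c0.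
have /(_ s) := @continuous_cos R; move/cvgr_gt => /(_ _ c0).
apply: filterS => x cx; rewrite derive1E.
by have [_ ->] := is_derive_tan (lt0r_neq0 cx).
Qed.

Let edist_polar0 (d u : R) : 0 <= d -> edist (polar d u) 0 = d.
Proof.
by move=> d0; rewrite edist0/= !exprMn -mulrDr cos2Dsin2 mulr1 sqrtr_sqr ger0_norm.
Qed.

Let edist_frame0 a (p : R * R) : edist (frame 0 a p) 0 = edist p 0.
Proof.
transitivity (edist (frame 0 a p) (frame 0 a 0)); last exact: edist_frame.
by congr edist; rewrite /frame /rotate/= !mulr0 subrr !addr0.
Qed.

(** The half-angle formula recovers the parameter of the arc. The absolute value keeps the
    denominator positive on the whole plane, so that the inverse is continuous everywhere. *)
Let half_angle (s : R) : 0 < cos s -> - pi < s < pi ->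
  2 * atan (sin s / (1 + `|cos s|)) = s.
Proof.
move=> c0 /andP[s1 s2]; rewrite gtr0_norm//.
have ch : 0 < cos (s / 2) by apply: cos_gt0_pihalf; apply/andP; split; lra.
have -> : sin s / (1 + cos s) = tan (s / 2).
  have -> : 1 + cos s = 2 * cos (s / 2) ^+ 2.
    rewrite [s in LHS]splitr cosD -!expr2; have := cos2Dsin2 (s / 2).
    set X := cos _ ^+ 2; set Y := sin _ ^+ 2 => ?; lra.
  have -> : sin s = 2 * sin (s / 2) * cos (s / 2) by rewrite [s in LHS]splitr sinD; ring.
  by rewrite /tan; field; rewrite gt_eqF.
by rewrite tanK ?in_itv/=; [field|apply/andP; split; lra].
Qed.

Lemma unit_disk_T_functional : T_functional (@unit_disk R) = (- (pi / 16))%:E.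
Proof.
have I (s : R) : s \in `[- b, b[ -> s \in `[- b, b] by exact: subset_itv_co_cc.
have b02 : 0 < (pi : R) / 4%:R < pi / 2.
  exact: (sector_angle_bounds (n := 4) isT).
have cpol : continuous (polar (1 : R)).
  by apply: continuous_pair => s; apply: cvgM; [exact: cvg_cst|exact: continuous_cos|exact: cvg_cst|exact: continuous_sin].
have diff (s u : R) : s \in `[- b, b] -> u \in `[- b, b] -> `|s - u| <= pi / 2.
  by rewrite !in_itv/= /b ler_norml => /andP[? ?] /andP[? ?]; apply/andP; split; lra.
(* Quarter circles keep parameter differences within [pi / 2], as the chord estimate requires. The
   slope is [tan], and [cos^2 s] times [tan' s] gives weight 1. *)
have [] // := @sectored_values R unit_disk 0 1 1 4 al t b h tan (polar 1)
  (fun p => 2 * atan (p.2 / (1 + `|p.1|))) oA _ _ _ _ _ _ _ _ _ _ _ _ _ _ _ _ _ _ _ _ _ _ _ (2 * b).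
- by move=> x Ax; apply: C_bounded; exact: AC.
- by move=> x; rewrite bA => -[/C_bounded].
- by move=> x xc; exact: sector_cover.
- by move=> x j k; exact: sector_inj.
- move=> k p [p0 _].
  have -> : unit_disk (frame 0 (al k) p) <-> edist p 0 < 1.
    by rewrite /unit_disk/= -[(0, 0)]/(0 : R * R) edist_frame0.
  have -> : (p.1 < h (p.2 / p.1)) = (edist p 0 * h (p.2 / p.1) < h (p.2 / p.1)).
    by rewrite hE.
  by rewrite gtr_pMl.
- move=> k p sp.
  have -> : boundary unit_disk (frame 0 (al k) p) <-> edist p 0 = 1.
    by rewrite bAE edist_frame0.
  split=> [p1|[s _ <-]]; last by rewrite edist_polar0.
  have [d [u [d0 uI e]]] := sector_polarP b02 sp.
  exists u; first by rewrite in_itv.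
  by rewrite e; congr polar; rewrite -p1 e edist_polar0// ltW.
- by move=> s; rewrite in_itv => sI; exact: sector_polar.
- by move=> /bAE; rewrite edist0/= expr0n/= addr0 sqrtr0 => /esym/eqP; rewrite oner_eq0.
- move=> s; apply: cvgV; first by rewrite gt_eqF// sqrtr_gt0 ltr_wpDr// sqr_ge0.
  have cq : continuous (fun s : R => 1 + s ^+ 2).
    by move=> u; apply: cvgD; [exact: cvg_cst|exact: exprn_continuous].
  exact: (continuous_composition cq (@sqrt_continuous R)).
- by rewrite divr_gt0.
- by rewrite tanN.
- move=> s u sI uI; rewrite ltr_tan// in_itv/=.
    by move: sI pi0; rewrite in_itv/= /b => /andP[? ?] ?; apply/andP; split; lra.
  by move: uI pi0; rewrite in_itv/= /b => /andP[? ?] ?; apply/andP; split; lra.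
- by move=> s /cos_quarter /lt0r_neq0; exact: derivable_tan.
- move=> s sI; have c0 := cos_quarter sI; have ds := derive_tan sI.
  have := nbhs_singleton ds => e; rewrite /continuous_at e.
  have ds' : \forall x \near s, (cos x) ^- 2 = tan^`()%classic x.
    by apply: filterS ds => x /= ->.
  apply: cvg_trans (near_eq_cvg ds') _; apply: cvgV; first by rewrite expf_neq0// gt_eqF.
  exact: (continuous_composition (@continuous_cos R) (@exprn_continuous _ 2)).
- move=> s sI; rewrite h_tan//; have /nbhs_singleton -> := derive_tan sI.
  by rewrite mulfV// expf_neq0// gt_eqF// cos_quarter.
- move=> s sI; rewrite h_tan// /polar !mul1r /tan; congr (_, _).
  by rewrite mulrC divfK// gt_eqF// cos_quarter.
- move=> s sI; rewrite /= !mul1r half_angle//; first exact: cos_quarter.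
  by move: sI pi0; rewrite in_itv/= /b => /andP[? ?] ?; apply/andP; split; lra.
- apply: continuous_measurable_prod => p; apply: cvgM; first exact: cvg_cst.
  have cq : continuous (fun p : R * R => p.2 / (1 + `|p.1|)).
    move=> q; apply: cvgM; first exact: cvg_snd.
    apply: cvgV; first by rewrite gt_eqF// ltr_wpDr.
    by apply: cvgD; [exact: cvg_cst|apply: cvg_norm; exact: cvg_fst].
  exact: (continuous_composition cq (@continuous_atan R)).
- move=> s u sI uI; apply: edist_polar_le; apply: (le_trans (diff _ _ sI uI)); move: pi0 => ?; lra.
- move=> e e0; exists (Num.min 1 e); first by rewrite lt_min ltr01.
  by move=> s u sI uI; apply: edist_polar_ge => //; exact: diff.
- have bb : - b <= b by rewrite ge0_cp// divr_ge0// ltW.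
  rewrite (eq_integral (fun=> 1%:E)).
    rewrite (@integral_derive R id (cst 1) _ _ bb); last exact: cst_continuous.
    by congr (_%:E); ring.
  by move=> s _; rewrite /= !mul1r cos2Dsin2.
by move=> _ ->; congr (_%:E); rewrite /b; field.
Qed.

End disk.

(** * Monotonicity and limit *)

Section profile.
Context {R : realType}.
Implicit Types x y s : R.

Definition profile y : R := y * (2 + cos y) / (3 * sin y).

Lemma profile_increasing x y : 0 < x -> x < y -> y < pi -> profile x < profile y.
Proof.
move=> x0 xy ypi; pose g s : R := 2 * sin s + sin s * cos s - s - 2 * s * cos s.
have dg (s : R) : is_derive s 1 g (2 * sin s * (s - sin s)).
  rewrite /g; apply: is_derive_eq; rewrite /GRing.scale/=.
  have /eqP := cos2Dsin2 s; rewrite -subr_eq0 => /eqP e.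
  transitivity (2 * sin s * (s - sin s) + (cos s ^+ 2 + sin s ^+ 2 - 1)); last by rewrite e addr0.
  by ring.
have g0 s : 0 < s < pi -> 0 < g s.
  move=> /andP[s0 spi]; have -> : 0 = g 0 by rewrite /g sin0; ring.
  apply: (is_derive_gt0_lt s0 (fun u _ => dg u)) => u /andP[u0 us].
  have up : 0 < u < pi by rewrite u0 (lt_trans us).
  by rewrite mulr_gt0 ?mulr_gt0 ?sin_gt0_pi// subr_gt0 sin_lt.
apply: (is_derive_gt0_lt (D := fun s => g s / (3 * sin s ^+ 2)) xy) => s /andP[xs sy].
  have s0 : 0 < sin s by rewrite sin_gt0_pi// (lt_le_trans x0)// (le_lt_trans sy).
  have nz : 3 * sin s != 0 by rewrite mulf_neq0 ?gt_eqF.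
  have dV := @is_deriveV R (fun s => 3 * sin s) s _ 1 nz _.
  rewrite /profile; apply: is_derive_eq; rewrite /GRing.scale/= /g.
  have /eqP := cos2Dsin2 s; rewrite -subr_eq0 => /eqP e.
  (* The quotient rule leaves [s (cos^2 s + sin^2 s)] where [g] has [s]; a multiple of the
     Pythagorean identity makes up the difference. *)
  rewrite -[RHS]subr0 -[X in _ = _ - X](mul0r (s / (3 * sin s ^+ 2))) -[X in _ = _ - X * _]e.
  by field; rewrite gt_eqF.
have sp : 0 < s < pi by rewrite (lt_trans x0)// (lt_trans sy).
apply: divr_gt0; first exact: g0.
by rewrite mulr_gt0// exprn_gt0// sin_gt0_pi.
Qed.

(** [g], numerator minus denominator, vanishes at 0. In half angles its derivative is [4 sin (s/2)
    (sin (s/2) - (s/2) cos (s/2))], which is positive. *)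
Lemma profile_gt1 y : 0 < y < pi -> 1 < profile y.
Proof.
move=> /andP[y0 ypi]; pose g s : R := 2 * s + s * cos s - 3 * sin s.
have dg (s : R) : is_derive s 1 g (2 * (1 - cos s) - s * sin s).
  by rewrite /g; apply: is_derive_eq; rewrite /GRing.scale/=; ring.
rewrite /profile ltr_pdivlMr ?mulr_gt0 ?sin_gt0_pi ?y0// mul1r -subr_gt0.
have -> : y * (2 + cos y) - 3 * sin y = g y by rewrite /g; ring.
have -> : 0 = g 0 by rewrite /g sin0; ring.
apply: (is_derive_gt0_lt y0 (fun u _ => dg u)) => s /andP[s0 sy].
have s2 : 0 < s / 2 < pi by apply/andP; split; lra.
have -> : sin s = 2 * sin (s / 2) * cos (s / 2) by rewrite [s in LHS]splitr sinD; ring.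
have -> : cos s = 1 - 2 * sin (s / 2) ^+ 2.
  rewrite [s in LHS]splitr cosD -!expr2; have := cos2Dsin2 (s / 2).
  set X := cos _ ^+ 2; set Y := sin _ ^+ 2 => ?; lra.
have -> : 2 * (1 - (1 - 2 * sin (s / 2) ^+ 2)) - s * (2 * sin (s / 2) * cos (s / 2)) =
  4 * sin (s / 2) * (sin (s / 2) - s / 2 * cos (s / 2)) by field.
by rewrite mulr_gt0 ?mulr_gt0 ?sin_gt0_pi// subr_gt0 mul_cos_lt_sin.
Qed.

(** From [y / sin y < 1 / cos y]: an upper bound that tends to 1 by continuity of the cosine alone,
    for the squeeze. *)
Lemma profile_lt y : 0 < y < pi / 2 -> profile y < (2 + cos y) / (3 * cos y).
Proof.
move=> /andP[y0 y2]; have c0 : 0 < cos y by apply: cos_gt0_pihalf; apply/andP; split; lra.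
have yp : 0 < y < pi by apply/andP; split; lra.
have s0 := sin_gt0_pi yp.
rewrite /profile ltr_pdivlMr ?mulr_gt0// mulrAC ltr_pdivrMr ?mulr_gt0//.
have -> : y * (2 + cos y) * (3 * cos y) = 3 * (2 + cos y) * (y * cos y) by ring.
have -> : (2 + cos y) * (3 * sin y) = 3 * (2 + cos y) * sin y by ring.
by rewrite ltr_pM2l ?mulr_gt0 ?addr_gt0// mul_cos_lt_sin.
Qed.

Let ang (N : nat) : R := 2 * pi / N%:R.

Let ang_bounds N : (3 <= N)%N -> 0 < ang N < pi.
Proof.
move=> N3; have N0 : 0 < N%:R :> R by rewrite ltr0n (leq_trans _ N3).
have pi0 := pi_gt0 R.
rewrite /ang divr_gt0 ?mulr_gt0//= ltr_pdivrMr// mulrC ltr_pM2l//.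
by rewrite (ltr_nat R 2).
Qed.

Lemma cvg_profile : profile (2 * pi / N%:R) @[N --> \oo] --> (1 : R).
Proof.
have cang : ang N @[N --> \oo] --> (0 : R).
  rewrite -[0](mulr0 (2 * (pi : R))); apply: cvgM; first exact: cvg_cst.
  apply/gtr0_cvgV0; last exact: cvgr_idn.
  by exists 1%N => // n /=; rewrite ltr0n.
have ccos : cos (ang N) @[N --> \oo] --> (1 : R).
  by rewrite -(@cos0 R); apply: (cvg_comp _ _ cang); exact: continuous_cos.
apply: (@squeeze_cvgr _ _ _ _ (fun=> 1) (fun N => (2 + cos (ang N)) / (3 * cos (ang N)))).
(* From 5 sides on, [2 pi / N] is strictly below [pi / 2]; at 4 it equals it. *)
- exists 5%N => // N /= N5; have N0 : 0 < N%:R :> R by rewrite ltr0n (leq_trans _ N5).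
  have pi0 := pi_gt0 R.
  have aN : 0 < ang N < pi / 2.
    rewrite /ang divr_gt0 ?mulr_gt0//= ltr_pdivrMr//.
    have : 5 <= N%:R :> R by rewrite (ler_nat R 5).
    by nra.
  rewrite -[2 * pi / _]/(ang N) !ltW ?profile_lt ?profile_gt1//.
  by apply: ang_bounds; exact: leq_trans N5.
- exact: cvg_cst.
- have l1 : (2 + 1) / (3 * 1) = 1 :> R by field.
  rewrite -[X in _ --> X]l1.
  apply: cvgM; first by apply: cvgD; [exact: cvg_cst|exact: ccos].
  apply: cvgV; first by rewrite mulr1.
  by apply: cvgM; [exact: cvg_cst|exact: ccos].
Qed.

Lemma regular_polygon_T_functional N P : (3 <= N)%N -> regular_polygon N P ->
  area P = (@pi R)%:E ->
  T_functional P = (- (pi / 16 * profile (2 * pi / N%:R)))%:E.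
Proof.
move=> N3 /(regular_polygon_values N3)[r r0 []] -> -> [e]; congr (_%:E).
have N0 : 0 < N%:R :> R by rewrite ltr0n (leq_trans _ N3).
have /andP[b0 b2] := sector_angle_bounds (R := R) N3; have pi0 := pi_gt0 R.
set b := pi / N%:R in e b0 b2 *.
have c0 : 0 < cos b by apply: cos_gt0_pihalf; apply/andP; split; lra.
have s0 : 0 < sin b by apply: sin_gt0_pi; apply/andP; split; lra.
have -> : 2 * pi / N%:R = b + b :> R by rewrite /b; ring.
have pN : (pi : R) = N%:R * b by rewrite /b mulrC divfK ?gt_eqF.
(* The area condition [pi = N r^2 tan b], with [pi = N b], fixes the inradius. *)
have rb : r ^+ 2 = b * cos b / sin b.
  move: e; rewrite [in RHS]pN -mulrA => /(mulfI (lt0r_neq0 N0)) bE.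
  transitivity (r ^+ 2 * tan b * cos b / sin b); last by rewrite bE.
  by rewrite /tan; field; rewrite !gt_eqF.
rewrite /profile cosD sinD -!expr2 (_ : r ^+ 4 = (r ^+ 2) ^+ 2); last by ring.
rewrite rb pN /tan.
have s2 : sin b ^+ 2 = 1 - cos b ^+ 2 by rewrite -(cos2Dsin2 b); ring.
transitivity (- (N%:R * b ^+ 2 * (3 * cos b ^+ 2 + sin b ^+ 2) / (48 * (sin b * cos b)))).
  by field; rewrite !gt_eqF.
(* [3 cos^2 b + sin^2 b = 2 + cos (2 b)], which brings in the double angle [2 pi / N]. *)
transitivity (- (N%:R * b ^+ 2 * (2 + (cos b ^+ 2 - sin b ^+ 2)) / (48 * (sin b * cos b)))).
  by congr (- (_ * _ / _)); rewrite s2; ring.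
by field; rewrite !gt_eqF// addr_gt0// mulr_gt0.
Qed.

End profile.

Theorem theorem1p3 (R : realType) (P : nat -> set (R * R))
    (hP : forall N : nat, (3 <= N)%N ->
       regular_polygon N (P N) /\ area (P N) = (@pi R)%:E) :
  [/\ \forall N \near \oo, (T_functional (P N) < T_functional (@unit_disk R))%E,
      forall N M : nat, (3 <= N)%N -> (N < M)%N ->
        (T_functional (P N) < T_functional (P M))%E &
      T_functional (P N) @[N --> \oo] --> T_functional (@unit_disk R)].
Proof.
have pi0 := pi_gt0 R.
have TP N : (3 <= N)%N -> T_functional (P N) = (- (pi / 16 * profile (2 * pi / N%:R)))%:E.
  by move=> N3; have [] := hP N N3; exact: regular_polygon_T_functional.
have aN N : (3 <= N)%N -> 0 < (2 * pi / N%:R : R) < pi.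
  move=> N3; have N0 : 0 < N%:R :> R by rewrite ltr0n (leq_trans _ N3).
  by rewrite divr_gt0 ?mulr_gt0//= ltr_pdivrMr// mulrC ltr_pM2l// (ltr_nat R 2).
rewrite unit_disk_T_functional; split.
- exists 3%N => // N /= N3; rewrite TP// lte_fin ltrN2 -[ltLHS]mulr1.
  by rewrite ltr_pM2l ?divr_gt0// profile_gt1// aN.
- move=> N M N3 NM; have M3 : (3 <= M)%N by rewrite (leq_trans N3)// ltnW.
  have N0 : 0 < N%:R :> R by rewrite ltr0n (leq_trans _ N3).
  have M0 : 0 < M%:R :> R by rewrite ltr0n (leq_trans _ M3).
  rewrite !TP// lte_fin ltrN2 ltr_pM2l ?divr_gt0//.
  have /andP[M1 _] := aN M M3; have /andP[_ N2] := aN N N3.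
  (* The angle decreases as the number of sides grows, and the minus sign in the value turns the
     order back. *)
  by apply: profile_increasing => //; rewrite ltr_pM2l ?mulr_gt0// ltf_pV2 ?posrE// ltr_nat.
- have e : \forall N \near \oo, (- (pi / 16 * profile (2 * pi / N%:R)))%:E = T_functional (P N).
    by exists 3%N => // N /= N3; rewrite TP.
  apply: cvg_trans (near_eq_cvg e) _; apply: cvg_EFin; first exact: nearW.
  rewrite -[X in _ --> - X]mulr1; apply: cvgN; apply: cvgM; first exact: cvg_cst.
  exact: cvg_profile.
Qed.
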